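(* Let $\mathfrak{S}$ denote the space of all functions $m\in C^\infty(\mathbb{R}^d\setminus\{0\})$ such that for every multi-index $\alpha$ there is $C_\alpha<\infty$ with $|\partial^\alpha m(\xi)|\le C_\alpha|\xi|^{-|\alpha|}$ for all $\xi\neq 0$. Equip $\mathfrak{S}$ with the Fréchet space topology given by the norms $$\|m\|_{(j)}=\sup_{|\alpha|\le j}\sup_{\xi\in\mathbb{R}^d\setminus\{0\}}|\xi|^{|\alpha|}|\partial^\alpha_\xi m(\xi)|,\qquad j=0,1,2,\dots$$ For $m\in\mathfrak{S}$ define the dyadic maximal operator $$M_m f(x)=\sup_{k\in\mathbb{Z}}\big|\mathcal{F}^{-1}[m(2^k\cdot)\widehat f\,](x)\big|.$$ Let $\mathcal{S}_0$ be the space of Schwartz functions on $\mathbb{R}^d$ whose Fourier transforms have compact support in $\mathbb{R}^d\setminus\{0\}$, and let $\mathfrak{S}^M$ be the set of all $m\in\mathfrak{S}$ for which there exists some $p\in(1,\infty)$ with $$\sup\{\|M_m f\|_p:\ f\in\mathcal{S}_0,\ \|f\|_p\le 1\}<\infty.$$ Then $\mathfrak{S}^M$ is of first category in $\mathfrak{S}$ in the sense of Baire.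
   Context: $\mathcal{F}^{-1}$ denotes the inverse Fourier transform on $\mathbb{R}^d$ and $\widehat f$ the Fourier transform of $f$. *)

(* Defs.v *)
From HB Require Import structures.
From mathcomp Require Import all_boot all_order all_algebra.
From mathcomp Require Import all_classical all_reals all_analysis.
From mathcomp Require Import complex.

Set Implicit Arguments.
Unset Strict Implicit.
Unset Printing Implicit Defensive.

Import Order.TTheory GRing.Theory Num.Theory.
Import numFieldNormedType.Exports.
Import ComplexField.

Local Open Scope classical_set_scope.
Local Open Scope ring_scope.

Section Defs.
Variables (R : realType) (d : nat).

Local Notation Rd := 'rV[R]_d.

Definition enorm (x : Rd) : R := Num.sqrt (\sum_(i < d) x 0 i ^+ 2).
Definition dotp (x y : Rd) : R := \sum_(i < d) x 0 i * y 0 i.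

Definition cmod (z : R[i]) : R := Num.sqrt (complex.Re z ^+ 2 + complex.Im z ^+ 2).

Definition expi (t : R) : R[i] := Complex (cos t) (sin t).

Definition ebasis (i : 'I_d) : Rd := \row_(j < d) (i == j)%:R.

Definition rD (s : seq 'I_d) (h : Rd -> R) : Rd -> R :=
  foldr (fun i (g : Rd -> R) => fun x => 'D_(ebasis i) g x) h s.

Definition cD (s : seq 'I_d) (g : Rd -> R[i]) : Rd -> R[i] :=
  fun x => Complex (rD s (fun y => complex.Re (g y)) x) (rD s (fun y => complex.Im (g y)) x).

Definition rsmooth_on (U : set Rd) (h : Rd -> R) : Prop :=
  forall s : seq 'I_d,
    (forall x, U x -> {for x, continuous (rD s h)}) /\
    (forall (i : 'I_d) x, U x -> derivable (rD s h) x (ebasis i)).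

Definition csmooth_on (U : set Rd) (g : Rd -> R[i]) : Prop :=
  rsmooth_on U (fun y => complex.Re (g y)) /\ rsmooth_on U (fun y => complex.Im (g y)).

Definition mlen (a : 'I_d -> nat) : nat := (\sum_(i < d) a i)%N.
Definition mword (a : 'I_d -> nat) : seq 'I_d :=
  flatten [seq nseq (a i) i | i <- enum 'I_d].
Definition dpow (a : 'I_d -> nat) (g : Rd -> R[i]) : Rd -> R[i] :=
  cD (mword a) g.

Definition mono (b : 'I_d -> nat) (x : Rd) : R := \prod_(i < d) x 0 i ^+ b i.

(* The symbol class frak S.  Elements are functions on R^d \ {0}; we represent
   them as functions on R^d normalised by m 0 = 0. *)
Definition Sym (m : Rd -> R[i]) : Prop :=
  m 0 = 0 /\
  csmooth_on [set xi | xi != 0] m /\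
  forall a : 'I_d -> nat, exists C : R, forall xi : Rd, xi != 0 ->
    cmod (dpow a m xi) <= C * (enorm xi) ^- (mlen a).

Definition snorm (j : nat) (m : Rd -> R[i]) : \bar R :=
  ereal_sup [set r : \bar R | exists (xi : Rd) (a : 'I_d -> nat),
    [/\ xi != 0, (mlen a <= j)%N &
         r = ((enorm xi) ^+ (mlen a) * cmod (dpow a m xi))%:E]].

Definition sball (m : Rd -> R[i]) (j : nat) (e : R) : set (Rd -> R[i]) :=
  [set m' | Sym m' /\ (snorm j (fun x => (m' x - m x)%R) < e%:E)%E].

(* A is nowhere dense in frak S (closure has empty interior), unfolded on the
   base of basic open sets *)
Definition nowhere_dense_S (A : set (Rd -> R[i])) : Prop :=
  forall m j e, Sym m -> 0 < e ->
    exists m' j' e', [/\ Sym m', 0 < e',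
      sball m' j' e' `<=` sball m j e & sball m' j' e' `&` A = set0].

Definition first_category_S (A : set (Rd -> R[i])) : Prop :=
  exists N : nat -> set (Rd -> R[i]),
    (forall n, nowhere_dense_S (N n)) /\ A `<=` \bigcup_n N n.

Fixpoint iRint (n : nat) : ('rV[R]_n -> R) -> R :=
  match n with
  | 0 => fun h => h 0
  | n'.+1 => fun h => Rintegral (@lebesgue_measure R) setT
      (fun t : R => iRint (fun v : 'rV[R]_n' => h (row_mx (\row_(_ < 1) t) v)))
  end.

Fixpoint iEint (n : nat) : ('rV[R]_n -> \bar R) -> \bar R :=
  match n with
  | 0 => fun h => h 0
  | n'.+1 => fun h => (\int[@lebesgue_measure R]_(t in setT)
      iEint (fun v : 'rV[R]_n' => h (row_mx (\row_(_ < 1) t) v)))%E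
  end.

Definition cint (g : Rd -> R[i]) : R[i] :=
  Complex (iRint (fun x => complex.Re (g x))) (iRint (fun x => complex.Im (g x))).

Definition FT (f : Rd -> R[i]) : Rd -> R[i] :=
  fun xi => cint (fun x => f x * expi (- (2 * pi * dotp x xi))).
Definition IFT (g : Rd -> R[i]) : Rd -> R[i] :=
  fun x => cint (fun xi => g xi * expi (2 * pi * dotp x xi)).

Definition Lpnorm (p : R) (g : Rd -> \bar R) : \bar R :=
  ((iEint (fun x => (`|g x| `^ p)%E)) `^ p^-1)%E.

Definition Schwartz (f : Rd -> R[i]) : Prop :=
  csmooth_on setT f /\
  forall a b : 'I_d -> nat, exists C : R, forall x : Rd,
    `|mono b x| * cmod (dpow a f x) <= C.

Definition S0 (f : Rd -> R[i]) : Prop :=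
  Schwartz f /\
  compact (closure [set xi | FT f xi != 0]) /\
  ~ closure [set xi | FT f xi != 0] 0.

Definition Mmax (m f : Rd -> R[i]) (x : Rd) : \bar R :=
  ereal_sup (range (fun k : int =>
    (cmod (IFT (fun xi => m (((2 : R) ^ k) *: xi) * FT f xi) x))%:E)).

Definition SymM (m : Rd -> R[i]) : Prop :=
  Sym m /\ exists p : R, 1 < p /\
    (ereal_sup [set Lpnorm p (Mmax m f)
               | f in [set f | S0 f /\
                   (Lpnorm p (fun x => (cmod (f x))%:E) <= 1)%E]] < +oo)%E.

End Defs.

(* Main.v *)
Require Import Defs.
From HB Require Import structures.
From mathcomp Require Import all_boot all_order all_algebra.
From mathcomp Require Import all_classical all_reals all_analysis.
From mathcomp Require Import measurable_realfun complex.
From mathcomp Require Import ring lra.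

Set Implicit Arguments.
Unset Strict Implicit.
Unset Printing Implicit Defensive.

Import Order.TTheory GRing.Theory Num.Theory.
Import numFieldNormedType.Exports.
Import ComplexField.

Local Open Scope classical_set_scope.
Local Open Scope ring_scope.

(** [SymM] is covered by the sets of symbols whose maximal operator has norm at
    most [k + 1] on some [L^p], [1 < p <= k + 1].  Given [m] and a neighbourhood,
    put [m' = m + delta * u], where [u] is a sum of bumps, one in each of finitely
    many disjoint dyadic shells, so that its symbol norms do not depend on the number
    of shells.  Test on [f(x) = S(x_0) * prod_i g(x_i)], where
    [S(t) = sum_(l < N) exp(2 pi i L 2^l t)] is lacunary and [FT g] lives in [[-1, 1]]:
    for huge [L] the dilated multipliers act on the l-th summand almost as the scalars
    [m'(2^(N i + l) e_0)].  These are adjusted so that for every [x] some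
    dilation aligns the [N] summands, whence [Mmax m' f >= c delta N |g~|], where
    [g~] is [g] filtered twice; this survives small perturbations of [m'].  But
    [|S|^2] has mean [N], so that [|S / N|^p <= r + |S / N|^2 / r] shows that the
    [L^p] norm of [f] is [o(N)], uniformly for [p] in bounded intervals.

    Fourier inversion is never used: it is enough that [FT g] has compact support and that
    the cosine transform of [FT g] does not vanish identically. *)

(** * Integrals of quadratically decaying functions on the line *)

(** Aligning the [N] summands separately at every real [x_0] would need infinitely many shells, but
    [S] depends only on [L x_0] modulo 1. It is enough to align at [I] equally spaced nodes of the
    circle: block [i] of [N] consecutive shells serves node [i], and [I] is so large that moving to
    a node at distance [1 / I] costs at most half of the gain. Hence [N * I] shells, a number that
    may be as large as needed. [L] is chosen after the perturbed symbol, as a power of two: dilation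
    by [2^(N i) / L] carries the frequency [L 2^l e_0] exactly to [2^(N i + l) e_0] and shrinks the
    unit box around it to a size on which the symbol is nearly constant. With [N = M^2] and
    [r = 1 / M] the two terms bounding the mean of [|S / N|^p] are both of order [1 / M]. A level
    bounds [p] and the operator norm together because [M] is fixed before the nearby symbol, hence
    before its exponent [p], is known. *)

Section IntegrableLine.
Variable R : realType.
Implicit Types (h b : R -> R) (t s c K : R).
Local Notation mu := (@lebesgue_measure R).
Local Notation W := (fun t : R => (oneDsqr t)^-1).

Lemma oneDsqrV_gt0 t : 0 < W t.
Proof. by rewrite invr_gt0 (lt_le_trans ltr01). Qed.

Lemma measurable_oneDsqrV : measurable_fun [set: R] (fun t => (W t)%:E).
Proof.
apply/measurable_EFinP.
by apply: continuous_measurable_fun => t; exact: continuous_oneDsqrV.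
Qed.

Lemma integral_oneDsqrV : (\int[mu]_x (W x)%:E = pi%:E)%E.
Proof.
rewrite ge0_symfun_integralT; first last.
- by move=> x; rewrite /= /oneDsqr sqrrN.
- by move=> x; exact: continuous_oneDsqrV.
- by move=> x; rewrite ltW// oneDsqrV_gt0.
rewrite (_ : [set x | _] = `[0, +oo[%classic); last first.
  by apply/seteqP; split => x /=; rewrite in_itv/= andbT.
by rewrite integral0y_oneDsqr -EFinM; congr EFin; field.
Qed.

Lemma integrable_oneDsqrV : mu.-integrable setT (EFin \o W).
Proof.
apply/integrableP; split; first exact: measurable_oneDsqrV.
under eq_integral => x _.
  rewrite /= ger0_norm; last by rewrite ltW// oneDsqrV_gt0.
over.
by rewrite integral_oneDsqrV ltry.
Qed.

(** A single class serves the integrability side conditions on the line: it is stable under sums,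
    translations and bounded continuous factors, and it contains the compactly supported continuous
    functions as well as the cosine transforms of test functions. *)
Definition quad_decay h := continuous h /\ exists C, forall t, `|h t| <= C * W t.

Lemma quad_decay_cont h : quad_decay h -> continuous h. Proof. by case. Qed.

Lemma integrable_scaled_oneDsqrV C : mu.-integrable setT (EFin \o (fun t => C * W t)).
Proof. by apply: (integrableZl measurableT C integrable_oneDsqrV). Qed.

Lemma quad_decay_integrable h : quad_decay h -> mu.-integrable setT (EFin \o h).
Proof.
move=> [ch [C hC]].
apply: (le_integrable measurableT _ _ (integrable_scaled_oneDsqrV C)).
  by apply/measurable_EFinP; exact: continuous_measurable_fun.
move=> t _ /=; rewrite lee_fin.
by rewrite (le_trans (hC t))// ler_norm.
Qed.

Lemma quad_decayD h1 h2 : quad_decay h1 -> quad_decay h2 -> quad_decay (fun t => h1 t + h2 t).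
Proof.
move=> [c1 [C1 H1]] [c2 [C2 H2]]; split.
  by move=> t; apply: cvgD; [exact: c1|exact: c2].
exists (C1 + C2) => t.
by rewrite mulrDl (le_trans (ler_normD _ _))// lerD.
Qed.

Lemma quad_decay_mulb h b K : continuous b -> (forall t, `|b t| <= K) ->
  quad_decay h -> quad_decay (fun t => b t * h t).
Proof.
move=> cb bK [ch [C H]]; split.
  by move=> t; apply: cvgM; [exact: cb|exact: ch].
exists (K * C) => t; rewrite normrM -mulrA.
by apply: ler_pM.
Qed.

Lemma quad_decayZ h c : quad_decay h -> quad_decay (fun t => c * h t).
Proof.
by move=> dh; apply: (@quad_decay_mulb _ (fun=> c) `|c|) => // t; exact: cvg_cst.
Qed.

Lemma quad_decayN h : quad_decay h -> quad_decay (fun t => - h t).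
Proof.
by move=> /(quad_decayZ (-1)); under eq_fun do rewrite mulN1r.
Qed.

Lemma quad_decayB h1 h2 : quad_decay h1 -> quad_decay h2 -> quad_decay (fun t => h1 t - h2 t).
Proof. by move=> d1 d2; apply: quad_decayD => //; exact: quad_decayN. Qed.

Lemma quad_decay0 : quad_decay (fun=> 0).
Proof.
by split; [exact: cst_continuous|exists 0 => t; rewrite normr0 mul0r].
Qed.

Lemma quad_decay_norm h : quad_decay h -> quad_decay (fun t => `|h t|).
Proof.
move=> [ch [C H]]; split; first by move=> t; apply: cvg_norm; exact: ch.
by exists C => t; rewrite normr_id.
Qed.

(** The uniform constant matters: it is the factor lost when the mean of [|S|^2] is computed by
    averaging over translations. After clearing denominators the difference is
    [(2 t + 3 s)^2 / 2 + 2 - 3 s^2 / 2], nonnegative for [|s| <= 1]. *)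
Lemma oneDsqrV_shift t s : `|s| <= 1 -> W (t + s) <= 3 * W t.
Proof.
move=> s1; rewrite -[3]invrK -invfM lef_pV2 ?posrE; last 2 first.
- by rewrite (lt_le_trans ltr01).
- by rewrite mulr_gt0// ?invr_gt0// (lt_le_trans ltr01).
rewrite /oneDsqr mulrC ler_pdivrMr//.
have : s ^+ 2 <= 1 by rewrite -(real_normK (num_real s)) exprn_ile1.
have := sqr_ge0 (2 * t + 3 * s); have := sqr_ge0 t; have := sqr_ge0 s; nra.
Qed.

Lemma quad_decay_shift h s : quad_decay h -> quad_decay (fun t => h (t + s)).
Proof.
move=> [ch [C H]]; split.
  move=> t; apply: (@continuous_comp _ _ _ (fun t => t + s) h); last exact: ch.
  by apply: cvgD; [exact: cvg_id|exact: cvg_cst].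
have C0 : 0 <= C.
  have := le_trans (normr_ge0 _) (H 0).
  by rewrite pmulr_lge0 ?oneDsqrV_gt0.
(* The factor comes from [t^2 <= 2 (t + s)^2 + 2 s^2]. *)
have sP : 0 < 2 + 2 * s ^+ 2 by have := sqr_ge0 s; lra.
exists (C * (2 + 2 * s ^+ 2)) => t; rewrite (le_trans (H _))// -mulrA.
rewrite ler_wpM2l//.
rewrite -[_ + _ * _]invrK -invfM lef_pV2 ?posrE; last 2 first.
- by rewrite (lt_le_trans ltr01).
- by rewrite mulr_gt0 ?invr_gt0// (lt_le_trans ltr01).
rewrite mulrC ler_pdivrMr// /oneDsqr.
have := sqr_ge0 (t + 2 * s); have := sqr_ge0 (s * (t + s)).
have := sqr_ge0 t; have := sqr_ge0 s; nra.
Qed.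

Lemma quad_decay_bounded_supp h (B : R) : continuous h -> (forall t,
  B < `|t| -> h t = 0) -> quad_decay h.
Proof.
move=> ch hB; split => //.
have [B0|B0] := ltP B 0.
  by exists 0 => t; rewrite hB ?normr0 ?mul0r// (lt_le_trans B0).
have BB : - B <= B by lra.
have nh : {within `[- B, B], continuous (fun t => `|h t|)}.
  by apply: continuous_subspaceT => t; apply: cvg_norm; exact: ch.
have [c _ hc] := EVT_max BB nh.
exists (`|h c| * oneDsqr B) => t.
have [tB|tB] := ltP B `|t|.
  rewrite hB// normr0; apply: mulr_ge0; last exact: ltW (oneDsqrV_gt0 _).
  by apply: mulr_ge0 => //; exact: le_trans ler01 _.
have := hc t; rewrite in_itv/= -ler_norml tB => /(_ isT) h1.
rewrite -mulrA (le_trans h1)// ler_peMr//.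
rewrite ler_pdivlMr ?(lt_le_trans ltr01)// mul1r /oneDsqr lerD2l.
by rewrite -(real_normK (num_real t)) ler_sqr ?nnegrE.
Qed.

Lemma Rintegral_ge0T h : (forall t, 0 <= h t) -> 0 <= \int[mu]_t h t.
Proof. by move=> h0; apply: Rintegral_ge0 => t _. Qed.

Lemma le_Rintegral_decay h1 h2 : quad_decay h1 -> quad_decay h2 -> (forall t, h1 t <= h2 t) ->
  \int[mu]_t h1 t <= \int[mu]_t h2 t.
Proof. by move=> d1 d2 h12; apply: le_Rintegral => //; exact: quad_decay_integrable. Qed.

Lemma le_normr_Rintegral_decay h : quad_decay h -> `|\int[mu]_t h t| <= \int[mu]_t `|h t|.
Proof. by move=> dh; apply: le_normr_Rintegral => //; exact: quad_decay_integrable. Qed.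

Lemma RintegralD_decay h1 h2 : quad_decay h1 -> quad_decay h2 ->
  \int[mu]_t (h1 t + h2 t) = \int[mu]_t h1 t + \int[mu]_t h2 t.
Proof. by move=> d1 d2; apply: RintegralD => //; exact: quad_decay_integrable. Qed.

Lemma RintegralZl_decay h c : quad_decay h -> \int[mu]_t (c * h t) = c * \int[mu]_t h t.
Proof. by move=> dh; apply: RintegralZl => //; exact: quad_decay_integrable. Qed.

Lemma RintegralB_decay h1 h2 : quad_decay h1 -> quad_decay h2 ->
  \int[mu]_t (h1 t - h2 t) = \int[mu]_t h1 t - \int[mu]_t h2 t.
Proof. by move=> d1 d2; apply: RintegralB => //; exact: quad_decay_integrable. Qed.

Lemma integral_decay h : quad_decay h -> (\int[mu]_t (h t)%:E = (\int[mu]_t h t)%:E)%E.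
Proof. by move=> dh; rewrite fineK//; apply: integrable_fin_num => //;
  exact: quad_decay_integrable. Qed.

Lemma Rintegral_gt0_decay h t0 : quad_decay h -> (forall t, 0 <= h t) -> 0 < h t0 ->
  0 < \int[mu]_t h t.
Proof.
move=> dh h0 ht0.
have : \forall t \near t0, h t0 / 2 < h t.
  have /cvgrPdist_lt/(_ (h t0 / 2)) := @quad_decay_cont _ dh t0.
  move=> /(_ ltac:(by rewrite divr_gt0)); apply: filterS => t.
  by rewrite ltr_distlC => /andP[+ _]; lra.
move=> /nbhs_ballP[e /= e0 he].
have e2 : 0 < e / 2 by rewrite divr_gt0.
apply: (@lt_le_trans _ _ (\int[mu]_(t in `[t0 - e / 2, t0 + e / 2]) (h t0 / 2))).
  rewrite Rintegral_cst//= lebesgue_measure_itv /= lte_fin ifT; last lra.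
  by rewrite -EFinB /= mulr_gt0//; lra.
apply: (@le_trans _ _ (\int[mu]_(t in `[t0 - e / 2, t0 + e / 2]) h t)).
  apply: le_Rintegral => //.
  - apply: continuous_compact_integrable; first exact: segment_compact.
    by apply: continuous_subspaceT => ?; exact: cvg_cst.
  - by apply: (integrableS measurableT) => //; exact: quad_decay_integrable.
  - move=> t /= /[!in_itv]/= /andP[a b]; apply/ltW/he.
    by rewrite /ball/= ltr_norml; apply/andP; split; lra.
rewrite /Rintegral fine_le//.
- apply: integrable_fin_num => //; apply: (integrableS measurableT) => //.
  exact: quad_decay_integrable.
- by apply: integrable_fin_num => //; exact: quad_decay_integrable.
apply: ge0_subset_integral => //.
  by apply/measurable_EFinP; apply: continuous_measurable_fun; exact: quad_decay_cont.
by move=> t _; rewrite lee_fin.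
Qed.

(* [s + e * t] with [e = -1] or [e = 1]: reflections and translations at once. *)
Lemma Rintegral_isometry h (e : bool) s : quad_decay h ->
  \int[mu]_t h (s + (-1) ^+ e * t) = \int[mu]_t h t.
Proof.
move=> dh.
pose phi : measurableTypeR R -> measurableTypeR R := fun t => s + (-1) ^+ e * t.
have cphi : continuous phi.
  move=> t; apply: cvgD; first exact: cvg_cst.
  by apply: cvgM; [exact: cvg_cst|exact: cvg_id].
have mphi : measurable_fun [set: measurableTypeR R] phi by exact: continuous_measurable_fun.
(* Half-open intervals []a, b]] determine Lebesgue measure; the reflection turns them into [[s - b,
   s - a[], so the two signs are treated apart. *)
have phimu A : measurable A -> mu A = pushforward mu phi A.
  move=> mA; apply/lebesgue_measure_unique => //= _ [[a b] _ <-];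
    rewrite /pushforward /= lebesgue_measure_itv /= lte_fin.
  case: e @phi cphi mphi => phi cphi mphi.
    rewrite (_ : phi @^-1` _ = `[s - b, s - a[%classic); last first.
      by apply/seteqP; split => t; rewrite /phi /= !in_itv/= expr1 => /andP[? ?];
        apply/andP; split; lra.
    rewrite lebesgue_measure_itv /= lte_fin (_ : (s - b < s - a) = (a < b));
      last by apply/idP/idP; lra.
    by case: ifP => // _; rewrite -!EFinB; congr EFin; lra.
  rewrite (_ : phi @^-1` _ = `]a - s, b - s]%classic); last first.
    by apply/seteqP; split => t; rewrite /phi /= !in_itv/= expr0 => /andP[? ?]; apply/andP;
      split; lra.
  rewrite lebesgue_measure_itv /= lte_fin (_ : (a - s < b - s) = (a < b));
    last by apply/idP/idP; lra.
  by case: ifP => // _; rewrite -!EFinB; congr EFin; lra.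
have mh : measurable_fun [set: measurableTypeR R] (EFin \o h).
  by have /integrableP[] := quad_decay_integrable dh.
have eqm f : (\int[mu]_x f x = \int[pushforward mu phi]_x f x)%E.
  by apply: eq_measure_integral => A mA _; exact: phimu.
have ih : mu.-integrable (phi @^-1` setT) ((EFin \o h) \o phi).
  rewrite preimage_setT; apply/integrableP; split; first exact: measurableT_comp.
  have /integrableP[_] := quad_decay_integrable dh.
  rewrite eqm; apply: le_lt_trans; rewrite le_eqVlt; apply/orP; left; apply/eqP.
  have := @ge0_integral_pushforward _ _ _ _ _ phi mphi mu setT (fun x => `|(EFin \o h) x|%E)
    measurableT.
  rewrite preimage_setT => -> //.
  exact: measurableT_comp.
have := integral_pushforward mphi mh ih measurableT.
by rewrite -eqm preimage_setT /Rintegral => ->.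
Qed.

Lemma Rintegral_shift h s : quad_decay h -> \int[mu]_t h (t + s) = \int[mu]_t h t.
Proof.
move=> dh; rewrite -[RHS](@Rintegral_isometry h false s dh).
by apply: eq_Rintegral => t _; rewrite expr0 mul1r addrC.
Qed.

Lemma Rintegral_opp h : quad_decay h -> \int[mu]_t h (- t) = \int[mu]_t h t.
Proof.
move=> dh; rewrite -[RHS](@Rintegral_isometry h true 0 dh).
by apply: eq_Rintegral => t _; rewrite expr1 add0r mulN1r.
Qed.

Lemma Rintegral_odd h : quad_decay h -> (forall t, h (- t) = - h t) -> \int[mu]_t h t = 0.
Proof.
move=> dh oh; have := Rintegral_opp dh.
under eq_Rintegral do rewrite oh -mulN1r.
by rewrite RintegralZl_decay//; lra.
Qed.

End IntegrableLine.

(** * Smooth functions of one variable and a bump function *)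

Section SmoothLine.
Variable R : realType.
Implicit Types (h f : R -> R) (t s c x : R).

Definition smooth h := forall n x, derivable (derive1n n h) x 1.

(** Smoothness by coinduction: a class of differentiable functions stable under [derive1] replaces
    any formula for the n-th derivative, and the second conclusion transfers bounds known on the
    class to all derivatives. *)
Lemma smooth_coind (P : set (R -> R)) :
  (forall h, P h -> (forall x, derivable h x 1) /\ P (derive1 h)) ->
  forall h, P h -> smooth h /\ forall n, P (derive1n n h).
Proof.
move=> HP h Ph.
have Pn n : P (derive1n n h) by elim: n => [//|n IH]; exact: (HP _ IH).2.
by split => // n; exact: (HP _ (Pn n)).1.
Qed.

Lemma derive1nSr h n : derive1n n (derive1 h) = derive1n n.+1 h.
Proof. by rewrite /derive1n iterSr. Qed.

Lemma smooth_derive1 h : smooth h -> smooth (derive1 h).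
Proof. by move=> sh n; rewrite derive1nSr; exact: sh. Qed.

Lemma smooth_derivable h : smooth h -> forall x, derivable h x 1.
Proof. by move=> sh; exact: (sh 0%N). Qed.

Lemma smooth_continuous h : smooth h -> continuous h.
Proof.
move=> sh x; apply: differentiable_continuous; apply/derivable1_diffP.
exact: smooth_derivable.
Qed.

Lemma derive1P h x : derivable h x 1 -> is_derive x 1 h ((derive1 h) x).
Proof. by move=> dh; apply: DeriveDef => //; rewrite derive1E. Qed.

Lemma is_derive_derive1 h x l : is_derive x 1 h l -> (derive1 h) x = l.
Proof. by rewrite derive1E => -[]. Qed.

Lemma derive1_near h f x : (\forall y \near x, h y = f y) -> (derive1 h) x = (derive1 f) x.
Proof. by move=> hf; rewrite !derive1E; exact: near_eq_derive. Qed.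

Lemma is_derive_near h f x l : (\forall y \near x, h y = f y) ->
  is_derive x 1 f l -> is_derive x 1 h l.
Proof.
move=> hf [df <-]; apply: DeriveDef; last by apply: near_eq_derive.
by apply: near_eq_derivable df; move: hf; apply: filterS => y ->.
Qed.

Lemma derive1_affine h (a b : R) : (forall x, derivable h x 1) ->
  derive1 (fun t => h (a * t + b)) = (fun t => a * (derive1 h) (a * t + b)) /\
  forall x, derivable (fun t => h (a * t + b)) x 1.
Proof.
move=> dh.
have D x : is_derive x 1 (fun t => h (a * t + b)) (a * (derive1 h) (a * x + b)).
  rewrite mulrC; apply: (@is_derive1_comp _ h (fun t => a * t + b)).
    exact: derive1P.
  by apply: is_derive_eq; rewrite !(scaler1, scaler0, add0r, addr0, mulr1).
split; last by move=> x; case: (D x).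
by apply/funext => x; exact: is_derive_derive1.
Qed.

Lemma derive1D h f : (forall x, derivable h x 1) -> (forall x, derivable f x 1) ->
  derive1 (fun t => h t + f t) = (fun t => derive1 h t + derive1 f t) /\
  forall x, derivable (fun t => h t + f t) x 1.
Proof.
move=> dh df; split; last by move=> x; exact: derivableD.
by apply/funext => x; rewrite !derive1E deriveD.
Qed.

Lemma derive1M h f : (forall x, derivable h x 1) -> (forall x, derivable f x 1) ->
  derive1 (fun t => h t * f t) = (fun t => derive1 h t * f t + h t * derive1 f t) /\
  forall x, derivable (fun t => h t * f t) x 1.
Proof.
move=> dh df; split; last by move=> x; exact: derivableM.
apply/funext => x; rewrite !derive1E deriveM//.
by rewrite /GRing.scale /= addrC mulrC.
Qed.

Lemma derive1nZ_affine h (a b : R) n : smooth h ->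
  derive1n n (fun t => h (a * t + b)) = (fun t => a ^+ n * derive1n n h (a * t + b)).
Proof.
move=> sh; elim: n => [|n IH]; first by apply/funext => t; rewrite expr0 mul1r.
rewrite /derive1n iterS -/(derive1n n _) IH.
have [D1 D2] := derive1_affine a b (sh n).
apply/funext => t; rewrite derive1Ml ?D1 //.
by rewrite exprSr mulrA.
Qed.

Lemma smooth_affine h (a b : R) : smooth h -> smooth (fun t => h (a * t + b)).
Proof.
move=> sh n x; rewrite derive1nZ_affine//; apply: derivableM; first exact: derivable_cst.
exact: (derive1_affine a b (sh n)).2.
Qed.

(** The Leibniz rule leaves the set of products of two smooth functions, so the invariant class for
    [smooth_coind] is its closure under sums. *)
Inductive sum_of_products : (R -> R) -> Prop :=
| sop_mul h f : smooth h -> smooth f -> sum_of_products (fun t => h t * f t)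
| sop_add h f : sum_of_products h -> sum_of_products f ->
    sum_of_products (fun t => h t + f t).

Lemma smoothM h f : smooth h -> smooth f -> smooth (fun t => h t * f t).
Proof.
move=> sh sf; apply: (smooth_coind _ (P := sum_of_products) _).1; last exact: sop_mul.
move=> {h f sh sf} k; elim=> [h f sh sf|h f _ [dh Ph] _ [df Pf]].
  have [D1 D2] := derive1M (smooth_derivable sh) (smooth_derivable sf).
  split; first exact: D2.
  by rewrite D1; apply: sop_add; [apply: (sop_mul (smooth_derive1 sh) sf)|
    apply: (sop_mul sh (smooth_derive1 sf))].
have [D1 D2] := derive1D dh df.
by split => //; rewrite D1; exact: sop_add.
Qed.

(** Meant for the gluing point of [exp_tail]: the difference quotient at [y] is at most
    [C * |y|]. *)
Lemma is_derive_sq h (C : R) : h 0 = 0 -> (forall x, `|h x| <= C * x ^+ 2) ->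
  is_derive (0:R) (1:R) h 0.
Proof.
move=> h0 hC.
suff H : (e^-1 *: ((h \o shift (0:R)) (e *: (1:R)) - h 0)) @[e --> 0^'] --> 0.
  by apply: DeriveDef; [exact: cvgP H|exact: cvg_lim].
have C0 : 0 <= C by have := le_trans (normr_ge0 _) (hC 1); rewrite expr1n mulr1.
apply/cvgrPdist_le => e e0; near=> y.
have y0 : y != 0 by near: y; exact: nbhs_dnbhs_neq.
rewrite sub0r normrN h0 subr0 /= addr0 /GRing.scale /= mulr1 normrM normfV.
rewrite ler_pdivrMl ?normr_gt0// (le_trans (hC _))//.
rewrite -(real_normK (num_real y)) expr2 mulrA [leRHS]mulrC ler_wpM2r//.
have : `|y| <= e / (C + 1).
  near: y; apply: dnbhs0_le; rewrite divr_gt0//; lra.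
rewrite ler_pdivlMr; last lra.
have := normr_ge0 y; nra.
Unshelve. all: end_near. Qed.

(** The classical flat function [exp (- 1 / t)], with a polynomial factor in [1 / t] so that the
    family is closed under differentiation: the derivative replaces [P] by [X^2 (P - P')]. *)
Definition exp_tail (P : {poly R}) t : R :=
  if 0 < t then P.[t^-1] * expR (- t^-1) else 0.

Lemma poly_expR_bound (P : {poly R}) : exists C, forall y, 0 <= y -> `|P.[y]| <= C * expR y.
Proof.
exists (\sum_(i < size P) `|P`_i| * i`!%:R) => y y0.
rewrite horner_coef (le_trans (ler_norm_sum _ _ _))// mulr_suml ler_sum// => i _.
rewrite normrM -mulrA ler_wpM2l// normrX (ger0_norm y0) mulrC.
case: i => -[|i] /= _; first by rewrite expr0 fact0 mulr1; have := expR_ge1Dx y; lra.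
rewrite -ler_pdivrMr ?ltr0n ?fact_gt0//.
have := expR_ge1Dxn i y0; lra.
Qed.

Lemma is_derive_exp_tail (P : {poly R}) t :
  is_derive t 1 (exp_tail P) (exp_tail ('X^2 * (P - P^`())) t).
Proof.
have [t0|t0|->] := ltgtP t 0.
- rewrite /exp_tail ltNge ltW//=.
  apply: (@is_derive_near _ (cst 0)).
  by move: (lt_nbhsl t0); apply: filterS => y y0; rewrite ltNge ltW.
- apply: (@is_derive_near _ (fun t => P.[t^-1] * expR (- t^-1))).
    by move: (lt_nbhsr t0); apply: filterS => y y0; rewrite /exp_tail y0.
  rewrite /exp_tail t0.
  have D1 : is_derive t 1 (fun x : R => x^-1) (- t ^- 2).
    have := @is_deriveV _ id t 1 1 (lt0r_neq0 t0) (is_derive_id _ _).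
    by rewrite scaler1.
  have D2 : is_derive t 1 (fun x : R => P.[x^-1]) (P^`().[t^-1] * - t ^- 2).
    by apply: (@is_derive1_comp _ (horner P) (fun x => x^-1)).
  have D3 : is_derive t 1 (fun x : R => expR (- x^-1)) (expR (- t^-1) * t ^- 2).
    have D3 : is_derive t 1 (fun x : R => - x^-1) (t ^- 2).
      by have := is_deriveN D1; rewrite opprK.
    exact: (@is_derive1_comp _ expR (fun x => - x^-1)).
  have scE (a b : R) : a *: (b : R) = a * b by [].
  by apply: is_derive_eq; rewrite !scE hornerM hornerD hornerN hornerXn exprVn; ring.
- rewrite [exp_tail _ 0]/exp_tail ltxx.
  (* The extra factor ['X^2] turns the bound by [C * expR y] at [y = x^-1] into
     [|exp_tail P x| <= C * x^2]. *)
  have [C HC] := poly_expR_bound ('X^2 * P).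
  apply: (@is_derive_sq _ C); first by rewrite /exp_tail ltxx.
  have C0 : 0 <= C by have := le_trans (normr_ge0 _) (HC 0 (lexx _)); rewrite expR0 mulr1.
  move=> x; rewrite /exp_tail; case: ifPn => [x0|_]; last first.
    by rewrite normr0 mulr_ge0// sqr_ge0.
  have := HC x^-1; rewrite invr_ge0 ltW// => /(_ isT).
  rewrite expRN normrM (ger0_norm (x := (expR _)^-1)) ?invr_ge0 ?expR_ge0//.
  rewrite ler_pdivrMr ?expR_gt0// hornerM hornerXn normrM.
  rewrite (ger0_norm (sqr_ge0 _)) exprVn mulrC ler_pdivrMr ?exprn_gt0// => /le_trans -> //.
  by rewrite mulrAC.
Unshelve. all: end_near. Qed.

Lemma smooth_exp_tail P : smooth (exp_tail P).
Proof.
apply: (smooth_coind _ (P := [set h | exists Q, h = exp_tail Q]) _).1; last by exists P.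
move=> h [Q ->]; split => [x|]; first by case: (is_derive_exp_tail Q x).
exists ('X^2 * (Q - Q^`())); apply/funext => x.
exact: is_derive_derive1 (is_derive_exp_tail Q x).
Qed.

(** The two factors vanish for [t <= -1] and [t >= 1] respectively, and the divisor makes the value
    at 0 equal to 1. Their arguments are kept in the shape [a * t + b] of [smooth_affine]. *)
Definition bump t : R := exp_tail 1 (1 * t + 1) * exp_tail 1 (- 1 * t + 1) / exp_tail 1 1 ^+ 2.

Lemma exp_tail1_gt0 t : (0 < exp_tail 1 t) = (0 < t).
Proof.
by rewrite /exp_tail; case: ifPn => // t0; rewrite ?ltxx// hornerC mul1r expR_gt0.
Qed.

Lemma exp_tail1_ge0 t : 0 <= exp_tail 1 t.
Proof. by rewrite /exp_tail; case: ifPn => // _; rewrite hornerC mul1r expR_ge0. Qed.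

Lemma smooth_cst c : smooth (fun=> c).
Proof.
apply: (smooth_coind _ (P := [set h | exists c, h = cst c]) _).1; last by exists c.
move=> h [c' ->]; split => [x|]; first exact: derivable_cst.
by exists 0; apply/funext => x; rewrite derive1_cst.
Qed.

Lemma smooth_bump : smooth bump.
Proof.
apply: smoothM; last exact: smooth_cst.
by apply: smoothM; apply: smooth_affine; exact: smooth_exp_tail.
Qed.

Lemma bump_ge0 t : 0 <= bump t.
Proof. by rewrite /bump !mulr_ge0 ?invr_ge0 ?exprn_ge0 ?exp_tail1_ge0. Qed.

Lemma bump0 : bump 0 = 1.
Proof.
rewrite /bump !mulr0 !add0r -expr2 divff// expf_neq0// gt_eqF// exp_tail1_gt0.
exact: ltr01.
Qed.

Lemma bump_supp t : 1 < `|t| -> bump t = 0.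
Proof.
rewrite /bump => t1.
suff : (exp_tail 1 (1 * t + 1) == 0) || (exp_tail 1 (-1 * t + 1) == 0).
  by case/orP => /eqP ->; rewrite !(mul0r, mulr0).
have [tp|tn] := leP 0 t.
  rewrite ger0_norm// in t1.
  by apply/orP; right; rewrite /exp_tail ifF//; apply/negbTE; rewrite -leNgt; lra.
rewrite ltr0_norm// in t1.
by apply/orP; left; rewrite /exp_tail ifF//; apply/negbTE; rewrite -leNgt; lra.
Qed.

Lemma bump_even t : bump (- t) = bump t.
Proof.
rewrite /bump [exp_tail _ _ * exp_tail _ _]mulrC.
by rewrite !mulrN !mulNr opprK.
Qed.

End SmoothLine.

(** * The cosine transform *)

Section CosineTransform.
Variable R : realType.
Implicit Types (h f F : R -> R) (t s c x : R).
Local Notation mu := (@lebesgue_measure R).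

Lemma integral_itv_cvg h : quad_decay h ->
  (\int[mu]_(x in `[(- n%:R)%R, n%:R]) (h x)%:E)%E @[n --> \oo] --> (\int[mu]_x (h x)%:E)%E.
Proof.
move=> dh.
under eq_fun do rewrite integral_mkcond.
have ih := quad_decay_integrable dh.
apply: (@dominated_cvg _ _ _ mu setT measurableT
  (fun n => (fun x => (h x)%:E) \_ `[(- n%:R)%R,
    n%:R]) (fun x => (h x)%:E) (fun x => `|h x|%:E)) => //.
- by move=> n; apply/(measurable_restrictT _ _).1 => //; apply: measurable_funTS;
  case/integrableP: ih.
- move=> x _; apply: cvg_near_cst.
  exists (Num.truncn `|x|).+1 => // n /= xn; rewrite patchE ifT//.
  rewrite inE /= in_itv /= -ler_norml ltW// (lt_le_trans (truncnS_gt _))//.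
  by rewrite ler_nat.
- have /quad_decay_integrable := quad_decay_norm dh. by [].
- move=> n x _; rewrite patchE; case: ifP => _; first by rewrite abse_EFin.
  by rewrite abse0 lee_fin.
Qed.

(** The fundamental theorem of calculus on [[-n, n]], whose boundary terms vanish in the limit. Both
    integration by parts and the vanishing of the integral of certain cosine transforms are derived
    from it. *)
Lemma Rintegral_derive1_eq0 F f : quad_decay f -> (forall x, is_derive x 1 F (f x)) ->
  (forall e : R, 0 < e -> exists B : R, forall t, B <= `|t| -> `|F t| <= e) ->
  \int[mu]_x f x = 0.
Proof.
move=> df DF F0.
apply/eqP; rewrite -normr_eq0 eq_le normr_ge0 andbT; apply/ler_addgt0Pr => e e0.
rewrite add0r.
have e2 : 0 < e / 4 by rewrite divr_gt0.
have [B HB] := F0 _ e2.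
have := integral_itv_cvg df; rewrite integral_decay// => /fine_cvgP[_].
move=> /cvgrPdist_le/(_ _ e2)[N _ HN].
pose n := (maxn N (Num.truncn `|B|).+1).+1.
have Bn : B <= n%:R.
  rewrite (le_trans (ler_norm _))// ltW// (lt_le_trans (truncnS_gt _))// ler_nat.
  by rewrite ltnW// ltnS leq_maxr.
have n0 : - n%:R < n%:R :> R by rewrite ltrNl -subr_gt0 opprK addr_gt0// ltr0n.
have := HN n; rewrite /= => /(_ (leqW (leq_maxl _ _))).
have cF : continuous F.
  by move=> x; apply: differentiable_continuous; apply/derivable1_diffP; case: (DF x).
rewrite (@continuous_FTC2 _ _ F)//=; first last.
- by move=> x _; rewrite (is_derive_derive1 (DF x)).
- split; first by move=> x _; case: (DF x).
  + by apply: cvg_at_right_filter; exact: cF.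
  + by apply: cvg_at_left_filter; exact: cF.
- by apply: continuous_subspaceT; exact: quad_decay_cont.
have F1 : `|F n%:R| <= e / 4 by apply: HB; rewrite ger0_norm.
have F2 : `|F (- n%:R)| <= e / 4 by apply: HB; rewrite normrN ger0_norm.
move=> H.
rewrite -[X in `|X|](subrK (F n%:R - F (- n%:R))).
rewrite (le_trans (ler_normD _ _))//.
have := ler_normB (F n%:R) (F (- n%:R)).
lra.
Qed.

(** One continuous derivative is all that integration by parts asks for, and all that is checked for
    the quotient [x^-1 * h x] in [Rintegral_Tr_eq0]. *)
Definition compact_C1 h := (forall x, derivable h x 1) /\ continuous (derive1 h) /\
  exists B : R, forall t, B < `|t| -> h t = 0.

Lemma near_normr_gt (B t : R) : B < `|t| -> \forall y \near t, B < `|y|.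
Proof. exact: (cvgr_gt _ (@norm_continuous _ R t)). Qed.

Lemma near_normr_lt (B t : R) : `|t| < B -> \forall y \near t, `|y| < B.
Proof. exact: (cvgr_lt _ (@norm_continuous _ R t)). Qed.

Lemma derive1_supp h (B : R) : (forall t, B < `|t| -> h t = 0) ->
  forall t, B < `|t| -> derive1 h t = 0.
Proof.
move=> hB t Bt; rewrite (@derive1_near _ h (cst 0)) ?derive1_cst//.
by apply: filterS (near_normr_gt Bt) => y /hB.
Qed.

Lemma compact_C1_continuous h : compact_C1 h -> continuous h.
Proof.
by move=> [dh _] x; apply: differentiable_continuous; apply/derivable1_diffP.
Qed.

Lemma compact_C1_decay h : compact_C1 h -> quad_decay h.
Proof.
move=> ch; have [_ [_ [B hB]]] := ch.
by apply: (quad_decay_bounded_supp _ hB); exact: compact_C1_continuous.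
Qed.

Lemma compact_C1_decay1 h : compact_C1 h -> quad_decay (derive1 h).
Proof.
by move=> [dh [c1 [B hB]]]; apply: (quad_decay_bounded_supp c1 (B := B)); exact: derive1_supp.
Qed.

Definition test_fun h := smooth h /\ exists B : R, forall t, B < `|t| -> h t = 0.

Lemma test_fun_C1 h : test_fun h -> compact_C1 h.
Proof.
move=> [sh hB]; split; first exact: smooth_derivable.
by split => //; apply: smooth_continuous; exact: smooth_derive1.
Qed.

Lemma test_fun_derive1 h : test_fun h -> test_fun (derive1 h).
Proof.
move=> [sh [B hB]]; split; first exact: smooth_derive1.
by exists B; exact: derive1_supp.
Qed.

Lemma test_fun_mulX h (k : R) : test_fun h -> test_fun (fun x => k * x * h x).
Proof.
move=> [sh [B hB]]; split; last by exists B => t /hB ->; rewrite mulr0.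
apply: smoothM; last exact: sh.
apply: (smooth_coind _ (P := [set h | exists a b : R, h = fun t => a * t + b]) _).1; last first.
  by exists k, 0; apply/funext => t; rewrite addr0.
move=> _ [a [b ->]].
have di (x : R) : derivable id x 1 by exact: derivable_id.
have [D1 D2] := derive1_affine a b di.
split => //; exists 0, a; rewrite D1; apply/funext => t.
by rewrite derive1_id mulr1 mul0r add0r.
Qed.

Lemma test_fun_affine h (a b : R) : a != 0 -> test_fun h -> test_fun (fun x => h (a * x + b)).
Proof.
move=> a0 [sh [B hB]]; split; first exact: smooth_affine.
exists ((B + `|b|) / `|a|) => t; rewrite ltr_pdivrMr ?normr_gt0// => Bt; apply: hB.
have := lerB_normD (a * t) b; rewrite normrM; nra.
Qed.

Lemma test_fun_decay h : test_fun h -> quad_decay h.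
Proof. by move=> /test_fun_C1/compact_C1_decay. Qed.

Definition phase t c x : R := 2 * pi * t * x + c.

(** The phase [c] puts the cosine transform ([c = 0]) and the sine transform ([c = - (pi / 2)]) in
    one family, on which differentiation in [t] and integration by parts both act by
    [c -> c + pi / 2]. *)
Definition cos_transform h c t : R := \int[mu]_x (cos (phase t c x) * h x).

Lemma continuous_phase t c : continuous (phase t c).
Proof.
move=> x; apply: cvgD; last exact: cvg_cst.
by apply: cvgM; [exact: cvg_cst|exact: cvg_id].
Qed.

Lemma continuous_cos_phase t c : continuous (fun x => cos (phase t c x)).
Proof.
move=> x; apply: (@continuous_comp _ _ _ (phase t c) cos); first exact: continuous_phase.
exact: continuous_cos.
Qed.

Lemma quad_decay_cos h t c : quad_decay h -> quad_decay (fun x => cos (phase t c x) * h x).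
Proof.
apply: (@quad_decay_mulb _ _ _ 1); first exact: continuous_cos_phase.
by move=> x; exact: cos_max.
Qed.

Lemma le_normr_cos h y x : `|cos y * h x| <= `|h x|.
Proof. by rewrite normrM ler_piMl// cos_max. Qed.

Lemma cos_transform_bound h c t : quad_decay h -> `|cos_transform h c t| <= \int[mu]_x `|h x|.
Proof.
move=> dh; rewrite (le_trans (le_normr_Rintegral_decay (quad_decay_cos t c dh)))//.
apply: le_Rintegral_decay; [exact/quad_decay_norm/quad_decay_cos|exact:
  quad_decay_norm|move=> x].
exact: le_normr_cos.
Qed.

Lemma cos_transform_continuous h c : quad_decay h -> continuous (cos_transform h c).
Proof.
move=> dh a; have aI : a \in `]a - 1, a + 1[%classic by rewrite inE/= in_itv/=; apply/andP;
  split; lra.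
apply: (@continuity_under_integral _ _ _ mu (fun t x => cos (phase t c x) * h x) setT
  measurableT (a - 1) (a + 1) _ _ (fun x => `|h x|) _ _ a aI).
- by move=> t _; apply: quad_decay_integrable; exact: quad_decay_cos.
- apply: aeW => y _ t _; apply: cvgM; last exact: cvg_cst.
  apply: (@continuous_comp _ _ _ (fun t => phase t c y) cos); last exact: continuous_cos.
  apply: cvgD; last exact: cvg_cst.
  by apply: cvgM; [apply: cvgM; [exact: cvg_cst|exact: cvg_id]|exact: cvg_cst].
- by apply: quad_decay_integrable; exact: quad_decay_norm.
- by move=> t _; apply: aeW => y _; exact: le_normr_cos.
Qed.

Lemma is_derive_cos_phase h c y t :
  is_derive t 1 (fun t => cos (phase t c y) * h y)
    (cos (phase t (c + pi / 2) y) * (2 * pi * y * h y)).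
Proof.
have D1 : is_derive t 1 (fun t => phase t c y) (2 * pi * y).
  rewrite /phase; apply: is_derive_eq.
  by rewrite !(scaler1, scaler0, add0r, addr0, mulr1, scale0r) /GRing.scale /= mulrC.
have D2 : is_derive t 1 (fun t => cos (phase t c y)) (- sin (phase t c y) * (2 * pi * y)).
  exact: (@is_derive1_comp _ cos (fun t => phase t c y)).
apply: is_derive_eq; rewrite scaler0 add0r /GRing.scale /=.
rewrite /phase addrA cosDpihalf -/(phase t c y); ring.
Qed.

Lemma is_derive_Tr h c t : quad_decay h -> quad_decay (fun x => 2 * pi * x * h x) ->
  is_derive t 1 (cos_transform h c) (cos_transform (fun x => 2 * pi * x * h x) (c + pi / 2) t).
Proof.
move=> dh dxh.
pose f t x := cos (phase t c x) * h x.
have tI : `]t - 1, t + 1[%classic t by rewrite /= in_itv/=; apply/andP; split; lra.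
have if_ s : `]t - 1, t + 1[%classic s -> mu.-integrable setT (EFin \o f s).
  by move=> _; apply: quad_decay_integrable; exact: quad_decay_cos.
have df s y : `]t - 1, t + 1[%classic s -> [set: R] y -> derivable (f ^~ y) s 1.
  by move=> _ _; case: (is_derive_cos_phase h c y s).
have G0 y : 0 <= `|2 * pi * y * h y| by [].
have iG : mu.-integrable setT (EFin \o (fun y => `|2 * pi * y * h y|)).
  by apply: quad_decay_integrable; exact: (quad_decay_norm dxh).
have dE s y : partial1of2 f s y = cos (phase s (c + pi / 2) y) * (2 * pi * y * h y).
  rewrite partial1of2E. by case: (is_derive_cos_phase h c y s).
have Gub s y : `]t - 1, t + 1[%classic s -> [set: R] y ->
  `|partial1of2 f s y| <= `|2 * pi * y * h y|.
  by move=> _ _; rewrite dE (le_normr_cos (fun y => 2 * pi * y * h y)).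
have D := derivable_under_integral measurableT tI if_ df G0 iG Gub.
have E := differentiation_under_integral measurableT tI if_ df G0 iG Gub.
apply: DeriveDef; first exact: D.
rewrite -derive1E; apply: (etrans E).
by apply: eq_Rintegral => y _; exact: dE.
Qed.

(** Integration by parts: [sin (phase t c x) * h x] has compact support, so its derivative has
    integral 0, and [- sin] is the cosine advanced by [pi / 2]. *)
Lemma cos_transform_derive1 h c t : compact_C1 h ->
  2 * pi * t * cos_transform h c t = cos_transform (derive1 h) (c + pi / 2) t.
Proof.
move=> ch; have dh := compact_C1_decay ch; have dh1 := compact_C1_decay1 ch.
have [der [_ [B hB]]] := ch.
pose f x := (2 * pi * t) * (cos (phase t c x) * h x) - cos (phase t (c + pi / 2) x) * derive1
  h x.
have df : quad_decay f by apply: quad_decayB; [apply: quad_decayZ|]; exact: quad_decay_cos.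
suff : \int[mu]_x f x = 0.
  rewrite RintegralB_decay ?RintegralZl_decay//;
    [|exact: quad_decay_cos|apply: quad_decayZ|]; try exact: quad_decay_cos.
  by move/eqP; rewrite subr_eq0 => /eqP.
apply: (@Rintegral_derive1_eq0 (fun x => sin (phase t c x) * h x)) => [|x|e e0].
- exact: df.
  have D1 : is_derive x 1 (phase t c) (2 * pi * t).
    by rewrite /phase; apply: is_derive_eq;
     rewrite !(scaler1, scaler0, add0r, addr0, mulr1, scale0r).
  have D2 : is_derive x 1 (fun x => sin (phase t c x)) (cos (phase t c x) * (2 * pi * t)).
    exact: (@is_derive1_comp _ sin (phase t c)).
  have D3 := derive1P (der x).
  apply: is_derive_eq; rewrite /f /GRing.scale /=.
  rewrite [in RHS]/phase addrA cosDpihalf -/(phase t c x); ring.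
exists (B + 1) => s Bs; rewrite hB ?mulr0 ?normr0 ?ltW//.
lra.
Qed.

(** Two integrations by parts bound [(2 pi t)^2] times the transform by the [L^1] norm of the second
    derivative. Since [(2 pi)^2 >= 1], adding the trivial bound controls [1 + t^2] times the
    transform. *)
Lemma cos_transform_decay h c : test_fun h -> quad_decay (cos_transform h c).
Proof.
move=> th; split; first by apply: cos_transform_continuous; exact: test_fun_decay.
have th1 := test_fun_derive1 th; have th2 := test_fun_derive1 th1.
exists (\int[mu]_x `|h x| + \int[mu]_x `|derive1 (derive1 h) x|) => t.
rewrite ler_pdivlMr ?(lt_le_trans ltr01)// /oneDsqr mulrDr mulr1.
apply: lerD; first by apply: cos_transform_bound; exact: test_fun_decay.
have := cos_transform_bound (c + pi / 2 + pi / 2) t (test_fun_decay th2).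
rewrite -cos_transform_derive1; last exact: test_fun_C1.
rewrite -cos_transform_derive1; last exact: test_fun_C1.
apply: le_trans; rewrite mulrA normrM mulrC ler_wpM2r//.
rewrite -expr2 exprMn normrM (ger0_norm (sqr_ge0 t)) ler_peMl ?sqr_ge0//.
rewrite ger0_norm ?sqr_ge0// exprMn.
have := pi_ge2 R; nra.
Qed.

Lemma cos_transform_shift h c s t : quad_decay h ->
  cos_transform h (c - 2 * pi * t * s) t = cos_transform (fun x => h (x + s)) c t.
Proof.
move=> dh; rewrite /cos_transform -(Rintegral_shift s (quad_decay_cos _ _ dh)).
by apply: eq_Rintegral => x _; congr (cos _ * _); rewrite /phase; ring.
Qed.

(* Dividing by [x] turns [cos_transform h c] into the derivative of a function vanishing at
  infinity. *)
Lemma Rintegral_Tr_eq0 h c (r : R) : test_fun h -> 0 < r -> (forall x, `|x| < r -> h x = 0) ->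
  \int[mu]_t cos_transform h c t = 0.
Proof.
move=> th r0 hr; have [sh [B hB]] := th.
(* By inversion the integral would be a multiple of [h 0 = 0]. Here [q] is [h x / (2 pi x)],
   harmless at the origin because [h] vanishes on []-r, r[], and multiplication by [2 pi x] gives
   back [h]. *)
pose q x := (2 * pi)^-1 * (x^-1 * h x).
have pi2 : 2 * pi != 0 :> R by rewrite mulf_neq0// gt_eqF// pi_gt0.
have hr1 x : `|x| < r -> derive1 h x = 0.
  move=> xr; rewrite (@derive1_near _ h (cst 0)) ?derive1_cst//.
  by apply: filterS (near_normr_lt xr) => y /hr.
pose q1 x := (2 * pi)^-1 * (x^-1 * derive1 h x - x^-1 * (x^-1 * h x)).
have Dq x : is_derive x 1 q (q1 x).
  have [xr|xr] := ltP `|x| r.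
    rewrite /q1 (hr _ xr) (hr1 _ xr) !mulr0 subr0 mulr0.
    apply: (@is_derive_near _ _ (cst 0)).
    by apply: filterS (near_normr_lt xr) => y /hr; rewrite /q => ->; rewrite !mulr0.
  have x0 : x != 0 by rewrite -normr_gt0 (lt_le_trans r0).
  have D1 : is_derive x 1 (fun x : R => x^-1) (- x ^- 2).
    by have := @is_deriveV _ id x 1 1 x0 (is_derive_id _ _); rewrite scaler1.
  have D2 := derive1P (@smooth_derivable _ _ sh x).
  apply: is_derive_eq; rewrite /q1 -exprVn /GRing.scale /=; ring.
have E1 : derive1 q = q1 by apply/funext => x; exact: is_derive_derive1 (Dq x).
have cq : compact_C1 q.
  split; first by move=> x; case: (Dq x).
  split; last by exists B => t /hB; rewrite /q => ->; rewrite !mulr0.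
  rewrite E1 => x.
  have [xr|xr] := ltP `|x| r.
    apply: cvg_near_cst; apply: filterS (near_normr_lt xr) => y yr.
    by rewrite /q1 !hr1// !hr// !mulr0.
  have x0 : x != 0 by rewrite -normr_gt0 (lt_le_trans r0).
  have cV : {for x, continuous (fun x : R => x^-1)} by exact: inv_continuous.
  apply: cvgM; first exact: cvg_cst.
  apply: cvgB.
    by apply: cvgM; [exact: cV|exact: (smooth_continuous (smooth_derive1 sh))].
  by apply: cvgM; [exact: cV|apply: cvgM; [exact: cV|exact: (smooth_continuous sh)]].
have qE : (fun x => 2 * pi * x * q x) = h.
  apply/funext => x; rewrite /q; have [->|x0] := eqVneq x 0;
    last by rewrite mulrACA mulfV// mul1r mulrA mulfV// mul1r.
  by rewrite invr0 mul0r !mulr0 hr ?normr0.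
have dq := compact_C1_decay cq.
apply: (@Rintegral_derive1_eq0 (cos_transform q (c - pi / 2))) => [|t|e e0];
  first exact: cos_transform_decay.
  have := @is_derive_Tr q (c - pi / 2) t dq; rewrite qE subrK; apply; exact: test_fun_decay.
(* One integration by parts on [q] gives decay like [K / |t|], enough for the primitive to vanish at
   infinity. *)
have [K [K0 HK]] : exists K, 0 <= K /\ forall t,
  `|2 * pi * t * cos_transform q (c - pi / 2) t| <= K.
  exists (\int[mu]_x `|derive1 q x|); split=> [|t]; first exact: Rintegral_ge0T.
  by rewrite cos_transform_derive1//; apply: cos_transform_bound; exact: compact_C1_decay1.
exists (K / e + 1) => t Kt.
have := HK t.
have Ke : 0 <= K / e by rewrite divr_ge0// ltW.
rewrite normrM normrM (ger0_norm (_ : 0 <= 2 * pi)) ?mulr_ge0 ?pi_ge0//.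
have pi2' := pi_ge2 R.
have : K <= e * (`|t| - 1). by rewrite mulrC -ler_pdivrMr//; lra.
have t1 : 1 <= `|t| by lra.
set T := `|cos_transform _ _ _|; have T0 : 0 <= T by exact: normr_ge0.
move=> H2 H1.
have H3 : T * `|t| <= 2 * pi * `|t| * T.
  by rewrite -[leRHS]mulrA [X in _ <= _ * X]mulrC ler_peMl ?mulr_ge0//; lra.
rewrite leNgt; apply/negP => H4.
have H5 : e * `|t| < T * `|t| by rewrite ltr_pM2r//; lra.
lra.
Qed.

End CosineTransform.

(** * The window: Fourier support and nonvanishing *)

Section TestFunction.
Variable R : realType.
Implicit Types (a b h : R -> R) (t s c x : R).
Local Notation mu := (@lebesgue_measure R).

Lemma quad_decay_Trl a b c : quad_decay a -> quad_decay b ->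
  quad_decay (fun s => b s * cos_transform a c s).
Proof.
move=> da db; under eq_fun do rewrite mulrC.
apply: (@quad_decay_mulb _ _ _ (\int[mu]_x `|a x|)) => //;
  first exact: cos_transform_continuous.
by move=> t; exact: cos_transform_bound.
Qed.

Lemma phaseC t s : phase t 0 s = phase s 0 t.
Proof. by rewrite /phase -!mulrA [t * s]mulrC. Qed.

(** The multiplication formula: Fubini for the kernel [cos (2 pi s t)], symmetric in [s] and [t],
    with [|b s| |a t|] as integrable majorant. *)
Lemma cos_transform_Parseval a b : quad_decay a -> quad_decay b ->
  \int[mu]_s (b s * cos_transform a 0 s) = \int[mu]_t (a t * cos_transform b 0 t).
Proof.
move=> da db.
pose f (z : measurableTypeR R * measurableTypeR R) : \bar R :=
  (cos (phase z.1 0 z.2) * (b z.1 * a z.2))%:E.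
have mdec h : quad_decay h -> measurable_fun [set: measurableTypeR R] h.
  by move=> dh; have /integrableP[/measurable_EFinP] := quad_decay_integrable dh.
have mf : measurable_fun setT f.
  apply/measurable_EFinP; apply: measurable_funM; last first.
    apply: measurable_funM.
      by apply: measurableT_comp; [exact: mdec|exact: measurable_fst].
    by apply: measurableT_comp; [exact: mdec|exact: measurable_snd].
  apply: (@measurableT_comp _ _ _ _ _ _ cos).
    by apply: continuous_measurable_fun; exact: continuous_cos.
  apply: measurable_funD; last exact: measurable_cst.
  by apply: measurable_funM; [apply: measurable_funM|];
    [exact: measurable_cst|exact: measurable_fst|exact: measurable_snd].
have dfx x : quad_decay (fun y => cos (phase x 0 y) * (b x * a y)).
  by apply: quad_decay_cos; exact: quad_decayZ.
have dfy y : quad_decay (fun x => cos (phase x 0 y) * (b x * a y)).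
  under eq_fun do rewrite phaseC [b _ * _]mulrC.
  by apply: quad_decay_cos; exact: quad_decayZ.
have iF : (mu \x mu)%E.-integrable setT f.
  apply/integrable12ltyP => //.
  apply: (@le_lt_trans _ _ (\int[mu]_x (`|b x| * \int[mu]_y `|a y|)%:E)%E).
    apply: ge0_le_integral => //.
    - by move=> x _; apply: integral_ge0.
    - apply: (@measurable_fun_fubini_tonelli_F _ _ _ _ _ mu (fun z => `|f z|%E)) => //.
      exact: measurableT_comp.
    - apply/measurable_EFinP; apply: measurable_funM; last exact: measurable_cst.
      by apply: mdec; exact: quad_decay_norm.
    - move=> x _.
      have := integral_decay (quad_decay_norm (dfx x)); rewrite /f /= => ->.
      rewrite lee_fin -RintegralZl_decay; last exact: quad_decay_norm.
      apply: le_Rintegral_decay; [exact: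
        quad_decay_norm|exact/quad_decayZ/quad_decay_norm|move=> y].
      by rewrite -normrM; exact: (le_normr_cos (fun y => b x * a y)).
  have -> : (fun x => (`|b x| * \int[mu]_y `|a y|)%:E) = EFin \o (fun x => (\int[mu]_y `|a
    y|) * `|b x|).
    by apply/funext => x /=; rewrite mulrC.
  by have := integral_decay (quad_decayZ (\int[mu]_y `|a y|) (quad_decay_norm db));
    rewrite /= => ->; rewrite ltry.
have := Fubini iF.
have -> : (fun x => (\int[mu]_y f (x, y))%E) = fun x => (b x * cos_transform a 0 x)%:E.
  apply/funext => x; have := integral_decay (dfx x); rewrite /f /= => ->; congr EFin.
  rewrite /cos_transform -RintegralZl_decay; last exact: quad_decay_cos.
  by apply: eq_Rintegral => y _; rewrite mulrCA.
have -> : (fun y => (\int[mu]_x f (x, y))%E) = fun y => (a y * cos_transform b 0 y)%:E.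
  apply/funext => y; have := integral_decay (dfy y); rewrite /f /= => ->; congr EFin.
  rewrite /cos_transform -RintegralZl_decay; last exact: quad_decay_cos.
  by apply: eq_Rintegral => x _; rewrite phaseC; ring.
rewrite integral_decay; last exact: quad_decay_Trl.
rewrite integral_decay; last exact: quad_decay_Trl.
by case.
Qed.

Lemma cos_transform_even h : quad_decay h -> (forall t, h (- t) = h t) -> forall t,
  cos_transform h 0 (- t) = cos_transform h 0 t.
Proof.
move=> dh eh t; rewrite /cos_transform -Rintegral_opp; last exact: quad_decay_cos.
by apply: eq_Rintegral => x _; rewrite eh /phase !mulrN !mulNr !opprK.
Qed.

Lemma cos_transform_sin_eq0 h t : quad_decay h -> (forall t,
  h (- t) = h t) -> cos_transform h (- (pi / 2)) t = 0.
Proof.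
move=> dh eh; apply: Rintegral_odd; first exact: quad_decay_cos.
by move=> x; rewrite eh /phase !cosBpihalf mulrN sinN mulNr.
Qed.

Lemma bump_test : test_fun (@bump R).
Proof. by split; [exact: smooth_bump|exists 1; exact: bump_supp]. Qed.

(** The [g], [FT g] and [g~] of the overview. Inversion would identify [window_hat] with [bump] and
    [window_tilde] with [window]. The bump being even, the cosine transforms are Fourier transforms
    here. *)
Definition window : R -> R := cos_transform (@bump R) 0.
Definition window_hat : R -> R := cos_transform window 0.
Definition window_tilde : R -> R := cos_transform window_hat 0.

Lemma quad_decay_window : quad_decay window.
Proof. exact/cos_transform_decay/bump_test. Qed.

Lemma window_even t : window (- t) = window t.
Proof. by apply: cos_transform_even; [exact: test_fun_decay bump_test|exact: bump_even]. Qed.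

Lemma window_hat_even t : window_hat (- t) = window_hat t.
Proof. by apply: cos_transform_even; [exact: quad_decay_window|exact: window_even]. Qed.

(** The product formula for cosines writes [window_hat s] as the mean of the integrals of the cosine
    transforms of two bumps, translated by [s] and by [- s]. For [|s| > 1] both translates vanish
    near 0, and [Rintegral_Tr_eq0] applies. *)
Lemma window_hat_supp s : 1 < `|s| -> window_hat s = 0.
Proof.
move=> s1.
have tb (e : R) : test_fun (fun x => @bump R (x + e)).
  have := test_fun_affine e (oner_neq0 R) bump_test.
  by under eq_fun do rewrite mul1r.
have Z e : `|e| = `|s| -> \int[mu]_t cos_transform (fun x => @bump R (x + e)) 0 t = 0.
  move=> es; apply: (@Rintegral_Tr_eq0 _ _ _ (`|s| - 1)) => //; first by rewrite subr_gt0.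
  move=> x xs; apply: bump_supp; have := lerB_normD e x; rewrite es [e + x]addrC; lra.
have db := test_fun_decay bump_test.
have -> : window_hat s = \int[mu]_t (2^-1 * cos_transform (fun x => @bump R (x + s)) 0 t +
                                2^-1 * cos_transform (fun x => @bump R (x + - s)) 0 t).
  apply: eq_Rintegral => t _; rewrite -!cos_transform_shift//.
  rewrite /window /cos_transform -!RintegralZl_decay; [|exact: quad_decay_cos..].
  rewrite -RintegralD_decay; [|apply: quad_decayZ; exact: quad_decay_cos..].
  apply: eq_Rintegral => x _.
  rewrite (_ : phase t (0 - 2 * pi * t * s) x = phase t 0 x - phase s 0 t);
    last by rewrite /phase; ring.
  rewrite (_ : phase t (0 - 2 * pi * t * - s) x = phase t 0 x + phase s 0 t);
    last by rewrite /phase; ring.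
  by rewrite cosB cosD; field.
have dT e : quad_decay (cos_transform (fun x => @bump R (x + e)) 0) by exact:
  cos_transform_decay.
rewrite (RintegralD_decay (quad_decayZ 2^-1 (dT s)) (quad_decayZ 2^-1 (dT (- s)))).
by rewrite (RintegralZl_decay _ (dT s)) (RintegralZl_decay _ (dT (- s))) (Z s erefl) (Z (- s)
  (normrN s)) mulr0 addr0.
Qed.

Lemma quad_decay_window_hat : quad_decay window_hat.
Proof.
by apply: (quad_decay_bounded_supp _ window_hat_supp); apply: cos_transform_continuous;
  exact: quad_decay_window.
Qed.

Lemma quad_decay_sqr h : quad_decay h -> quad_decay (fun t => h t * h t).
Proof.
move=> dh; have [ch [C hC]] := dh; apply: (@quad_decay_mulb _ _ _ `|C|) => // t.
rewrite (le_trans (hC t))// (le_trans (ler_norm _))// normrM ler_piMr//.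
by rewrite ger0_norm ?oneDsqrV_le1// ltW// oneDsqrV_gt0.
Qed.

(* Parseval twice: [window <> 0] gives [window_hat <> 0], which gives [window_tilde <> 0]. *)
Lemma window_tilde_neq0 : exists x, window_tilde x != 0.
Proof.
have db := test_fun_decay bump_test.
have w0 : window 0 != 0.
  rewrite gt_eqF// /window /cos_transform; apply: (@Rintegral_gt0_decay _ _ 0).
  - exact: quad_decay_cos.
  - by move=> t; rewrite /phase mulr0 mul0r addr0 cos0 mul1r bump_ge0.
  - by rewrite bump0 mulr1 /phase mulr0 addr0 cos0.
have [s hs] : exists s, window_hat s != 0.
  apply: contrapT => /forallNP H.
  have : \int[mu]_t (window t * window t) = 0.
    rewrite -[RHS](_ : \int[mu]_s (@bump R s * window_hat s) = 0); last first.
      rewrite -[RHS](_ : \int[mu]_s (0 : R) = 0); last by rewrite Rintegral_cst// mul0r.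
      by apply: eq_Rintegral => s _; have /negP := H s; rewrite negbK => /eqP ->; rewrite mulr0.
    by rewrite -cos_transform_Parseval//; exact: quad_decay_window.
  apply/eqP; rewrite gt_eqF//; apply: (@Rintegral_gt0_decay _ _ 0).
  - exact/quad_decay_sqr/quad_decay_window.
  - by move=> t; rewrite -expr2 sqr_ge0.
  - by rewrite -expr2 exprn_even_gt0.
apply: contrapT => /forallNP H.
have : \int[mu]_t (window_hat t * window_hat t) = 0.
  rewrite (cos_transform_Parseval quad_decay_window quad_decay_window_hat).
  rewrite -[RHS](_ : \int[mu]_s (0 : R) = 0); last by rewrite Rintegral_cst// mul0r.
  apply: eq_Rintegral => t _; have /negP := H t; rewrite negbK => /eqP Ht.
  by rewrite -/(window_tilde t) Ht mulr0.
apply/eqP; rewrite gt_eqF//; apply: (@Rintegral_gt0_decay _ _ s).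
- exact/quad_decay_sqr/quad_decay_window_hat.
- by move=> t; rewrite -expr2 sqr_ge0.
- by rewrite -expr2 exprn_even_gt0.
Qed.

Lemma window_tilde_lower : exists x0 r k, 0 < r /\ 0 < k /\
  forall x, `|x - x0| <= r -> k <= `|window_tilde x|.
Proof.
have [x0 hx] := window_tilde_neq0.
have k0 : 0 < `|window_tilde x0| / 2 by rewrite divr_gt0// normr_gt0.
have cw : continuous window_tilde by apply: cos_transform_continuous;
  exact: quad_decay_window_hat.
have /cvgrPdist_lt/(_ _ k0)/nbhs_ballP[e /= e0 he] := cw x0.
exists x0, (e / 2), (`|window_tilde x0| / 2); split; first by rewrite divr_gt0.
split => // x hxx; have := he x.
rewrite /ball /= distrC => /(_ _) H.
have := H ltac:(lra).
have := lerB_dist (window_tilde x0) (window_tilde x). lra.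
Qed.

End TestFunction.

(** * Complex-valued and iterated integrals *)

Section ComplexModulus.
Variable R : realType.
Implicit Types (z w : R[i]) (s t : R).

Lemma cmodE z : cmod z = Normc.normc z. Proof. by case: z. Qed.

Lemma cmodM z w : cmod (z * w) = cmod z * cmod w.
Proof. by rewrite !cmodE Normc.normcM. Qed.

Lemma cmod_ge0 z : 0 <= cmod z. Proof. exact: sqrtr_ge0. Qed.

Lemma ler_cmodD z w : cmod (z + w) <= cmod z + cmod w.
Proof. by rewrite !cmodE; exact: le_normcD. Qed.

Lemma cmodN z : cmod (- z) = cmod z.
Proof. by case: z => a b; rewrite /cmod /= !sqrrN. Qed.

Lemma cmod_real s : cmod (s%:C)%C = `|s|.
Proof. by rewrite /cmod /= expr0n addr0 sqrtr_sqr. Qed.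

Lemma cmod0 : cmod (0 : R[i]) = 0.
Proof. by rewrite /cmod /= expr0n addr0 sqrtr0. Qed.

Lemma cmod1 : cmod (1 : R[i]) = 1.
Proof. by rewrite /cmod /= expr0n addr0 expr1n sqrtr1. Qed.

Lemma cmod_expi t : cmod (expi t) = 1.
Proof. by rewrite /cmod /= cos2Dsin2 sqrtr1. Qed.

Lemma ler_Re z : `|complex.Re z| <= cmod z.
Proof. by rewrite -sqrtr_sqr /cmod ler_sqrt ?addr_ge0 ?sqr_ge0// lerDl sqr_ge0. Qed.

Lemma ler_Im z : `|complex.Im z| <= cmod z.
Proof. by rewrite -sqrtr_sqr /cmod ler_sqrt ?addr_ge0 ?sqr_ge0// lerDr sqr_ge0. Qed.

Lemma cmod_le_ReIm z : cmod z <= `|complex.Re z| + `|complex.Im z|.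
Proof.
rewrite -(ger0_norm (addr_ge0 (normr_ge0 (complex.Re z)) (normr_ge0 (complex.Im z)))).
rewrite -sqrtr_sqr /cmod ler_sqrt ?sqr_ge0// sqrrD !real_normK ?num_real//.
by rewrite lerD2r lerDl mulrn_wge0// mulr_ge0.
Qed.

Lemma ler_cmod_sum n (F : 'I_n -> R[i]) : cmod (\sum_i F i) <= \sum_i cmod (F i).
Proof.
elim/big_ind2 : _ => //; first by rewrite cmod0.
by move=> a b c e H1 H2; rewrite (le_trans (ler_cmodD _ _))// lerD.
Qed.

Lemma cmod_prod n (F : 'I_n -> R[i]) : cmod (\prod_i F i) = \prod_i cmod (F i).
Proof. by apply: (big_morph _ cmodM cmod1). Qed.

Lemma complexP z w : complex.Re z = complex.Re w -> complex.Im z = complex.Im w -> z = w.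
Proof. by case: z w => a b [c e] /= -> ->. Qed.

Lemma expiD s t : expi (s + t) = expi s * expi t :> R[i].
Proof. by apply: complexP; rewrite /= ?cosD// sinD addrC. Qed.

Lemma expi0 : expi 0 = 1 :> R[i].
Proof. by rewrite /expi cos0 sin0. Qed.

Lemma Re_add z w : complex.Re (z + w) = complex.Re z + complex.Re w.
Proof. by case: z; case: w. Qed.

Lemma Im_add z w : complex.Im (z + w) = complex.Im z + complex.Im w.
Proof. by case: z; case: w. Qed.

Lemma Re_mul z w : complex.Re (z * w) =
  complex.Re z * complex.Re w - complex.Im z * complex.Im w.
Proof. by case: z; case: w. Qed.

Lemma Im_mul z w : complex.Im (z * w) =
  complex.Re z * complex.Im w + complex.Im z * complex.Re w.
Proof. by case: z; case: w. Qed.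

End ComplexModulus.

(** * Iterated integrals in several variables *)

Section IteratedIntegral.
Variable R : realType.
Local Notation mu := (@lebesgue_measure R).
Local Notation "t |, v" := (row_mx (\row_(_ < 1) t) v) (at level 40).

Definition cquad_decay (h : R -> R[i]) := quad_decay (fun t => complex.Re (h t)) /\
  quad_decay (fun t => complex.Im (h t)).

Definition cint1 (h : R -> R[i]) : R[i] :=
  Complex (\int[mu]_t complex.Re (h t)) (\int[mu]_t complex.Im (h t)).

Lemma cquad_decayZ z h : cquad_decay h -> cquad_decay (fun t => z * h t).
Proof.
move=> [d1 d2]; split.
  under eq_fun do rewrite Re_mul.
  by apply: quad_decayB; exact: quad_decayZ.
under eq_fun do rewrite Im_mul.
by apply: quad_decayD; exact: quad_decayZ.
Qed.

Lemma cint1Z z h : cquad_decay h -> cint1 (fun t => z * h t) = z * cint1 h.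
Proof.
move=> [d1 d2]; apply: complexP; rewrite ?Re_mul ?Im_mul /=.
  under eq_Rintegral do rewrite Re_mul.
  by rewrite RintegralB_decay ?RintegralZl_decay//; exact: quad_decayZ.
under eq_Rintegral do rewrite Im_mul.
by rewrite RintegralD_decay ?RintegralZl_decay//; exact: quad_decayZ.
Qed.

Lemma cquad_decayD h1 h2 : cquad_decay h1 -> cquad_decay h2 ->
  cquad_decay (fun t => h1 t + h2 t).
Proof.
move=> [d1 d2] [e1 e2]; split.
  by under eq_fun do rewrite Re_add; exact: quad_decayD.
by under eq_fun do rewrite Im_add; exact: quad_decayD.
Qed.

Lemma cint1D h1 h2 : cquad_decay h1 -> cquad_decay h2 ->
  cint1 (fun t => h1 t + h2 t) = cint1 h1 + cint1 h2.
Proof.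
move=> [d1 d2] [e1 e2]; apply: complexP; rewrite ?Re_add ?Im_add /=.
  by under eq_Rintegral do rewrite Re_add; rewrite RintegralD_decay.
by under eq_Rintegral do rewrite Im_add; rewrite RintegralD_decay.
Qed.

Lemma cint1_sum n (F : 'I_n -> R -> R[i]) : (forall i, cquad_decay (F i)) ->
  cquad_decay (fun t => \sum_i F i t) /\
  cint1 (fun t => \sum_i F i t) = \sum_i cint1 (F i).
Proof.
elim: n F => [|n IH] F dF.
  rewrite big_ord0 (_ : (fun t => \sum_(i < 0) F i t) = (fun=> 0)); last first.
    by apply/funext => t; rewrite big_ord0.
  split; first by split; exact: quad_decay0.
  by apply: complexP => /=; rewrite Rintegral_cst// mul0r.
have [d1 e1] := IH (fun i => F (widen_ord (leqnSn n) i)) (fun i => dF _).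
rewrite (_ : (fun t => \sum_i F i t) =
  (fun t => \sum_i F (widen_ord (leqnSn n) i) t + F ord_max t)); last first.
  by apply/funext => t; rewrite big_ord_recr.
by split; [exact: cquad_decayD|rewrite cint1D// e1 big_ord_recr].
Qed.

Lemma cint1_shift h s : cquad_decay h -> cint1 (fun t => h (t + s)) = cint1 h.
Proof.
move=> [d1 d2]; congr Complex.
  exact: (Rintegral_shift s d1).
exact: (Rintegral_shift s d2).
Qed.

(** Follows the recursion of [iRint]: the slices are integrable and the partial integral decays in
    the outermost variable. Linearity and monotonicity then go by induction on the dimension,
    without product measures. *)
Fixpoint iter_integrable n : ('rV[R]_n -> R) -> Prop :=
  match n with
  | 0 => fun=> True
  | n'.+1 => fun h => (forall t, iter_integrable (fun v : 'rV[R]_n' => h (t |, v))) /\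
      quad_decay (fun t => iRint (fun v : 'rV[R]_n' => h (t |, v)))
  end.

Lemma iter_integrable_Z n (h : 'rV[R]_n -> R) c : iter_integrable h ->
  iter_integrable (fun v => c * h v) /\ iRint (fun v => c * h v) = c * iRint h.
Proof.
elim: n h => [//|n IH] h /= [H1 H2].
have E t := (IH _ (H1 t)).2.
split; last first.
  by under eq_Rintegral do rewrite E; rewrite RintegralZl_decay.
split; first by move=> t; exact: (IH _ (H1 t)).1.
by under eq_fun do rewrite E; exact: quad_decayZ.
Qed.

Lemma iter_integrable_D n (h1 h2 : 'rV[R]_n -> R) : iter_integrable h1 -> iter_integrable h2 ->
  iter_integrable (fun v => h1 v + h2 v) /\ iRint (fun v => h1 v + h2 v) = iRint h1 + iRint h2.
Proof.
elim: n h1 h2 => [//|n IH] h1 h2 /= [A1 A2] [B1 B2].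
have E t := (IH _ _ (A1 t) (B1 t)).2.
split; last first.
  by under eq_Rintegral do rewrite E; rewrite RintegralD_decay.
split; first by move=> t; exact: (IH _ _ (A1 t) (B1 t)).1.
by under eq_fun do rewrite E; exact: quad_decayD.
Qed.

Lemma iter_integrable_B n (h1 h2 : 'rV[R]_n -> R) : iter_integrable h1 -> iter_integrable h2 ->
  iter_integrable (fun v => h1 v - h2 v) /\ iRint (fun v => h1 v - h2 v) = iRint h1 - iRint h2.
Proof.
move=> i1 i2; have [A B] := iter_integrable_Z (-1) i2; have [A' B'] := iter_integrable_D i1 A.
have E : (fun v => h1 v - h2 v) = (fun v => h1 v + -1 * h2 v).
  by apply/funext => v; rewrite mulN1r.
by rewrite E; split => //; rewrite B' B mulN1r.
Qed.

Lemma le_iRint n (h1 h2 : 'rV[R]_n -> R) : iter_integrable h1 -> iter_integrable h2 ->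
  (forall v, h1 v <= h2 v) -> iRint h1 <= iRint h2.
Proof.
elim: n h1 h2 => [|n IH] h1 h2 /=; first by move=> _ _; exact.
move=> [A1 A2] [B1 B2] h12; apply: le_Rintegral_decay => // t.
by apply: IH => // v.
Qed.

Lemma iRint_norm n (h H : 'rV[R]_n -> R) : iter_integrable h -> iter_integrable H ->
  (forall v, `|h v| <= H v) -> `|iRint h| <= iRint H.
Proof.
move=> ih iH hH; rewrite ler_norml; apply/andP; split.
  have [A B] := iter_integrable_Z (-1) iH; rewrite -mulN1r -B; apply: le_iRint => // v.
  by have := hH v; rewrite ler_norml mulN1r => /andP[].
by apply: le_iRint => // v; rewrite (le_trans (ler_norm _)).
Qed.

Definition citer_integrable n (h : 'rV[R]_n -> R[i]) :=
  iter_integrable (fun v => complex.Re (h v)) /\ iter_integrable (fun v => complex.Im (h v)).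

Lemma citer_integrable_Z n (h : 'rV[R]_n -> R[i]) z : citer_integrable h ->
  citer_integrable (fun v => z * h v) /\ cint (fun v => z * h v) = z * cint h.
Proof.
move=> [i1 i2].
have [a1 b1] := iter_integrable_Z (complex.Re z) i1;
  have [a2 b2] := iter_integrable_Z (complex.Im z) i2.
have [a3 b3] := iter_integrable_Z (complex.Re z) i2;
  have [a4 b4] := iter_integrable_Z (complex.Im z) i1.
have [a5 b5] := iter_integrable_B a1 a2; have [a6 b6] := iter_integrable_D a3 a4.
have E1 : (fun v => complex.Re (z * h v)) =
    (fun v => complex.Re z * complex.Re (h v) - complex.Im z * complex.Im (h v)).
  by apply/funext => v; rewrite Re_mul.
have E2 : (fun v => complex.Im (z * h v)) =
    (fun v => complex.Re z * complex.Im (h v) + complex.Im z * complex.Re (h v)).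
  by apply/funext => v; rewrite Im_mul.
split; first by split; rewrite ?E1 ?E2.
by apply: complexP; rewrite ?Re_mul ?Im_mul /= ?E1 ?E2 ?b5 ?b6 ?b1 ?b2 ?b3 ?b4.
Qed.

Lemma citer_integrable_D n (h1 h2 : 'rV[R]_n -> R[i]) : citer_integrable h1 ->
  citer_integrable h2 ->
  citer_integrable (fun v => h1 v + h2 v) /\ cint (fun v => h1 v + h2 v) = cint h1 + cint h2.
Proof.
move=> [i1 i2] [j1 j2].
have [a1 b1] := iter_integrable_D i1 j1; have [a2 b2] := iter_integrable_D i2 j2.
have E1 : (fun v => complex.Re (h1 v + h2 v)) = (fun v => complex.Re (h1 v) + complex.Re (h2
  v)).
  by apply/funext => v; rewrite Re_add.
have E2 : (fun v => complex.Im (h1 v + h2 v)) = (fun v => complex.Im (h1 v) + complex.Im (h2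
  v)).
  by apply/funext => v; rewrite Im_add.
split; first by split; rewrite ?E1 ?E2.
by apply: complexP; rewrite ?Re_add ?Im_add /= ?E1 ?E2 ?b1 ?b2.
Qed.

Lemma citer_integrable_sum n k (F : 'I_k -> 'rV[R]_n -> R[i]) : (forall i,
  citer_integrable (F i)) ->
  citer_integrable (fun v => \sum_i F i v) /\ cint (fun v => \sum_i F i v) = \sum_i cint (F i).
Proof.
elim: k F => [|k IH] F dF.
  rewrite (_ : (fun v => \sum_(i < 0) F i v) = (fun=> 0)); last by apply/funext => t;
    rewrite big_ord0.
  have iI0 : iter_integrable (fun _ : 'rV[R]_n => 0) /\ iRint (fun _ : 'rV[R]_n => (0:R)) = 0.
    elim: (n) => [//|m [H1 H2]] /=; split; last first.
      by under eq_Rintegral do rewrite H2; rewrite Rintegral_cst// mul0r.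
    by split => //; under eq_fun do rewrite H2; exact: quad_decay0.
  case: iI0 => H1 H2; split => //.
  by rewrite big_ord0; apply: complexP => /=.
have [d1 e1] := IH (fun i => F (widen_ord (leqnSn k) i)) (fun i => dF _).
rewrite (_ : (fun t => \sum_i F i t) =
  (fun t => \sum_i F (widen_ord (leqnSn k) i) t + F ord_max t)); last first.
  by apply/funext => t; rewrite big_ord_recr.
have [d2 e2] := citer_integrable_D d1 (dF ord_max).
by split => //; rewrite e2 e1 big_ord_recr.
Qed.

Lemma cons_row0 n t (v : 'rV[R]_n) : ((t |, v) : 'rV[R]_n.+1) 0 ord0 = t.
Proof.
rewrite (_ : ord0 = lshift n (ord0 : 'I_1)); last exact: val_inj.
by rewrite (@row_mxEl R 1 1 n) mxE.
Qed.

Lemma cons_rowS n t (v : 'rV[R]_n) j : ((t |, v) : 'rV[R]_n.+1) 0 (lift ord0 j) = v 0 j.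
Proof.
rewrite (_ : lift ord0 j = rshift 1 j); last exact: val_inj.
by rewrite (@row_mxEr R 1 1 n).
Qed.

Lemma prod_cons_row (S : comPzSemiRingType) n (F : 'I_n.+1 -> R -> S) t (v : 'rV[R]_n) :
  \prod_(i < n.+1) F i (((t |, v) : 'rV[R]_n.+1) 0 i) =
  F ord0 t * \prod_(i < n) F (lift ord0 i) (v 0 i).
Proof.
rewrite big_ord_recl cons_row0; congr (_ * _).
by apply: eq_bigr => i _; rewrite cons_rowS.
Qed.

(** Integrating out the later coordinates leaves the constant [cint G] times [F ord0 t], so that
    one-variable linearity does the rest. *)
Lemma citer_integrable_prod n (F : 'I_n -> R -> R[i]) : (forall i, cquad_decay (F i)) ->
  citer_integrable (fun x : 'rV[R]_n => \prod_(i < n) F i (x 0 i)) /\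
  cint (fun x : 'rV[R]_n => \prod_(i < n) F i (x 0 i)) = \prod_(i < n) cint1 (F i).
Proof.
elim: n F => [|n IH] F dF.
  split; first by split.
  rewrite big_ord0 /cint /=. by apply: complexP => /=; rewrite big_ord0.
have [c e] := IH (fun i => F (lift ord0 i)) (fun i => dF _).
set G := fun x : 'rV[R]_n => \prod_(i < n) F (lift ord0 i) (x 0 i) in c e.
have E t : (fun v : 'rV[R]_n => \prod_(i < n.+1) F i (((t |, v) : 'rV[R]_n.+1) 0 i)) =
    (fun v => F ord0 t * G v).
  by apply/funext => v; rewrite prod_cons_row.
have ER t : (fun v : 'rV[R]_n => complex.Re (\prod_(i < n.+1) F i (((t |,
  v) : 'rV[R]_n.+1) 0 i))) =
    (fun v => complex.Re (F ord0 t * G v)).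
  by apply/funext => v; rewrite prod_cons_row.
have EI t : (fun v : 'rV[R]_n => complex.Im (\prod_(i < n.+1) F i (((t |,
  v) : 'rV[R]_n.+1) 0 i))) =
    (fun v => complex.Im (F ord0 t * G v)).
  by apply/funext => v; rewrite prod_cons_row.
have Z t := citer_integrable_Z (F ord0 t) c.
have FR t : iRint (fun v : 'rV[R]_n => complex.Re (F ord0 t * G v)) = complex.Re (cint G * F
  ord0 t).
  by have := (Z t).2 => /(congr1 (@complex.Re R)) /=; rewrite mulrC.
have FI t : iRint (fun v : 'rV[R]_n => complex.Im (F ord0 t * G v)) = complex.Im (cint G * F
  ord0 t).
  by have := (Z t).2 => /(congr1 (@complex.Im R)) /=; rewrite mulrC.
have [dR dI] := cquad_decayZ (cint G) (dF ord0).
have H := cint1Z (cint G) (dF ord0).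
rewrite big_ord_recl -e mulrC -H; split.
  split => /=; split.
  - by move=> t; rewrite ER; exact: (Z t).1.1.
  - by under eq_fun do rewrite ER FR.
  - by move=> t; rewrite EI; exact: (Z t).1.2.
  - by under eq_fun do rewrite EI FI.
congr Complex => /=.
  by under eq_Rintegral do rewrite ER FR.
by under eq_Rintegral do rewrite EI FI.
Qed.

Lemma cons_row_continuous n (p : R * 'rV[R]_n) :
  {for p, continuous (fun p : R * 'rV[R]_n => (p.1 |, p.2) : 'rV[R]_n.+1)}.
Proof.
apply/cvg_ballP => e e0; near=> q; split => // i j.
have [q1 q2] : ball p.1 e q.1 /\ ball p.2 e q.2.
  by near: q; exists (ball p.1 e, ball p.2 e) => //=; split; exact: nbhsx_ballx.
rewrite (ord1 i); case: (unliftP ord0 j) => [k|] ->.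
  by rewrite !cons_rowS; exact: q2.2.
by rewrite !cons_row0.
Unshelve. all: end_near. Qed.

Definition box_supp n (B : R) (h : 'rV[R]_n -> R) := forall (v : 'rV[R]_n) i,
  B < `|v 0 i| -> h v = 0.

Lemma box_compact n (B : R) : compact [set v : 'rV[R]_n | forall i, `|v 0 i| <= B].
Proof.
apply: bounded_closed_compact.
  exists `|B|; split; first exact: num_real.
  move=> C BC v /= vB.
  change (mx_norm v <= C).
  have [->|/mx_norm_neq0[[i k] /= ->]] := eqVneq (mx_norm v) 0;
    first by rewrite ltW// (le_lt_trans _ BC).
  by rewrite (ord1 i) (le_trans (vB _))// (le_trans (ler_norm _))// ltW.
have -> : [set v : 'rV[R]_n | forall i, `|v 0 i| <= B] =
    \bigcap_(i in setT) [set v : 'rV[R]_n | `|v 0 i| <= B].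
  by apply/seteqP; split => v H i; [move=> _; exact: H|exact: (H i I)].
apply: closed_bigI => i _.
apply: (@closed_comp _ _ (fun v : 'rV[R]_n => `|v 0 i|) [set y | y <= B]);
  last exact: closed_le.
move=> v _; apply: (@continuous_comp _ _ _ (fun v : 'rV[R]_n => v 0 i) Num.norm).
  exact: coord_continuous.
exact: norm_continuous.
Qed.

Lemma cons_row_continuous_r n t (v : 'rV[R]_n) :
  {for v, continuous (fun v : 'rV[R]_n => (t |, v) : 'rV[R]_n.+1)}.
Proof.
apply/(@cvg_ballP _ _ _ (nbhs v) (nbhs_filter v)) => e e0.
apply: (@filterS _ (nbhs v) (nbhs_filter v) (ball v e)); last exact: nbhsx_ballx.
move=> w vw; split => // i j.
rewrite (ord1 i); case: (unliftP ord0 j) => [k|] ->.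
  by rewrite !cons_rowS; exact: vw.2.
by rewrite !cons_row0; exact: ballxx.
Qed.

Lemma continuous_cons_row n (h : 'rV[R]_n.+1 -> R) t : continuous h ->
  continuous (fun v : 'rV[R]_n => h (t |, v)).
Proof.
move=> ch v.
apply: (@continuous_comp _ _ _ (fun v : 'rV[R]_n => (t |, v) : 'rV[R]_n.+1) h); last exact: ch.
exact: cons_row_continuous_r.
Qed.

(** Compactness of the box makes continuity in the first coordinate uniform in the others; outside
    the box both values are 0. This feeds the continuity of partial integrals. *)
Lemma cons_row_uniform n (h : 'rV[R]_n.+1 -> R) (B : R) t e : continuous h -> box_supp B h ->
  0 < e -> \forall s \near t, forall v : 'rV[R]_n, `|h (t |, v) - h (s |, v)| <= e.
Proof.
move=> ch hB e0.
have K := (compact_near_coveringP _).1 (@box_compact n B).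
have H : \forall s \near t, [set v : 'rV[R]_n | forall i, `|v 0 i| <= B] `<=`
    (fun v : 'rV[R]_n => `|h (t |, v) - h (s |, v)| <= e).
  apply: (K R (nbhs t) (fun s v => `|h (t |, v) - h (s |, v)| <= e) (nbhs_filter t)) => v vB.
  have c1 : {for (t, v), continuous (fun p : R * 'rV[R]_n => h (p.1 |, p.2))}.
    apply: (@continuous_comp _ _ _ (fun p : R * 'rV[R]_n => (p.1 |, p.2) : 'rV[R]_n.+1) h).
      exact: cons_row_continuous.
    exact: ch.
  have e2 : 0 < e / 2 by rewrite divr_gt0.
  have /cvgrPdist_lt/(_ _ e2) := c1.
  move=> [[P Q] /= [tP vQ] PQ].
  exists (Q, P) => //= -[w s] /= [Qw Ps].
  have Pt : P t by exact: nbhs_singleton.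
  have h1 := PQ (s, w) (conj Ps Qw); have h2 := PQ (t, w) (conj Pt Qw).
  rewrite /= in h1 h2.
  rewrite (_ : h (t |, w) - h (s |, w) = (h (t |, v) - h (s |, w)) - (h (t |, v) - h (t |,
    w))); last by ring.
  rewrite (le_trans (ler_normB _ _))//.
  by rewrite [leRHS]splitr lerD// ltW.
apply: filterS H => s H v.
have [vB|] := pselect (forall i, `|v 0 i| <= B); first exact: H.
move=> /existsNP[i /negP]; rewrite -ltNge => iB.
by rewrite !(hB _ (lift ord0 i)) ?cons_rowS// subrr normr0 ltW.
Qed.

(** The quantitative bound is carried through the induction because continuity of the partial
    integral comes from applying it to the difference of two slices. Each variable contributes
    [(1 + B^2) * pi]: on [[-B, B]] the constant 1 is below [(1 + B^2) / (1 + t^2)], whose integral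
    over the line is that number. *)
Lemma iter_integrable_bounded_supp n (h : 'rV[R]_n -> R) (B M : R) : continuous h ->
  box_supp B h ->
  (forall v, `|h v| <= M) -> iter_integrable h /\ `|iRint h| <= M * ((1 + B ^+ 2) * pi) ^+ n.
Proof.
elim: n h M => [|n IH] h M ch hB hM.
  by split => //=; rewrite expr0 mulr1.
have S t : continuous (fun v : 'rV[R]_n => h (t |, v)) by exact: continuous_cons_row.
have SB t : box_supp B (fun v : 'rV[R]_n => h (t |, v)).
  by move=> v i iB; apply: (hB _ (lift ord0 i)); rewrite cons_rowS.
pose J t := iRint (fun v : 'rV[R]_n => h (t |, v)).
have M0 : 0 <= M by rewrite (le_trans _ (hM 0)).
set c := (1 + B ^+ 2) * pi.
have B1 : 0 <= 1 + B ^+ 2 by rewrite addr_ge0// sqr_ge0.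
have c0 : 0 <= c by rewrite mulr_ge0// pi_ge0.
have JB t : B < `|t| -> J t = 0.
  move=> Bt; rewrite /J (_ : (fun _ => _) = (fun v : 'rV[R]_n => 0 * h (t |, v))).
    by rewrite (iter_integrable_Z 0 (IH _ _ (S t) (SB t) (fun v => hM _)).1).2 mul0r.
  by apply/funext => v; rewrite (hB _ ord0) ?cons_row0// mulr0.
have JC : continuous J.
  move=> t; apply/cvgrPdist_le => e e0.
  have cn : 0 < c ^+ n + 1 by rewrite ltr_wpDl// exprn_ge0.
  have e1 : 0 < e / (c ^+ n + 1) by rewrite divr_gt0.
  apply: filterS (cons_row_uniform t ch hB e1) => s H.
  have [_ <-] := iter_integrable_B (IH _ _ (S t) (SB t) (fun v => hM _)).1 (IH _ _ (S s) (SB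
    s) (fun v => hM _)).1.
  have C1 : continuous (fun v : 'rV[R]_n => h (t |, v) - h (s |, v)).
    by move=> v; exact: (cvgB (S t v) (S s v)).
  have C2 : box_supp B (fun v : 'rV[R]_n => h (t |, v) - h (s |, v)).
    by move=> v i iB; rewrite (SB t v i)// (SB s v i)// subrr.
  have [_ K] := IH _ _ C1 C2 H.
  by rewrite (le_trans K)// mulrAC -mulrA ler_piMr ?(ltW e0)// ler_pdivrMr// mul1r lerDl.
have dJ : quad_decay J by apply: (quad_decay_bounded_supp JC JB).
have hJ t : `|J t| <= M * c ^+ n * (1 + B ^+ 2) * (oneDsqr t)^-1.
  have [tB|tB] := ltP B `|t|.
    rewrite JB// normr0; apply: mulr_ge0; last exact/ltW/oneDsqrV_gt0.
    by rewrite !mulr_ge0 ?exprn_ge0.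
  rewrite (le_trans (IH _ _ (S t) (SB t) (fun v => hM _)).2)//.
  rewrite ler_pdivlMr ?(lt_le_trans ltr01)// ler_wpM2l ?mulr_ge0 ?exprn_ge0//.
  rewrite /oneDsqr lerD2l -(real_normK (num_real t)) ler_sqr ?nnegrE//.
  by rewrite (le_trans _ tB).
split; first by split => // t; exact: (IH _ _ (S t) (SB t) (fun v => hM _)).1.
rewrite (le_trans (le_normr_Rintegral_decay dJ))//.
have dW : quad_decay (fun t : R => (oneDsqr t)^-1).
  split; first by move=> x; exact: continuous_oneDsqrV.
  by exists 1 => t; rewrite mul1r ger0_norm// ltW// oneDsqrV_gt0.
rewrite (le_trans (le_Rintegral_decay (quad_decay_norm dJ) (quad_decayZ _ dW) hJ))//.
rewrite RintegralZl_decay// /Rintegral integral_oneDsqrV /=.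
by rewrite -!mulrA -/c -exprSr.
Qed.

Lemma iter_integrable_continuous_supp n (h : 'rV[R]_n -> R) (B : R) : continuous h ->
  box_supp B h -> iter_integrable h.
Proof.
move=> ch hB.
have [M hM] : exists M, forall v, `|h v| <= M.
  have := continuous_compact (continuous_subspaceT ch) (@box_compact n B).
  move=> /compact_bounded[M [_ hM]].
  exists (`|M| + 1) => v.
  have M1 : 0 <= `|M| + 1 by rewrite addr_ge0.
  have [vB|] := pselect (forall i, `|v 0 i| <= B).
    by apply: hM; [rewrite (le_lt_trans (ler_norm _))// ltrDl|exists v].
  by move=> /existsNP[i /negP]; rewrite -ltNge => iB; rewrite (hB _ i)// normr0.
exact: (iter_integrable_bounded_supp ch hB hM).1.
Qed.

(** The integral of a nonnegative function is a supremum over the simple functions below it, which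
    grows with the function. Iterated integrals of the maximal function can thus be compared without
    studying their measurability. *)
Lemma le_ge0_integralT (f g : R -> \bar R) : (forall x, 0 <= f x)%E ->
  (forall x, f x <= g x)%E -> (\int[mu]_x f x <= \int[mu]_x g x)%E.
Proof.
move=> f0 fg.
have g0 x : (0 <= g x)%E by exact: le_trans (f0 x) (fg x).
rewrite !ge0_integralTE//; apply: ereal_sup_le => _ [h /= hf <-].
by exists h => //= x; exact: le_trans (hf x) (fg x).
Qed.

Lemma iEint_ge0 n (h : 'rV[R]_n -> \bar R) : (forall v, 0 <= h v)%E -> (0 <= iEint h)%E.
Proof.
elim: n h => [|n IH] h h0 /=; first exact: h0.
by apply: integral_ge0 => t _; apply: IH => v.
Qed.

Lemma le_iEint n (h1 h2 : 'rV[R]_n -> \bar R) : (forall v, 0 <= h1 v)%E ->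
  (forall v, h1 v <= h2 v)%E -> (iEint h1 <= iEint h2)%E.
Proof.
elim: n h1 h2 => [|n IH] h1 h2 h0 h12 /=; first exact: h12.
apply: le_ge0_integralT => t; first by apply: iEint_ge0 => v.
by apply: IH => v.
Qed.

Lemma iEint_prod n (w : 'I_n -> R -> R) (J : 'I_n -> R) (a : R) : 0 <= a ->
  (forall i t, 0 <= w i t) -> (forall i, measurable_fun [set: R] (w i)) ->
  (forall i, \int[mu]_t (w i t)%:E = (J i)%:E)%E ->
  iEint (fun x : 'rV[R]_n => (a * \prod_(i < n) w i (x 0 i))%:E) = (a * \prod_(i < n) J i)%:E.
Proof.
elim: n w J a => [|n IH] w J a a0 w0 mw wJ /=; first by rewrite !big_ord0.
have J0 i : 0 <= J i by rewrite -lee_fin -wJ; apply: integral_ge0 => t _; rewrite lee_fin.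
have P0 : 0 <= \prod_(i < n) J (lift ord0 i) by apply: prodr_ge0.
transitivity (\int[mu]_t ((a * \prod_(i < n) J (lift ord0 i))%:E * (w ord0 t)%:E))%E.
  apply: eq_integral => t _.
  rewrite (_ : (fun v => _) = (fun v : 'rV[R]_n =>
     ((a * w ord0 t) * \prod_(i < n) w (lift ord0 i) (v 0 i))%:E)); last first.
    by apply/funext => v; rewrite prod_cons_row mulrA.
  rewrite (IH (fun i => w (lift ord0 i)) (fun i => J (lift ord0 i)))  ?mulr_ge0//.
  by rewrite -EFinM mulrAC.
rewrite ge0_integralZl//.
- by rewrite wJ -EFinM big_ord_recl -mulrA [J ord0 * _]mulrC.
- by apply/measurable_EFinP; exact: mw.
- by move=> t _; rewrite lee_fin.
- by rewrite lee_fin mulr_ge0.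
Qed.

End IteratedIntegral.

(** * Partial derivatives *)

Section ContinuousAt.
Variables (R : realType) (T : topologicalType).
Implicit Types (f g : T -> R) (x : T).

Lemma continuous_atD f g x : {for x, continuous f} -> {for x, continuous g} ->
  {for x, continuous (fun y => f y + g y)}.
Proof. by move=> cf cg; apply: cvgD; [exact: cf|exact: cg]. Qed.

Lemma continuous_atM f g x : {for x, continuous f} -> {for x, continuous g} ->
  {for x, continuous (fun y => f y * g y)}.
Proof. by move=> cf cg; apply: cvgM; [exact: cf|exact: cg]. Qed.

Lemma continuous_at_cst (c : R) x : {for x, continuous (fun=> c)}.
Proof. exact: cvg_cst. Qed.

Lemma continuous_at_near f g x : (\forall y \near x, f y = g y) ->
  {for x, continuous f} -> {for x, continuous g}.
Proof.
move=> fg cf; rewrite /prop_for /continuous_at -(nbhs_singleton fg).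
exact: cvg_trans (near_eq_cvg fg) cf.
Qed.

End ContinuousAt.

Section PartialDerivatives.
Variables (R : realType) (d : nat).
Local Notation Rd := 'rV[R]_d.
Implicit Types (f g h : Rd -> R) (U : set Rd) (s : seq 'I_d) (x v : Rd).

(** The difference quotients of [g] along [v] and of [p] at [x0] are literally the same function,
    which reduces partial derivatives to one variable. *)
Lemma is_derive_coord g x v (p : R -> R) (x0 l : R) :
  (forall t : R, g (t *: v + x) = p (t + x0)) ->
  is_derive x0 1 p l -> is_derive x v g l.
Proof.
move=> gp [dp <-].
have E : (fun t : R => t^-1 *: ((g \o shift x) (t *: v) - g x)) =
         (fun t : R => t^-1 *: ((p \o shift x0) (t *: 1) - p x0)).
  apply/funext => t /=; rewrite gp; congr (_ *: (_ - _)).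
    by rewrite /GRing.scale /= mulr1.
  by have := gp 0; rewrite scale0r !add0r.
by apply: DeriveDef; rewrite /derivable /derive E.
Qed.

Lemma rsmooth_on_continuous U f : rsmooth_on U f -> forall x, U x -> {for x, continuous f}.
Proof. by move=> /(_ [::])[]. Qed.

Lemma rD_DZ U f g (c : R) : open U -> rsmooth_on U f -> rsmooth_on U g ->
  forall s x, U x -> rD s (fun x => f x + c * g x) x = rD s f x + c * rD s g x.
Proof.
move=> oU sf sg; elim=> [//|i s IH] x Ux /=.
have [_ df] := sf s; have [_ dg] := sg s.
rewrite (@near_eq_derive _ _ _ _ (fun x => rD s f x + c *: rD s g x)).
  rewrite deriveD ?deriveZ//; [exact: dg|exact: df|].
  by apply: derivableZ; exact: dg.
by apply: filterS (open_nbhs_nbhs (conj oU Ux)) => y Uy; rewrite IH.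
Qed.

Lemma rsmooth_on_DZ U f g (c : R) : open U -> rsmooth_on U f -> rsmooth_on U g ->
  rsmooth_on U (fun x => f x + c * g x).
Proof.
move=> oU sf sg s; have [cf df] := sf s; have [cg dg] := sg s.
have near_rD x : U x -> \forall y \near x, rD s f y + c * rD s g y =
    rD s (fun x => f x + c * g x) y.
  by move=> Ux; apply: filterS (open_nbhs_nbhs (conj oU Ux)) => y Uy; rewrite (rD_DZ c oU).
split=> [x Ux|i x Ux].
  apply: (continuous_at_near (near_rD x Ux)).
  by apply: continuous_atD; [exact: cf|apply: continuous_atM;
    [exact: continuous_at_cst|exact: cg]].
apply: near_eq_derivable (near_rD x Ux) _.
apply: derivableD; first exact: df.
by apply: derivableZ; exact: dg.
Qed.

Lemma rsmooth_on0 U : rsmooth_on U (fun=> 0) /\ forall s x, rD s (fun _ : Rd => (0 : R)) x = 0.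
Proof.
have E s : rD s (fun _ : Rd => (0 : R)) = (fun=> 0).
  by elim: s => [//|i s IH] /=; rewrite IH; apply/funext => x; exact: derive_cst.
split=> [s|s x]; last by rewrite E.
rewrite E; split => [x _|i x _]; first exact: continuous_at_cst.
exact: derivable_cst.
Qed.

Lemma rsmooth_on_sum U N (F : 'I_N -> Rd -> R) (c : 'I_N -> R) : open U ->
  (forall k, rsmooth_on U (F k)) ->
  rsmooth_on U (fun x => \sum_(k < N) c k * F k x) /\
  forall s x, U x -> rD s (fun x => \sum_(k < N) c k * F k x) x = \sum_(k < N) c k * rD s (F
    k) x.
Proof.
move=> oU; elim: N F c => [|N IH] F c sF.
  rewrite (_ : (fun x : Rd => \sum_(k < 0) c k * F k x) = (fun=> 0)); last first.
    by apply/funext => x; rewrite big_ord0.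
  have [a b] := rsmooth_on0 U.
  by split => // s x _; rewrite b big_ord0.
have [a b] := IH (fun i => F (widen_ord (leqnSn N) i)) (fun i => c (widen_ord (leqnSn N) i))
  (fun i => sF _).
rewrite (_ : (fun x => \sum_(k < N.+1) c k * F k x) =
  (fun x => \sum_(i < N) c (widen_ord (leqnSn N) i) * F (widen_ord (leqnSn N) i) x +
     c ord_max * F ord_max x)); last first.
  by apply/funext => x; rewrite big_ord_recr.
split; first exact: (rsmooth_on_DZ _ oU a (sF ord_max)).
by move=> s x Ux; rewrite (rD_DZ _ oU a (sF ord_max) s Ux) (b s x Ux) big_ord_recr.
Qed.

Lemma continuous_coord_prod (F : 'I_d -> R -> R) : (forall i, continuous (F i)) ->
  continuous (fun x : Rd => \prod_(i < d) F i (x 0 i)).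
Proof.
move=> cF; elim: (index_enum _) => [|i r IH] x.
  rewrite (_ : (fun x : Rd => \prod_(i <- [::]) _) = (fun=> 1)); first exact: continuous_at_cst.
  by apply/funext => y; rewrite big_nil.
rewrite (_ : (fun x : Rd => \prod_(i <- i :: r) F i (x 0 i)) =
    (fun x => F i (x 0 i) * \prod_(i <- r) F i (x 0 i))); last first.
  by apply/funext => y; rewrite big_cons.
have ci : {for x, continuous (fun x : Rd => F i (x 0 i))}.
  apply: (@continuous_comp _ _ _ (fun x : Rd => x 0 i) (F i)); last exact: cF.
  exact: coord_continuous.
exact: (continuous_atM ci (IH x)).
Qed.

(** A derivative in direction [i] acts on the i-th factor only, so an iterated derivative depends on
    the word [s] through its letter counts alone. *)
Lemma rsmooth_on_prod U (F : 'I_d -> R -> R) : (forall i, smooth (F i)) ->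
  rsmooth_on U (fun x => \prod_(i < d) F i (x 0 i)) /\
  forall s, rD s (fun x => \prod_(i < d) F i (x 0 i)) =
    (fun x => \prod_(i < d) derive1n (count_mem i s) (F i) (x 0 i)).
Proof.
move=> sF.
have D (k : 'I_d -> nat) i x : is_derive x (ebasis R i)
    (fun x : Rd => \prod_(j < d) derive1n (k j) (F j) (x 0 j))
    (\prod_(j < d) derive1n ((i == j) + k j) (F j) (x 0 j)).
  pose P := \prod_(j < d | j != i) derive1n (k j) (F j) (x 0 j).
  apply: (@is_derive_coord _ _ _ (fun t => derive1n (k i) (F i) t * P) (x 0 i)).
    move=> t; rewrite (bigD1 i)//=; congr (derive1n (k i) (F i) _ * _).
      by rewrite !mxE eqxx mulr1.
    apply: eq_bigr => j ji; rewrite !mxE eq_sym (negbTE ji).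
    by rewrite mulr0 add0r.
  have D1 := derive1P (sF i (k i) (x 0 i)).
  apply: is_derive_eq; rewrite scaler0 add0r /GRing.scale /= mulrC (bigD1 i)//= eqxx.
  congr (_ * _); apply: eq_bigr => j ji.
  by rewrite eq_sym (negbTE ji).
have E s : rD s (fun x => \prod_(i < d) F i (x 0 i)) =
    (fun x => \prod_(i < d) derive1n (count_mem i s) (F i) (x 0 i)).
  elim: s => [//|i s IH] /=; rewrite IH; apply/funext => x.
  by case: (D (fun j => count_mem j s) i x).
split => // s; rewrite E; split => [x _|i x _].
  apply: (continuous_coord_prod (F := fun i => derive1n (count_mem i s) (F i))) => i.
  have : smooth (derive1n (count_mem i s) (F i)).
    by elim: (count_mem i s) => [|k IH]; [exact: sF|rewrite /derive1n iterS;
      exact: smooth_derive1].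
  exact: smooth_continuous.
by case: (D (fun j => count_mem j s) i x).
Qed.

Lemma count_mword (a : 'I_d -> nat) i : count_mem i (mword a) = a i.
Proof.
rewrite /mword count_flatten -map_comp /= sumnE big_map big_enum /=.
rewrite (bigD1 i)//= count_nseq /= eqxx mul1n big1 ?addn0// => j ji.
by rewrite count_nseq /= (negbTE ji) mul0n.
Qed.

Lemma enorm_ge0 x : 0 <= enorm x. Proof. exact: sqrtr_ge0. Qed.

Lemma enorm_gt0 x : x != 0 -> 0 < enorm x.
Proof.
move=> x0; rewrite /enorm sqrtr_gt0 lt_neqAle sumr_ge0 ?andbT; last by move=> i _;
  exact: sqr_ge0.
rewrite eq_sym psumr_eq0; last by move=> i _; exact: sqr_ge0.
apply: contra x0 => /allP H; apply/eqP/rowP => i; rewrite mxE.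
by have := H i (mem_index_enum i); rewrite /= sqrf_eq0 => /eqP.
Qed.

Lemma enorm_le x (K : R) : 0 <= K -> (forall i, `|x 0 i| <= K) -> enorm x <= K * d.+1%:R.
Proof.
move=> K0 xK; rewrite -[leRHS]ger0_norm ?mulr_ge0// -sqrtr_sqr /enorm ler_sqrt ?sqr_ge0//.
rewrite (@le_trans _ _ (\sum_(i < d) K ^+ 2))//.
  by apply: ler_sum => i _; rewrite -(real_normK (num_real (x 0 i))) ler_sqr ?nnegrE.
rewrite sumr_const card_ord -[X in X <= _]mulr_natr exprMn ler_wpM2l ?sqr_ge0//.
by rewrite -natrX ler_nat (leq_trans (leqnSn d))// expnS expn1 leq_pmulr.
Qed.

End PartialDerivatives.

(** * The lacunary test function and its Fourier transform *)

Section OscillatingWindow.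
Variable R : realType.
Implicit Types (h : R -> R) (t c w : R).

(** Modulated cosine transforms. A derivative hits either the modulation, shifting its phase, or the
    transform, replacing [psi] by [2 pi x psi]; sums of such terms are therefore a class to which
    [smooth_coind] applies. *)
Inductive osc : (R -> R) -> Prop :=
| osc_term a w c psi c' : test_fun psi -> osc (fun t => a * (cos (phase w c t) *
  cos_transform psi c' t))
| osc_add h1 h2 : osc h1 -> osc h2 -> osc (fun t => h1 t + h2 t).

Lemma osc_derive1 h : osc h -> (forall x, derivable h x 1) /\ osc (derive1 h).
Proof.
elim=> {h} [a w c psi c' tp|h1 h2 _ [d1 o1] _ [d2 o2]]; last first.
  have [E D] := derive1D d1 d2.
  by split => //; rewrite E; exact: osc_add.
have tp' := test_fun_mulX (2 * pi) tp.
have D (x : R) : is_derive x 1 (fun t => a * (cos (phase w c t) * cos_transform psi c' t))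
   (a * 2 * pi * w * (cos (phase w (c + pi / 2) x) * cos_transform psi c' x) +
    a * (cos (phase w c x) * cos_transform (fun x => 2 * pi * x * psi x) (c' + pi / 2) x)).
  have D1 := is_derive_Tr c' x (test_fun_decay tp) (test_fun_decay tp').
  have D2 : is_derive x 1 (phase w c) (2 * pi * w).
    by rewrite /phase; apply: is_derive_eq;
     rewrite !(scaler1, scaler0, add0r, addr0, mulr1, scale0r).
  have D3 : is_derive x 1 (fun x => cos (phase w c x)) (- sin (phase w c x) * (2 * pi * w)).
    exact: (@is_derive1_comp _ cos (phase w c)).
  apply: is_derive_eq; rewrite /GRing.scale /=.
  rewrite [in RHS]/phase addrA cosDpihalf -/(phase w c x); ring.
split; first by move=> x; case: (D x).
have -> : derive1 (fun t => a * (cos (phase w c t) * cos_transform psi c' t)) = fun x =>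
    (a * 2 * pi * w * (cos (phase w (c + pi / 2) x) * cos_transform psi c' x) +
    a * (cos (phase w c x) * cos_transform (fun x => 2 * pi * x * psi x) (c' + pi / 2) x)).
  by apply/funext => x; exact: is_derive_derive1 (D x).
by apply: osc_add; exact: osc_term.
Qed.

(** Each power of [t] is traded for a derivative of [psi], at the price of a phase shift. *)
Lemma cos_transform_pow_bounded psi b : test_fun psi -> forall c, exists C, forall t,
  `|t ^+ b * cos_transform psi c t| <= C.
Proof.
elim: b psi => [|b IH] psi tp c.
  exists (\int[@lebesgue_measure R]_x `|psi x|) => t; rewrite mul1r.
  exact/cos_transform_bound/test_fun_decay.
have [C HC] := IH _ (test_fun_derive1 tp) (c + pi / 2).
exists C => t; apply: le_trans (HC t).
rewrite -cos_transform_derive1; last exact: test_fun_C1.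
rewrite (_ : t ^+ b * _ = 2 * pi * (t ^+ b.+1 * cos_transform psi c t));
  last by rewrite exprS; ring.
rewrite [leRHS]normrM ler_peMl// ger0_norm ?mulr_ge0 ?pi_ge0//.
have := pi_ge2 R; lra.
Qed.

Lemma osc_pow_bounded h b : osc h -> exists C, forall t, `|t ^+ b * h t| <= C.
Proof.
elim=> {h} [a w c psi c' tp|h1 h2 _ [C1 H1] _ [C2 H2]]; last first.
  by exists (C1 + C2) => t; rewrite mulrDr (le_trans (ler_normD _ _))// lerD.
have [C HC] := cos_transform_pow_bounded b tp c'.
exists (`|a| * C) => t; rewrite (_ : _ * _ = a * (cos (phase w c t) * (t ^+ b * cos_transform
  psi c' t))); last by ring.
rewrite normrM ler_wpM2l// (le_trans _ (HC t))//.
exact: (le_normr_cos (fun t => t ^+ b * cos_transform psi c' t)).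
Qed.

Lemma osc_schwartz h : osc h -> smooth h /\
  forall k b, exists C, forall t, `|t ^+ b * derive1n k h t| <= C.
Proof.
move=> oh; have [sh dh] := @smooth_coind R osc osc_derive1 h oh.
by split => // k b; apply: osc_pow_bounded; exact: dh.
Qed.

Lemma osc_sum N (F : 'I_N -> R -> R) : (forall k, osc (F k)) -> osc (fun t => \sum_k F k t).
Proof.
elim: N F => [|N IH] F oF.
  rewrite (_ : (fun t => \sum_(k < 0) F k t) = (fun t => 0 * (cos (phase 0 0 t) *
    cos_transform (@bump R) 0 t))).
    by apply: osc_term; exact: bump_test.
  by apply/funext => t; rewrite big_ord0 mul0r.
rewrite (_ : (fun t => \sum_k F k t) =
   (fun t => \sum_k F (widen_ord (leqnSn N) k) t + F ord_max t)); last first.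
  by apply/funext => t; rewrite big_ord_recr.
by apply: osc_add => //; exact: IH.
Qed.

End OscillatingWindow.

Section LacunaryTest.
Variables (R : realType) (n N : nat) (a : R) (w : 'I_N -> R).
Hypothesis a0 : 0 <= a.
Hypothesis w2 : forall l, 2 <= w l.
Local Notation Rd := 'rV[R]_n.+1.
Local Notation mu := (@lebesgue_measure R).
Implicit Types (x xi : Rd) (t s : R).

Definition exp_sum t : R[i] := \sum_(l < N) expi (2 * pi * (t * w l)).

Definition lac_test_factor (i : 'I_n.+1) t : R[i] :=
  if i == ord0 then exp_sum t * ((a * window t)%:C)%C else ((window t)%:C)%C.

Definition lac_test x : R[i] := \prod_(i < n.+1) lac_test_factor i (x 0 i).

Definition freq (l : 'I_N) (i : 'I_n.+1) : R := if i == ord0 then w l else 0.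

(** Up to the factor [a], the Fourier transform of the l-th summand: modulation by [w l] translates
    [window_hat] along the first axis. *)
Definition lac_test_hat l xi : R := \prod_(i < n.+1) window_hat (xi 0 i - freq l i).

Lemma window_osc : osc (@window R).
Proof.
rewrite (_ : @window R = (fun t => 1 * (cos (phase 0 0 t) * cos_transform (@bump R) 0 t))).
  by apply: osc_term; exact: bump_test.
by apply/funext => t; rewrite /phase mulr0 mul0r addr0 cos0 !mul1r.
Qed.

(** Only the factor of index [ord0] is complex, so the real and imaginary parts of [lac_test] are
    again products and [rsmooth_on_prod] applies to each. *)
Definition lac_test_re (i : 'I_n.+1) t : R := if i == ord0 then complex.Re (exp_sum t * ((a *
  window t)%:C)%C) else window t.
Definition lac_test_im (i : 'I_n.+1) t : R := if i == ord0 then complex.Im (exp_sum t * ((a *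
  window t)%:C)%C) else window t.

Lemma Re_sum M (F : 'I_M -> R[i]) : complex.Re (\sum_k F k) = \sum_k complex.Re (F k).
Proof. by apply: (big_morph _ (@Re_add R)). Qed.

Lemma Im_sum M (F : 'I_M -> R[i]) : complex.Im (\sum_k F k) = \sum_k complex.Im (F k).
Proof. by apply: (big_morph _ (@Im_add R)). Qed.

Lemma osc_exp_sum : osc (fun t => complex.Re (exp_sum t * ((a * window t)%:C)%C)) /\
  osc (fun t => complex.Im (exp_sum t * ((a * window t)%:C)%C)).
Proof.
split.
  rewrite (_ : (fun t => _) = (fun t => \sum_(l < N) a * (cos (phase (w l) 0 t) *
    cos_transform (@bump R) 0 t))).
    by apply: osc_sum => l; apply: osc_term; exact: bump_test.
  apply/funext => t; rewrite Re_mul /= mulr0 subr0 Re_sum mulr_suml; apply: eq_bigr => l _ /=.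
  by rewrite /phase addr0 -[2 * pi * w l * t]mulrA [w l * t]mulrC mulrCA.
rewrite (_ : (fun t => _) = (fun t => \sum_(l < N) a * (cos (phase (w l) (- (pi / 2)) t) *
  cos_transform (@bump R) 0 t))).
  by apply: osc_sum => l; apply: osc_term; exact: bump_test.
apply/funext => t; rewrite Im_mul /= mulr0 add0r Im_sum mulr_suml; apply: eq_bigr => l _ /=.
by rewrite /phase cosBpihalf -[2 * pi * w l * t]mulrA [w l * t]mulrC mulrCA.
Qed.

Lemma osc_lac_test i : osc (lac_test_re i) /\ osc (lac_test_im i).
Proof.
have [p1 p2] := osc_exp_sum.
by rewrite /lac_test_re /lac_test_im; case: (i == ord0); split => //; exact: window_osc.
Qed.

Lemma prod_real_complex (I : finType) (P : pred I) (F : I -> R) :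
  \prod_(i | P i) ((F i)%:C)%C = ((\prod_(i | P i) F i)%:C)%C :> R[i].
Proof. by rewrite (big_morph _ (@rmorphM _ _ (real_complex R)) (rmorph1 (real_complex R))). Qed.

Lemma Re_lac_test : (fun x => complex.Re (lac_test x)) = fun x => \prod_(i < n.+1)
  lac_test_re i (x 0 i).
Proof.
apply/funext => x; rewrite /lac_test big_ord_recl [RHS]big_ord_recl.
under eq_bigr do rewrite /lac_test_factor /=. rewrite prod_real_complex. rewrite Re_mul /=
  mulr0 subr0; congr (_ * _).
Qed.

Lemma Im_lac_test : (fun x => complex.Im (lac_test x)) = fun x => \prod_(i < n.+1)
  lac_test_im i (x 0 i).
Proof.
apply/funext => x; rewrite /lac_test big_ord_recl [RHS]big_ord_recl.
by under eq_bigr do rewrite /lac_test_factor /=;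
  rewrite prod_real_complex Im_mul /= mulr0 add0r.
Qed.

Lemma mono_prod_bounded (F : 'I_n.+1 -> R -> R) (k b : 'I_n.+1 -> nat) : (forall i,
  osc (F i)) ->
  exists C, forall x, `|mono b x| * `|\prod_i derive1n (k i) (F i) (x 0 i)| <= C.
Proof.
move=> oF.
have H i : exists C, forall t, `|t ^+ b i * derive1n (k i) (F i) t| <= C.
  exact: (osc_schwartz (oF i)).2.
have [C HC] := choice H.
exists (\prod_i C i) => x; rewrite -normrM -big_split /= normr_prod.
by apply: ler_prod => i _; rewrite normr_ge0 /= HC.
Qed.

Lemma lac_test_Schwartz : Schwartz lac_test.
Proof.
have s1 i : smooth (lac_test_re i) := (osc_schwartz (osc_lac_test i).1).1.
have s2 i : smooth (lac_test_im i) := (osc_schwartz (osc_lac_test i).2).1.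
have [S1 E1] := rsmooth_on_prod setT s1; have [S2 E2] := rsmooth_on_prod setT s2.
split; first by split; rewrite ?Re_lac_test ?Im_lac_test.
move=> k b.
have [C1 H1] := mono_prod_bounded (fun i => count_mem i (mword k)) b (fun i => (osc_lac_test
  i).1).
have [C2 H2] := mono_prod_bounded (fun i => count_mem i (mword k)) b (fun i => (osc_lac_test
  i).2).
exists (C1 + C2) => x; rewrite (le_trans (ler_wpM2l (normr_ge0 _) (cmod_le_ReIm _)))//.
by rewrite /dpow /cD /= Re_lac_test Im_lac_test E1 E2 mulrDr lerD.
Qed.

Lemma phaseE (c b t : R) : phase c b t = 2 * pi * (t * c) + b.
Proof. by rewrite /phase -mulrA [c * t]mulrC. Qed.

Lemma expi_sum (F : 'I_n.+1 -> R) : expi (\sum_i F i) = \prod_i expi (F i) :> R[i].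
Proof. by rewrite (big_morph _ (@expiD R) (@expi0 R)). Qed.

Lemma cquad_decay_real_expi h (c : R) : quad_decay h ->
  cquad_decay (fun t => ((h t)%:C)%C * expi (2 * pi * (t * c))).
Proof.
move=> dh; split.
  rewrite (_ : (fun t => _) = (fun t => cos (phase c 0 t) * h t)); first exact: quad_decay_cos.
  by apply/funext => t; rewrite Re_mul /= mul0r subr0 mulrC phaseE addr0.
rewrite (_ : (fun t => _) = (fun t => cos (phase c (- (pi / 2)) t) * h t));
  first exact: quad_decay_cos.
by apply/funext => t; rewrite Im_mul /= mul0r addr0 mulrC phaseE cosBpihalf.
Qed.

Lemma cint1_real_expi h (c : R) : quad_decay h -> (forall t, h (- t) = h t) ->
  cint1 (fun t => ((h t)%:C)%C * expi (2 * pi * (t * c))) = ((cos_transform h 0 c)%:C)%C.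
Proof.
move=> dh eh; apply: complexP => /=.
  by apply: eq_Rintegral => t _; rewrite /= mul0r subr0 mulrC phaseE addr0.
apply: (etrans _ (cos_transform_sin_eq0 c dh eh)).
by apply: eq_Rintegral => t _; rewrite /= mul0r addr0 mulrC phaseE cosBpihalf.
Qed.

Lemma FT_factor i s : cquad_decay (fun t => lac_test_factor i t * expi (- (2 * pi * (t *
  s)))) /\
  cint1 (fun t => lac_test_factor i t * expi (- (2 * pi * (t * s)))) =
  if i == ord0 then ((a * \sum_(l < N) window_hat (s - w l))%:C)%C else ((window_hat s)%:C)%C.
Proof.
have E c t : - (2 * pi * (t * c)) = 2 * pi * (t * - c) by rewrite !mulrN.
rewrite /lac_test_factor; case: (i == ord0); last first.
  rewrite (_ : (fun t => _) = (fun t => ((window t)%:C)%C * expi (2 * pi * (t * - s))));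
    last first.
    by apply/funext => t; rewrite E.
  split; first exact/cquad_decay_real_expi/quad_decay_window.
  rewrite cint1_real_expi; [|exact: quad_decay_window|exact: window_even].
  by rewrite -/(window_hat (- s)) window_hat_even.
rewrite (_ : (fun t => _) = (fun t => \sum_(l < N)
   (a%:C)%C * (((window t)%:C)%C * expi (2 * pi * (t * (w l - s)))))); last first.
  apply/funext => t; rewrite E /exp_sum !mulr_suml; apply: eq_bigr => l _.
  rewrite mulrBr (mulrBr (2 * pi)) expiD -E rmorphM /=.
  by rewrite [in RHS]mulrA [RHS]mulrA -[_ * expi (2 * pi * (t * w l))]mulrC !mulrA.
have dl l : cquad_decay (fun t => ((window t)%:C)%C * expi (2 * pi * (t * (w l - s)))).
  exact/cquad_decay_real_expi/quad_decay_window.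
have [d1 e1] := cint1_sum (fun l => cquad_decayZ (a%:C)%C (dl l)).
split => //; rewrite e1 rmorphM /= rmorph_sum /= mulr_sumr; apply: eq_bigr => l _.
rewrite cint1Z// cint1_real_expi; [|exact: quad_decay_window|exact: window_even].
by rewrite -/(window_hat (w l - s)) -window_hat_even opprB.
Qed.

Lemma FT_lac_test xi : FT lac_test xi = ((a * \sum_(l < N) lac_test_hat l xi)%:C)%C.
Proof.
rewrite /FT (_ : (fun x => _) = (fun x : Rd => \prod_(i < n.+1)
   ((fun i t => lac_test_factor i t * expi (- (2 * pi * (t * xi 0 i)))) i (x 0 i))));
     last first.
  apply/funext => x; rewrite big_split /=; congr (_ * _).
  by rewrite -expi_sum; congr expi; rewrite /dotp mulr_sumr -sumrN.
have [_ ->] := citer_integrable_prod (fun i => (FT_factor i (xi 0 i)).1).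
rewrite (eq_bigr _ (fun i _ => (FT_factor i (xi 0 i)).2)) big_ord_recl /=.
rewrite prod_real_complex -rmorphM /=; congr (_%:C)%C; rewrite -mulrA mulr_suml; congr (_ * _).
apply: eq_bigr => l _; rewrite /lac_test_hat big_ord_recl /freq /=; congr (_ * _).
by apply: eq_bigr => i _; rewrite subr0.
Qed.

Lemma lac_test_hat_supp l xi i : 1 < `|xi 0 i - freq l i| -> lac_test_hat l xi = 0.
Proof.
by move=> H; rewrite /lac_test_hat (bigD1 i)//= window_hat_supp// mul0r.
Qed.

Definition lac_test_box : R := 1 + \sum_(l < N) w l.

Lemma freq_ge0 l i : 0 <= freq l i.
Proof. by rewrite /freq; case: ifP => // _; rewrite (le_trans _ (w2 l)). Qed.

Lemma freq_box l i : freq l i + 1 <= lac_test_box.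
Proof.
rewrite addrC lerD2l /freq; case: ifP => _.
  by rewrite (bigD1 l)//= lerDl sumr_ge0// => k _; rewrite (le_trans _ (w2 k)).
by rewrite sumr_ge0// => k _; rewrite (le_trans _ (w2 k)).
Qed.

Lemma lac_test_hat_box l xi i : lac_test_box < `|xi 0 i| -> lac_test_hat l xi = 0.
Proof.
move=> H; apply: (@lac_test_hat_supp l xi i).
have := freq_box l i; have := freq_ge0 l i; have := lerB_dist (xi 0 i) (freq l i).
move=> H1 H2 H3; rewrite (ger0_norm H2) in H1; lra.
Qed.

(** Here [2 <= w l] enters: the spectrum, within distance 1 of the frequencies in each coordinate,
    stays in the half-space [xi_0 >= 1]. This gives [S0] and keeps the singularity of the symbols at
    0 out of the integrals. *)
Lemma lac_test_hat_low l xi : xi 0 ord0 < 1 -> lac_test_hat l xi = 0.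
Proof.
move=> H; apply: (@lac_test_hat_supp l xi ord0); rewrite /freq eqxx.
rewrite distrC; have := w2 l; have := ler_norm (w l - xi 0 ord0); lra.
Qed.

Lemma lac_test_S0 : S0 lac_test.
Proof.
split; first exact: lac_test_Schwartz.
pose K := [set xi : Rd | forall i, `|xi 0 i| <= lac_test_box].
pose L := [set xi : Rd | 1 <= xi 0 ord0].
have cK : compact K by exact: box_compact.
have clL : closed L.
  apply: (@closed_comp _ _ (fun v : Rd => v 0 ord0) [set y | 1 <= y]); last exact: closed_ge.
  by move=> v _; exact: coord_continuous.
have clK : closed K by apply: compact_closed => //; exact: norm_hausdorff.
have sub : [set xi | FT lac_test xi != 0] `<=` K `&` L.
  move=> xi /=; rewrite FT_lac_test => nz.
  have [l hl] : exists l, lac_test_hat l xi != 0.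
    apply: contrapT => /forallNP H; move/negP: nz; apply.
    by rewrite big1 ?mulr0// => l _; have /negP := H l; rewrite negbK => /eqP.
  split => [i|]; [|rewrite /L /=]; rewrite leNgt; apply/negP => H; move/eqP: hl; apply.
    exact: (lac_test_hat_box l H).
  exact: lac_test_hat_low.
have subC : closure [set xi | FT lac_test xi != 0] `<=` K `&` L.
  rewrite [X in _ `<=` X](closure_id _).1; last exact: closedI.
  exact: closureS.
split.
  apply: (subclosed_compact _ cK); first exact: closed_closure.
  by move=> xi /subC[].
by move=> /subC[_]; rewrite /L /= mxE; lra.
Qed.

End LacunaryTest.

(** * Dilated multipliers acting on the test function *)

Section MultiplierAction.
Variables (R : realType) (n N : nat) (a : R) (w : 'I_N -> R).
Hypothesis a0 : 0 <= a.
Hypothesis w2 : forall l, 2 <= w l.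
Local Notation Rd := 'rV[R]_n.+1.
Local Notation mu := (@lebesgue_measure R).
Local Notation lac_test := (lac_test (n := n) a w).
Local Notation lac_test_hat := (lac_test_hat (n := n) w).
Local Notation freq := (freq (n := n) w).
Implicit Types (x xi : Rd) (t s : R).

Definition hat_mass : R := \int[mu]_t `|window_hat t|.

Lemma hat_mass_ge0 : 0 <= hat_mass. Proof. exact: Rintegral_ge0T. Qed.

Lemma quad_decay_window_hat_shift (f : R) : quad_decay (fun t => window_hat (t - f)).
Proof. exact/quad_decay_shift/quad_decay_window_hat. Qed.

Lemma cint1_window_hat_shift (f c : R) :
  cint1 (fun t => ((window_hat (t - f))%:C)%C * expi (2 * pi * (t * c))) =
  expi (2 * pi * (f * c)) * ((window_tilde c)%:C)%C.
Proof.
have dh := cquad_decay_real_expi c (@quad_decay_window_hat R).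
rewrite -[X in _ * (X%:C)%C]/(cos_transform (@window_hat R) 0 c) -cint1_real_expi; last 2 first.
- exact: quad_decay_window_hat.
- exact: window_hat_even.
rewrite -cint1Z// -[RHS](cint1_shift (- f) (cquad_decayZ _ dh)); congr cint1; apply/funext => t.
by rewrite [RHS]mulrCA -expiD -mulrDr -mulrDl [f + _]addrC subrK.
Qed.

Definition main_term l x xi : R[i] :=
  \prod_(i < n.+1) (((window_hat (xi 0 i - freq l i))%:C)%C * expi (2 * pi * (xi 0 i * x 0 i))).

Lemma cint_main_term l x : citer_integrable (main_term l x) /\
  cint (main_term l x) = expi (2 * pi * (x 0 0 * w l)) * \prod_i ((window_tilde (x 0 i))%:C)%C.
Proof.
have [c e] := citer_integrable_prod (fun i => cquad_decay_real_expi (x 0 i)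
  (quad_decay_window_hat_shift (freq l i))).
split; first exact: c.
apply: etrans e _.
rewrite (eq_bigr _ (fun i _ => cint1_window_hat_shift (freq l i) (x 0 i))) big_split /=;
  congr (_ * _).
rewrite big_ord_recl /freq /= [w l * _]mulrC big1 ?mulr1// => i _.
by rewrite mul0r mulr0 expi0.
Qed.

Lemma main_termE l x xi : main_term l x xi = ((lac_test_hat l xi)%:C)%C * expi (2 * pi * dotp
  x xi).
Proof.
rewrite /main_term big_split /= prod_real_complex; congr (_ * _).
rewrite -expi_sum; congr expi; rewrite /dotp mulr_sumr.
by apply: eq_bigr => i _; rewrite [xi 0 i * _]mulrC.
Qed.

Lemma iRint_lac_test_hat l : iter_integrable (fun xi => `|lac_test_hat l xi|) /\ iRint (fun
  xi => `|lac_test_hat l xi|) = hat_mass ^+ n.+1.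
Proof.
pose F i t : R[i] := (`|window_hat (t - freq l i)|%:C)%C.
have dF i : cquad_decay (F i).
  split; last exact: quad_decay0.
  exact: quad_decay_norm (quad_decay_window_hat_shift _).
have E : (fun xi => `|lac_test_hat l xi|) = (fun xi : Rd => complex.Re (\prod_(i < n.+1) F i
  (xi 0 i))).
  by apply/funext => xi; rewrite /lac_test_hat normr_prod prod_real_complex.
have [[c _] e] := citer_integrable_prod dF.
rewrite E; split => //.
have /(congr1 (@complex.Re R)) /= -> := e.
rewrite (eq_bigr (fun=> (hat_mass%:C)%C)) ?prodr_const ?card_ord; last first.
  move=> i _; apply: complexP => /=; last by rewrite Rintegral_cst// mul0r.
  exact: (Rintegral_shift (- freq l i) (quad_decay_norm (@quad_decay_window_hat R))).
by rewrite -rmorphXn.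
Qed.

Variable m : Rd -> R[i].
Hypothesis mRe : forall xi, xi != 0 -> {for xi, continuous (fun xi => complex.Re (m xi))}.
Hypothesis mIm : forall xi, xi != 0 -> {for xi, continuous (fun xi => complex.Im (m xi))}.

Lemma continuous_lac_test_hat l : continuous (lac_test_hat l).
Proof.
apply: (continuous_coord_prod (F := fun i t => window_hat (t - freq l i))) => i.
by case: (quad_decay_window_hat_shift (freq l i)).
Qed.

Lemma continuous_dotp x : continuous (fun xi : Rd => dotp x xi).
Proof.
rewrite /dotp; elim: (index_enum _) => [|i r IH] xi.
  rewrite (_ : (fun xi : Rd => \sum_(i <- [::]) _) = (fun=> 0)); first exact: continuous_at_cst.
  by apply/funext => y; rewrite big_nil.
rewrite (_ : (fun xi : Rd => \sum_(i <- i :: r) x 0 i * xi 0 i) =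
    (fun xi => x 0 i * xi 0 i + \sum_(i <- r) x 0 i * xi 0 i)); last first.
  by apply/funext => y; rewrite big_cons.
have c1 : {for xi, continuous (fun xi : Rd => x 0 i * xi 0 i)}.
  by apply: continuous_atM; [exact: continuous_at_cst|exact: coord_continuous].
exact: (continuous_atD c1 (IH xi)).
Qed.

Lemma continuous_scale (c : R) : continuous (fun xi : Rd => c *: xi).
Proof. by move=> xi; exact: scaler_continuous. Qed.

(** Near a point with [xi_0 < 1] the product is identically 0; at every other point [c *: xi] is
    nonzero, so [h] is continuous there. *)
Lemma continuous_off0_mul (h r : Rd -> R) (c : R) : c != 0 ->
  (forall xi, xi != 0 -> {for xi, continuous h}) -> continuous r ->
  (forall xi, xi 0 ord0 < 1 -> r xi = 0) -> continuous (fun xi => r xi * h (c *: xi)).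
Proof.
move=> c0 ch cr r0 xi.
have [xi1|xi1] := ltP (xi 0 ord0) 1.
  apply: (@continuous_at_near _ _ (fun=> 0)); last exact: continuous_at_cst.
  have cc : {for xi, continuous (fun v : Rd => v 0 ord0)} by exact: coord_continuous.
  have N1 : nbhs xi (fun y : Rd => y 0 ord0 < 1) by exact: (cvgr_lt _ cc _ xi1).
  by apply: filterS N1 => y y1; rewrite r0// mul0r.
apply: continuous_atM; first exact: cr.
apply: (@continuous_comp _ _ _ (fun xi : Rd => c *: xi) h); first exact: continuous_scale.
apply: ch; rewrite scaler_eq0 (negbTE c0)/=; apply/eqP => x0.
by move: xi1; rewrite x0 mxE; lra.
Qed.

Lemma multiplier_integrand x (c : R) : c != 0 ->
  citer_integrable (fun xi => m (c *: xi) * FT lac_test xi * expi (2 * pi * dotp x xi)).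
Proof.
move=> c0.
pose r xi := a * \sum_(l < N) lac_test_hat l xi.
have cs : continuous (fun xi => \sum_(l < N) lac_test_hat l xi).
  elim: (index_enum _) => [|l q IH] xi.
    rewrite (_ : (fun xi => \sum_(l <- [::]) _) = (fun=> 0)); first exact: continuous_at_cst.
    by apply/funext => y; rewrite big_nil.
  rewrite (_ : (fun xi => \sum_(l <- l :: q) lac_test_hat l xi) =
      (fun xi => lac_test_hat l xi + \sum_(l <- q) lac_test_hat l xi)); last first.
    by apply/funext => y; rewrite big_cons.
  exact: (continuous_atD (@continuous_lac_test_hat l xi) (IH xi)).
have ctrig (f : R -> R) : continuous f -> continuous (fun xi => r xi * f (2 * pi * dotp x xi)).
  move=> cf xi; apply: continuous_atM.
    by apply: continuous_atM; [exact: continuous_at_cst|exact: cs].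
  apply: (@continuous_comp _ _ _ (fun xi : Rd => 2 * pi * dotp x xi) f); last exact: cf.
  by apply: continuous_atM; [exact: continuous_at_cst|exact: continuous_dotp].
have r0 xi : xi 0 ord0 < 1 -> r xi = 0.
  by move=> xi1; rewrite /r big1 ?mulr0// => l _; apply: lac_test_hat_low.
have rB i xi : lac_test_box w < `|xi 0 i| -> r xi = 0.
  by move=> xiB; rewrite /r big1 ?mulr0// => l _; apply: (lac_test_hat_box w2 l xiB).
have cont (f h : _ -> R) : continuous f -> (forall xi, xi != 0 -> {for xi, continuous h}) ->
    continuous (fun xi => r xi * f (2 * pi * dotp x xi) * h (c *: xi)).
  move=> cf ch; apply: (continuous_off0_mul (r := fun xi => r xi * f (2 * pi * dotp x xi)))
    => //.
    exact: ctrig.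
  by move=> xi /r0 ->; rewrite mul0r.
have ccos := @continuous_cos R; have csin := @continuous_sin R.
split.
  apply: (@iter_integrable_continuous_supp _ _ _ (lac_test_box w)).
    rewrite (_ : (fun xi => _) = (fun xi =>
      r xi * cos (2 * pi * dotp x xi) * complex.Re (m (c *: xi)) +
      (-1) * (r xi * sin (2 * pi * dotp x xi) * complex.Im (m (c *: xi))))); last first.
      apply/funext => xi; rewrite FT_lac_test// !(Re_mul, Im_mul) /= -/(r xi); ring.
    have k1 := cont _ _ ccos mRe; have k2 := cont _ _ csin mIm.
    move=> xi; exact: (continuous_atD (k1 xi) (continuous_atM (@continuous_at_cst R _ (-1)
      xi) (k2 xi))).
  by move=> xi i xiB; rewrite FT_lac_test// -/(r xi) (rB _ _ xiB) mulr0 mul0r.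
apply: (@iter_integrable_continuous_supp _ _ _ (lac_test_box w)).
  rewrite (_ : (fun xi => _) = (fun xi =>
    r xi * cos (2 * pi * dotp x xi) * complex.Im (m (c *: xi)) +
    r xi * sin (2 * pi * dotp x xi) * complex.Re (m (c *: xi)))); last first.
    apply/funext => xi; rewrite FT_lac_test// !(Re_mul, Im_mul) /= -/(r xi); ring.
  have k1 := cont _ _ ccos mIm; have k2 := cont _ _ csin mRe.
  move=> xi; exact: (continuous_atD (k1 xi) (k2 xi)).
by move=> xi i xiB; rewrite FT_lac_test// -/(r xi) (rB _ _ xiB) mulr0 mul0r.
Qed.

(** On the unit box around the l-th frequency, outside which [lac_test_hat l] vanishes, the symbol
    is replaced by the scalar [b l]. The error integrand is dominated by [a * eta] times the sum of
    the [|lac_test_hat l|], each of integral [hat_mass ^+ n.+1]; the factor 2 comes from estimating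
    real and imaginary parts separately. *)
Lemma multiplier_approx (c eta : R) (b : 'I_N -> R[i]) x : c != 0 -> 0 <= eta ->
  (forall l xi, (forall i, `|xi 0 i - freq l i| <= 1) -> cmod (m (c *: xi) - b l) <= eta) ->
  cmod (IFT (fun xi => m (c *: xi) * FT lac_test xi) x -
    (a%:C)%C * (\sum_(l < N) b l * expi (2 * pi * (x 0 0 * w l))) *
      \prod_i ((window_tilde (x 0 i))%:C)%C) <=
  2 * (a * eta * N%:R * hat_mass ^+ n.+1).
Proof.
move=> c0 eta0 mb.
have cG := multiplier_integrand x c0.
(* Minus the integrand with frozen symbol, so that the difference to be estimated becomes a single
   integral. *)
pose M xi := \sum_(l < N) (- ((a%:C)%C * b l)) * main_term l x xi.
have [cM eM] : citer_integrable M /\ cint M = \sum_(l < N) cint (fun xi => (- ((a%:C)%C * b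
  l)) * main_term l x xi).
  by apply: citer_integrable_sum => l; exact: (citer_integrable_Z _ (cint_main_term l x).1).1.
have [cD eD] := citer_integrable_D cG cM.
rewrite (_ : IFT _ x - _ = cint (fun xi => m (c *: xi) * FT lac_test xi * expi (2 * pi * dotp
  x xi) + M xi)); last first.
  rewrite eD; congr (_ + _); rewrite eM -mulrA -mulNr mulr_suml mulr_sumr;
    apply: eq_bigr => l _.
  by rewrite (citer_integrable_Z _ (cint_main_term l x).1).2 (cint_main_term l x).2 !mulrA
    !mulNr.
pose H xi := \sum_(l < N) (a * eta) * `|lac_test_hat l xi|.
have [iH eH] : iter_integrable H /\ iRint H = N%:R * (a * eta * hat_mass ^+ n.+1).
  have iF l : citer_integrable (fun xi => ((a * eta)%:C)%C * ((`|lac_test_hat l xi|)%:C)%C).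
    apply: (citer_integrable_Z _ _).1; split; first exact: (iRint_lac_test_hat l).1.
    by have := (iter_integrable_Z 0 (iRint_lac_test_hat l).1).1; under eq_fun do rewrite mul0r.
  have [cs es] := citer_integrable_sum iF.
  have E : H = (fun xi => complex.Re (\sum_(l < N) ((a * eta)%:C)%C * ((`|lac_test_hat l
    xi|)%:C)%C)).
    by apply/funext => xi; rewrite Re_sum; apply: eq_bigr => l _; rewrite Re_mul /= mulr0 subr0.
  rewrite E; split; first exact: cs.1.
  have /(congr1 (@complex.Re R)) /= -> := es; rewrite Re_sum.
  rewrite (eq_bigr (fun=> a * eta * hat_mass ^+ n.+1));
    first by rewrite sumr_const card_ord mulr_natl.
  move=> l _; have [_ <-] := iRint_lac_test_hat l;
    rewrite -(iter_integrable_Z _ (iRint_lac_test_hat l).1).2.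
  apply: (congr1 (@iRint R n.+1)); apply/funext => xi.
  by rewrite Re_mul /= mulr0 subr0.
have DH xi : cmod (m (c *: xi) * FT lac_test xi * expi (2 * pi * dotp x xi) + M xi) <= H xi.
  rewrite (_ : _ + _ = \sum_(l < N) (m (c *: xi) - b l) * ((a * lac_test_hat l xi)%:C)%C *
    expi (2 * pi * dotp x xi)); last first.
    rewrite FT_lac_test// mulr_sumr rmorph_sum /= mulr_sumr mulr_suml -big_split;
      apply: eq_bigr => l _ /=.
    by rewrite main_termE rmorphM /=; ring.
  rewrite (le_trans (ler_cmod_sum _))//; apply: ler_sum => l _.
  rewrite cmodM cmod_expi mulr1 cmodM cmod_real normrM (ger0_norm a0) -mulrA mulrCA ler_wpM2l//.
  have [h|h] := pselect (forall i, `|xi 0 i - freq l i| <= 1).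
    by rewrite ler_wpM2r// mb.
  move/existsNP: h => [i /negP]; rewrite -ltNge => /(@lac_test_hat_supp _ _ _ w l xi i) ->.
  by rewrite normr0 !mulr0.
rewrite (le_trans (cmod_le_ReIm _))//.
have h1 : `|iRint (fun xi => complex.Re (m (c *: xi) * FT lac_test xi * expi (2 * pi * dotp x
  xi) + M xi))| <= iRint H.
  by apply: iRint_norm => //; [exact: cD.1|move=> xi; exact: le_trans (ler_Re _) (DH xi)].
have h2 : `|iRint (fun xi => complex.Im (m (c *: xi) * FT lac_test xi * expi (2 * pi * dotp x
  xi) + M xi))| <= iRint H.
  by apply: iRint_norm => //; [exact: cD.2|move=> xi; exact: le_trans (ler_Im _) (DH xi)].
rewrite (le_trans (lerD h1 h2))// eH.
rewrite le_eqVlt; apply/orP; left; apply/eqP; ring.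
Qed.

End MultiplierAction.

(** * Lebesgue norms of the test function *)

Section LacunarySum.
Variable R : realType.
Local Notation mu := (@lebesgue_measure R).
Local Notation W := (fun t : R => (oneDsqr t)^-1).
Implicit Types (y t : R) (u v z : R[i]).

Definition lac_sum N y : R[i] := \sum_(l < N) expi (2 * pi * (y * 2 ^+ l)).

Lemma cmod_sqr z : cmod z ^+ 2 = complex.Re z ^+ 2 + complex.Im z ^+ 2.
Proof. by rewrite sqr_sqrtr// addr_ge0 ?sqr_ge0. Qed.

Lemma cmod_parallelogram u v :
  cmod (u + v) ^+ 2 + cmod (- u + v) ^+ 2 = 2 * (cmod u ^+ 2 + cmod v ^+ 2).
Proof. by rewrite !cmod_sqr; case: u v => a b [c e] /=; ring. Qed.

Lemma expiDpi t : expi (t + pi) = - expi t :> R[i].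
Proof. by apply: complexP; rewrite /= ?cosDpi ?sinDpi. Qed.

Lemma expi_nat k : expi (2 * pi * k%:R) = 1 :> R[i].
Proof.
elim: k => [|k IH]; first by rewrite mulr0 expi0.
rewrite -[k.+1%:R]natr1 mulrDr expiD IH mul1r mulr1 -[2 * pi]add0r.
by rewrite (_ : 0 + 2 * pi = 0 + pi + pi); [rewrite !expiDpi opprK expi0|ring].
Qed.

Lemma expiD_nat t k : expi (2 * pi * (t + k%:R)) = expi (2 * pi * t) :> R[i].
Proof. by rewrite mulrDr expiD expi_nat mulr1. Qed.

Lemma lac_sumD1 N y : lac_sum N (y + 1) = lac_sum N y.
Proof.
by apply: eq_bigr => l _; rewrite (mulrDl y 1) mul1r -natrX expiD_nat.
Qed.

Lemma lac_sumS N y : lac_sum N.+1 y = expi (2 * pi * y) + lac_sum N (2 * y).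
Proof.
rewrite /lac_sum big_ord_recl expr0 mulr1; congr (_ + _); apply: eq_bigr => l _.
by rewrite lift0 exprS [2 * y]mulrC !mulrA.
Qed.

(* Shifting [y] by 1/2 flips the sign of the first summand only. *)
Lemma lac_sum_Parseval N y :
  \sum_(j < 2 ^ N) cmod (lac_sum N (y + j%:R / 2 ^+ N)) ^+ 2 = N%:R * 2 ^+ N.
Proof.
elim: N y => [|N IH] y.
  by rewrite big_ord1 /lac_sum big_ord0 cmod0 expr0n /= mul0r.
have p2 : (2 : R) ^+ N != 0 by rewrite expf_neq0.
have key (p q x k : R) : q != 0 -> 2 * p * (x + (q + k) / (2 * q)) = 2 * p * (x + k / (2 *
  q)) + p.
  by move=> q0; field; rewrite q0.
(* The nodes of index [j] and [2 ^ N + j] differ by 1/2 and are paired by the parallelogram law;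
   doubling the argument then leads back to the sum for [N]. *)
rewrite expnS mul2n -addnn big_split_ord /= -big_split /=.
rewrite (eq_bigr (fun j : 'I_(2 ^ N) => 2 + 2 * cmod (lac_sum N (2 * y + j%:R / 2 ^+ N)) ^+
  2)); last first.
  move=> j _; rewrite !lac_sumS.
  rewrite (_ : 2 * (y + j%:R / 2 ^+ N.+1) = 2 * y + j%:R / 2 ^+ N); last first.
    by rewrite exprS; field; rewrite p2.
  rewrite (_ : 2 * (y + (2 ^ N + j)%:R / 2 ^+ N.+1) = 2 * y + j%:R / 2 ^+ N + 1); last first.
    by rewrite natrD natrX exprS; field; rewrite p2.
  rewrite (_ : 2 * pi * (y + (2 ^ N + j)%:R / 2 ^+ N.+1) = 2 * pi * (y + j%:R / 2 ^+ N.+1) +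
    pi); last first.
    by rewrite natrD natrX exprS key.
  by rewrite lac_sumD1 expiDpi cmod_parallelogram cmod_expi expr1n mulrDr mulr1.
rewrite big_split /= sumr_const card_ord -mulr_sumr IH -[N.+1%:R]natr1 exprS -[2 *+ (2 ^
  N)]mulr_natr natrX.
ring.
Qed.

Lemma lac_sum_le N y : cmod (lac_sum N y) <= N%:R.
Proof.
rewrite (le_trans (ler_cmod_sum _))// (eq_bigr (fun=> 1)) ?sumr_const ?card_ord//.
by move=> l _; exact: cmod_expi.
Qed.

Lemma continuous_cmod_lac N (L : R) : continuous (fun t => cmod (lac_sum N (t * L)) ^+ 2).
Proof.
have E : (fun t => cmod (lac_sum N (t * L)) ^+ 2) = (fun t =>
    (\sum_(l < N) cos (2 * pi * (t * L * 2 ^+ l))) * (\sum_(l < N) cos (2 * pi * (t * L * 2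
      ^+ l))) +
    (\sum_(l < N) sin (2 * pi * (t * L * 2 ^+ l))) * (\sum_(l < N) sin (2 * pi * (t * L * 2
      ^+ l)))).
  by apply/funext => t; rewrite cmod_sqr /lac_sum Re_sum Im_sum !expr2.
have H (f : R -> R) : continuous f -> continuous (fun t => \sum_(l < N) f (2 * pi * (t * L *
  2 ^+ l))).
  move=> cf; elim: (index_enum _) => [|l q IH] t.
    rewrite (_ : (fun t => \sum_(l <- [::]) _) = (fun=> 0)); first exact: cvg_cst.
    by apply/funext => s; rewrite big_nil.
  rewrite (_ : (fun t => \sum_(l <- l :: q) f (2 * pi * (t * L * 2 ^+ l))) =
      (fun t => f (2 * pi * (t * L * 2 ^+ l)) + \sum_(l <- q) f (2 * pi * (t * L * 2 ^+
        l)))); last first.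
    by apply/funext => s; rewrite big_cons.
  apply: cvgD; last exact: IH.
  apply: (@continuous_comp _ _ _ (fun t => 2 * pi * (t * L * 2 ^+ l)) f); last exact: cf.
  apply: cvgM; first exact: cvg_cst.
  by apply: cvgM; [apply: cvgM; [exact: cvg_id|exact: cvg_cst]|exact: cvg_cst].
have cc := H _ (@continuous_cos R); have cs := H _ (@continuous_sin R).
by rewrite E => t; apply: cvgD; apply: cvgM; [exact: cc|exact: cc|exact: cs|exact: cs].
Qed.

Lemma Rintegral_dec_sum n (F : 'I_n -> R -> R) : (forall i, quad_decay (F i)) ->
  \int[mu]_t (\sum_(i < n) F i t) = \sum_(i < n) \int[mu]_t F i t.
Proof.
move=> dF; have dF' i : cquad_decay (fun t => ((F i t)%:C)%C) by split;
  [exact: dF|exact: quad_decay0].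
have /(congr1 (@complex.Re R)) := (cint1_sum dF').2; rewrite Re_sum /= => <-.
by apply: eq_Rintegral => t _; rewrite Re_sum.
Qed.

Lemma quad_decay_W : quad_decay W.
Proof.
split; first by move=> x; exact: continuous_oneDsqrV.
by exists 1 => t; rewrite mul1r ger0_norm// ltW// oneDsqrV_gt0.
Qed.

Lemma Rintegral_W : \int[mu]_t W t = pi.
Proof. by rewrite /Rintegral integral_oneDsqrV. Qed.

Lemma quad_decay_lac_W N (L : R) : quad_decay (fun t => cmod (lac_sum N (t * L)) ^+ 2 * W t).
Proof.
apply: (@quad_decay_mulb _ _ _ (N%:R ^+ 2)); [exact: continuous_cmod_lac| |exact: quad_decay_W].
by move=> t; rewrite ger0_norm ?sqr_ge0// ler_sqr ?nnegrE ?cmod_ge0// lac_sum_le.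
Qed.

(** Averaging over the translations of [t] by [j / (2 ^ N L)], [j < 2 ^ N], replaces [|S|^2] by its
    exact mean [N], by [lac_sum_Parseval]. As [L >= 1] these translations are at most 1, so each
    costs the weight a factor 3; the weight has integral [pi]. *)
Lemma Rintegral_lac_W N (L : R) : 1 <= L ->
  \int[mu]_t (cmod (lac_sum N (t * L)) ^+ 2 * W t) <= 3 * N%:R * pi.
Proof.
move=> L1; have L0 : L != 0 by rewrite gt_eqF// (lt_le_trans ltr01).
set I := \int[mu]_t _.
have p2 : 0 < (2 : R) ^+ N by rewrite exprn_gt0.
pose s (j : 'I_(2 ^ N)) : R := j%:R / 2 ^+ N / L.
have s1 j : `|s j| <= 1.
  rewrite /s ger0_norm; last by apply: divr_ge0;
    [exact: divr_ge0 (ltW p2)|exact: le_trans ler01 L1].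
  rewrite ler_pdivrMr ?(lt_le_trans ltr01)// mul1r (le_trans _ L1)//.
  by rewrite ler_pdivrMr// mul1r -natrX ler_nat ltnW.
have dj (j : 'I_(2 ^ N)) : quad_decay (fun t => 3 * (cmod (lac_sum N (t * L + j%:R / 2 ^+ N))
  ^+ 2 * W t)).
  apply: quad_decayZ; apply: (@quad_decay_mulb _ _ _ (N%:R ^+ 2)); [|by move=> t;
    rewrite ger0_norm ?sqr_ge0// ler_sqr ?nnegrE ?cmod_ge0// lac_sum_le|exact: quad_decay_W].
  rewrite (_ : (fun t => cmod (lac_sum N (t * L + j%:R / 2 ^+ N)) ^+ 2) =
      (fun t => cmod (lac_sum N (t * L)) ^+ 2) \o (fun t => t + s j)); last first.
    by apply/funext => t /=; rewrite mulrDl [s j * L](_ : _ = j%:R / 2 ^+ N)// /s divfK.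
  move=> t; apply: continuous_comp; last exact: continuous_cmod_lac.
  by apply: cvgD; [exact: cvg_id|exact: cvg_cst].
have Ij (j : 'I_(2 ^ N)) : I <= \int[mu]_t (3 * (cmod (lac_sum N (t * L + j%:R / 2 ^+ N)) ^+
  2 * W t)).
  rewrite /I -(Rintegral_shift (s j) (quad_decay_lac_W N L)).
  apply: le_Rintegral_decay => //; first exact: (quad_decay_shift (s j) (quad_decay_lac_W N L)).
  move=> t; rewrite mulrDl (_ : s j * L = j%:R / 2 ^+ N); last by rewrite /s divfK.
  by rewrite [leRHS]mulrCA ler_wpM2l ?sqr_ge0// oneDsqrV_shift.
have : \sum_(j < 2 ^ N) I <= \sum_(j < 2 ^ N) \int[mu]_t (3 * (cmod (lac_sum N (t * L + j%:R
  / 2 ^+ N)) ^+ 2 * W t)).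
  by apply: ler_sum => j _; exact: Ij.
rewrite sumr_const card_ord -[I *+ _]mulr_natl natrX.
rewrite (_ : \sum_(j < _) _ = \int[mu]_t (3 * N%:R * 2 ^+ N * W t)); last first.
  rewrite -(Rintegral_dec_sum dj); apply: eq_Rintegral => t _.
  by rewrite -mulr_sumr -mulr_suml lac_sum_Parseval !mulrA.
rewrite RintegralZl_decay ?Rintegral_W; last exact: quad_decay_W.
by rewrite (_ : 3 * N%:R * 2 ^+ N * pi = 2 ^+ N * (3 * N%:R * pi)) ?ler_pM2l//; ring.
Qed.

End LacunarySum.

(** * Upper and lower bounds for [L^p] norms *)

Section LpEstimates.
Variables (R : realType) (n N : nat).
Local Notation Rd := 'rV[R]_n.+1.
Local Notation mu := (@lebesgue_measure R).
Local Notation W := (fun t : R => (oneDsqr t)^-1).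
Implicit Types (x : Rd) (t : R).

Lemma window_bound : exists C : R, 1 <= C /\ forall t, `|window t| <= C * W t.
Proof.
have [_ [C HC]] := @quad_decay_window R.
exists (Num.max 1 C); split; first by rewrite le_max lexx.
move=> t; rewrite (le_trans (HC t))// ler_wpM2r ?le_max ?lexx ?orbT//.
Qed.

Definition lac_freq (L : R) (l : 'I_N) : R := L * 2 ^+ l.

Lemma lac_freq_ge (L : R) l : 2 <= L -> 2 <= lac_freq L l.
Proof.
move=> L2; rewrite (le_trans L2)// /lac_freq ler_peMr ?(le_trans _ L2)//.
by rewrite exprn_ege1// ler1n.
Qed.

Lemma exp_sum_lac (L : R) t : exp_sum (lac_freq L) t = lac_sum N (t * L).
Proof. by apply: eq_bigr => l _; rewrite /lac_freq !mulrA. Qed.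

Lemma cmod_lac_test_le (L a C : R) x : 0 <= a -> 1 <= C -> (forall t, `|window t| <= C * W t) ->
  cmod (lac_test (n := n) a (lac_freq L) x) <=
  a * C ^+ n.+1 * (cmod (lac_sum N (x 0 ord0 * L)) * \prod_i W (x 0 i)).
Proof.
move=> a0 C1 hC; have C0 : 0 <= C by rewrite (le_trans _ C1).
rewrite /lac_test cmod_prod big_ord_recl /lac_test_factor /= cmodM cmod_real exp_sum_lac
  normrM ger0_norm//.
rewrite (eq_bigr (fun i => `|window (x 0 (lift ord0 i))|)); last by move=> i _;
  rewrite cmod_real.
have P : \prod_(i < n) `|window (x 0 (lift ord0 i))| <= C ^+ n * \prod_(i < n) W (x 0 (lift
  ord0 i)).
  rewrite -[X in C ^+ X](card_ord n) -prodr_const -big_split /=.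
  by apply: ler_prod => i _; rewrite normr_ge0 hC.
apply: le_trans (ler_wpM2l _ P) _; first by rewrite mulr_ge0 ?cmod_ge0// mulr_ge0.
rewrite big_ord_recl exprS.
set z := cmod _; set u := window _; set q := \prod_(i < n) _.
have q0 : 0 <= q by rewrite prodr_ge0// => i _; exact/ltW/oneDsqrV_gt0.
rewrite (_ : a * _ * _ = (a * z * (C ^+ n * q)) * (C * W (x 0 ord0))); last by ring.
rewrite (_ : z * _ * _ = (a * z * (C ^+ n * q)) * `|u|); last by ring.
rewrite ler_wpM2l//; last exact: hC.
by rewrite !mulr_ge0 ?cmod_ge0 ?exprn_ge0.
Qed.

(** With [u = |S / N| <= 1] and [P <= 1] the product of the weights,
    [(u P)^p <= u P <= (lam + u^2 / lam) P] for [p >= 1]. The majorant is a product function, so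
    [iEint_prod] evaluates it, and [Rintegral_lac_W] turns the quadratic term into
    [3 / (lam * N)]. *)
Lemma Lp_lac_test (L a C p lam : R) : 1 <= L -> 0 <= a -> 1 <= C ->
  (forall t, `|window t| <= C * W t) -> 1 <= p -> 0 < lam -> (0 < N)%N ->
  (iEint (fun x => (`|(cmod (lac_test (n := n) a (lac_freq L) x))%:E| `^ p)) <=
   ((a * C ^+ n.+1 * N%:R) `^ p * ((lam + 3 / (lam * N%:R)) * pi ^+ n.+1))%:E)%E.
Proof.
move=> L1 a0 C1 hC p1 lam0 N0; have C0 : 0 <= C by rewrite (le_trans _ C1).
have N0' : 0 < N%:R :> R by rewrite ltr0n.
have W1 t : W t <= 1 by exact: oneDsqrV_le1.
have W0 t : 0 < W t by exact: oneDsqrV_gt0.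
pose k := lam^-1 / N%:R ^+ 2.
pose w0 t := lam * W t + k * (cmod (lac_sum N (t * L)) ^+ 2 * W t).
pose w (i : 'I_n.+1) t := if i == ord0 then w0 t else W t.
pose J (i : 'I_n.+1) := if i == ord0 then \int[mu]_t w0 t else pi.
have dw0 : quad_decay w0 by apply: quad_decayD; apply: quad_decayZ;
  [exact: quad_decay_W|exact: quad_decay_lac_W].
have k0 : 0 <= k by rewrite divr_ge0 ?invr_ge0 ?ltW// exprn_gt0.
have w0_ge0 t : 0 <= w0 t.
  apply: addr_ge0; apply: mulr_ge0; [exact: ltW|exact: ltW|exact: k0|].
  by apply: mulr_ge0; [exact: sqr_ge0|exact: ltW].
have wJ : iEint (fun x => ((a * C ^+ n.+1 * N%:R) `^ p * \prod_(i < n.+1) w i (x 0 i))%:E) =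
    ((a * C ^+ n.+1 * N%:R) `^ p * \prod_(i < n.+1) J i)%:E.
  apply: iEint_prod => [|i t|i|i]; first exact: powR_ge0.
  - by rewrite /w; case: (i == ord0) => //; exact: ltW.
  - rewrite /w; case: (i == ord0).
      by apply: continuous_measurable_fun; case: dw0.
    by apply: continuous_measurable_fun; case: (@quad_decay_W R).
  - rewrite /w /J; case: (i == ord0); first exact: integral_decay.
    exact: integral_oneDsqrV.
have J0 : \int[mu]_t w0 t <= (lam + 3 / (lam * N%:R)) * pi.
  rewrite /w0 RintegralD_decay; [|apply: quad_decayZ;
    exact: quad_decay_W|apply: quad_decayZ; exact: quad_decay_lac_W].
  rewrite RintegralZl_decay ?RintegralZl_decay; [|exact: quad_decay_lac_W|exact: quad_decay_W].
  rewrite Rintegral_W mulrDl lerD2l.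
  rewrite (le_trans (ler_wpM2l k0 (Rintegral_lac_W N L1)))//.
  rewrite le_eqVlt; apply/orP; left; apply/eqP; rewrite !mulrA; congr (_ * pi).
  by rewrite /k; field; rewrite !gt_eqF.
apply: (@le_trans _ _ ((a * C ^+ n.+1 * N%:R) `^ p * \prod_(i < n.+1) J i)%:E); last first.
  rewrite lee_fin ler_wpM2l ?powR_ge0// big_ord_recl {1}/J eqxx exprS mulrA.
  rewrite (eq_bigr (fun=> pi)) ?prodr_const ?card_ord; last by move=> i _.
  by rewrite ler_wpM2r// exprn_ge0// pi_ge0.
rewrite -wJ; apply: le_iEint => x; first exact: poweR_ge0.
rewrite abse_EFin poweR_EFin lee_fin (ger0_norm (cmod_ge0 _)).
set y := cmod (lac_sum N (x 0 ord0 * L)); set P := \prod_i W (x 0 i).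
have P0 : 0 < P by rewrite prodr_gt0.
have P1 : P <= 1 by apply: prodr_ile1 => i _; apply/andP; split; [exact: ltW|exact: W1].
have yN : y <= N%:R by exact: lac_sum_le.
have y0 : 0 <= y by exact: cmod_ge0.
have prodw : \prod_(i < n.+1) w i (x 0 i) = (lam + k * y ^+ 2) * P.
  rewrite big_ord_recl {1}/w eqxx /P [in RHS]big_ord_recl mulrA; congr (_ * _).
  by rewrite /w0 -/y; ring.
rewrite prodw.
have A0 : 0 <= a * C ^+ n.+1 by rewrite mulr_ge0 ?exprn_ge0.
have z0 : 0 <= y / N%:R * P by apply: mulr_ge0; [exact: divr_ge0|exact: ltW].
have AN0 : 0 <= a * C ^+ n.+1 * N%:R by exact: mulr_ge0.
apply: (@le_trans _ _ ((a * C ^+ n.+1 * N%:R * (y / N%:R * P)) `^ p)).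
  apply: ge0_ler_powR; rewrite ?nnegrE ?cmod_ge0 ?(le_trans _ p1)//.
    exact: mulr_ge0.
  rewrite (le_trans (cmod_lac_test_le L x a0 C1 hC))//.
  rewrite le_eqVlt; apply/orP; left; apply/eqP; rewrite -/y -/P; field.
  by rewrite gt_eqF.
rewrite powRM//.
rewrite ler_wpM2l ?powR_ge0//.
have yN1 : y / N%:R <= 1 by rewrite ler_pdivrMr// mul1r.
have [->|y_neq0] := eqVneq y 0.
  rewrite mul0r mul0r powR0 ?mulr_ge0 ?(ltW P0)//; last by rewrite gt_eqF// (lt_le_trans _ p1).
  by rewrite expr0n mulr0 addr0 (ltW lam0).
have yp : 0 < y by rewrite lt_neqAle eq_sym y_neq0.
rewrite (@le_trans _ _ (y / N%:R * P))//.
  apply: ge1r_powR => //; rewrite !mulr_gt0 ?invr_gt0//=.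
  by rewrite -[leRHS]mulr1 ler_pM ?divr_ge0 ?(ltW P0)// ltW.
rewrite ler_wpM2r ?(ltW P0)//.
have -> : k * y ^+ 2 = (y / N%:R) ^+ 2 / lam by rewrite /k expr_div_n; field; rewrite !gt_eqF.
set u := y / N%:R.
rewrite -(ler_pM2r lam0) mulrDl mulfVK ?gt_eqF//.
have := sqr_ge0 (lam - u); have : 0 <= u by rewrite divr_ge0// ltW.
nra.
Qed.

Lemma Lpnorm_le1 (p : R) (g : Rd -> \bar R) : 0 < p ->
  (iEint (fun x => `|g x| `^ p) <= 1)%E -> (Lpnorm p g <= 1)%E.
Proof.
move=> p0 h; rewrite /Lpnorm -(poweR1r p^-1).
apply: gt0_ler_poweR => //; first by rewrite invr_ge0 ltW.
  have iE0 : (0 <= iEint (fun x => `|g x| `^ p))%E by apply: iEint_ge0 => v; exact: poweR_ge0.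
  by rewrite in_itv /= leey andbT; exact: iE0.
by rewrite in_itv /= leey andbT lee01.
Qed.

(** Chebyshev on a cube: [|g|^p] is compared pointwise with [mulow^p] times the indicator of the
    cube, a product function whose iterated integral is explicit. *)
Lemma Lpnorm_lower (p K mulow x0 r : R) (g : Rd -> \bar R) : 0 < p -> 0 <= K ->
  0 <= mulow -> 0 < r ->
  (Lpnorm p g <= K%:E)%E ->
  (forall x, (forall i, `|x 0 i - x0| <= r) -> (mulow%:E <= g x)%E) ->
  mulow `^ p * (2 * r) ^+ n.+1 <= K `^ p.
Proof.
move=> p0 K0 m0 r0 hL hg.
have iE0 : (0 <= iEint (fun x => `|g x| `^ p))%E.
  by apply: iEint_ge0 => v; exact: poweR_ge0.
have H1 : (iEint (fun x => `|g x| `^ p) <= (K `^ p)%:E)%E.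
  have L0 : Lpnorm p g \in `[0%E, +oo%E] by rewrite in_itv; apply/andP; split;
    [exact: poweR_ge0|exact: leey].
  have K0' : K%:E \in `[0%E, +oo%E] by rewrite in_itv; apply/andP; split;
    [exact: K0|exact: leey].
  have : (Lpnorm p g `^ p <= K%:E `^ p)%E by exact: (gt0_ler_poweR (ltW p0) L0 K0' hL).
  by rewrite poweR_EFin /Lpnorm -poweRrM mulVf ?gt_eqF// poweRe1.
pose I := `[x0 - r, x0 + r]%classic : set R.
pose w (i : 'I_n.+1) t : R := \1_I t.
have wJ : iEint (fun x => (mulow `^ p * \prod_(i < n.+1) w i (x 0 i))%:E) =
    (mulow `^ p * \prod_(i < n.+1) (2 * r))%:E.
  apply: iEint_prod => [|i t|i|i]; first exact: powR_ge0.
  - by rewrite /w indicE.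
  - by apply: measurable_indic; exact: measurable_itv.
  - rewrite /w integral_indic//; last exact: measurable_itv.
    rewrite setIT /= lebesgue_measure_itv /= lte_fin ifT; last lra.
    by rewrite -EFinB; congr EFin; lra.
rewrite -lee_fin (le_trans _ H1)//.
rewrite -[X in (2 * r) ^+ X](card_ord n.+1) -prodr_const -wJ; apply: le_iEint => x.
  by rewrite lee_fin mulr_ge0 ?powR_ge0// prodr_ge0// => i _; rewrite /w indicE.
have [h|/existsNP[i hi]] := pselect (forall i, `|x 0 i - x0| <= r).
  rewrite big1 ?mulr1 -?poweR_EFin; last first.
    move=> i _; rewrite /w indicE mem_set//= /I /= in_itv /=.
    by have := h i; rewrite ler_distl => /andP[? ?]; apply/andP; split; lra.
  have := hg x h; have m0' : (0 <= mulow%:E)%E by rewrite lee_fin.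
  move=> hgx; have g0 := le_trans m0' hgx; rewrite gee0_abs//.
  by apply: gt0_ler_poweR; rewrite ?(ltW p0)// in_itv /= leey ?m0' ?g0.
rewrite (bigD1 i)//= {1}/w indicE memNset ?mul0r ?mulr0 ?poweR_ge0//=.
rewrite /I /= in_itv /= => /andP[h1 h2]; apply: hi; rewrite ler_distl; apply/andP; split; lra.
Qed.

End LpEstimates.

(** * Perturbing a symbol on dyadic shells *)

Section Selection.
Variable R : realType.
Implicit Types (a b y t : R).

Lemma lipschitz1 (f df : R -> R) : (forall x : R, is_derive x 1 f (df x)) ->
  (forall x, `|df x| <= 1) -> forall a b, `|f a - f b| <= `|a - b|.
Proof.
move=> Df df1.
have H a b : a < b -> `|f b - f a| <= `|b - a|.
  move=> ab; have [|x _ ->] := MVT ab (fun x _ => Df x).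
    apply: continuous_subspaceT => x; apply: differentiable_continuous; apply/derivable1_diffP.
    by case: (Df x).
  by rewrite normrM ler_piMl.
move=> a b; have [ab|ba|->] := ltgtP a b; last by rewrite !subrr.
  by rewrite distrC (distrC a); exact: H.
exact: H.
Qed.

Lemma expi_lipschitz a b : cmod (expi a - expi b : R[i]) <= 2 * `|a - b|.
Proof.
rewrite (le_trans (cmod_le_ReIm _))// mulr_natl mulr2n lerD//=.
  by apply: (@lipschitz1 cos (fun x => - sin x)) => x; rewrite normrN sin_max.
by apply: (@lipschitz1 sin cos) => x; exact: cos_max.
Qed.

Lemma expi_int (k : int) : expi (2 * pi * k%:~R) = 1 :> R[i].
Proof.
case: k => k; first exact: expi_nat.
rewrite NegzE mulrNz -[LHS]mulr1 -[X in _ * X](@expi_nat R k.+1) -expiD.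
by rewrite -mulrDr addNr mulr0 expi0.
Qed.

(** [k] is the integer part of [y], and [i / I] is the grid point just below its fractional part. *)
Lemma circle_net (I : nat) y : (0 < I)%N ->
  exists2 i, (i < I)%N & exists y0 : R, exists k : int,
    y = y0 + k%:~R /\ `|y0 - i%:R / I%:R| <= I%:R^-1.
Proof.
move=> I0; have I0' : 0 < I%:R :> R by rewrite ltr0n.
pose y0 := y - (Num.floor y)%:~R.
have [y00 y01] : 0 <= y0 /\ y0 < 1.
  have := Num.Theory.floor_le_tmp y; have := Num.Theory.floorD1_gt y.
  by rewrite intrD /y0; lra.
have z0 : 0 <= I%:R * y0 by rewrite mulr_ge0// ltW.
have /andP[h1 h2] := truncn_itv z0.
exists (Num.truncn (I%:R * y0)).
  by rewrite -(ltr_nat R) (le_lt_trans h1)// gtr_pMr.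
exists y0, (Num.floor y); split; first by rewrite subrK.
have -> : y0 - (Num.truncn (I%:R * y0))%:R / I%:R = (I%:R * y0 - (Num.truncn (I%:R * y0))%:R)
  / I%:R.
  by field; rewrite gt_eqF.
rewrite ger0_norm; last by rewrite divr_ge0 ?subr_ge0// ltW.
rewrite ler_pdivrMr// mulVf ?gt_eqF//.
by move: h2; rewrite -natr1; lra.
Qed.

(** By the parallelogram law the squares of [|z + r|] and [|z - r|] add up to at least [2 r^2], so
    one of the two moduli is at least [r]. *)
Lemma sign_choice (z : R[i]) (r : R) : 0 <= r ->
  exists s : bool, r <= cmod (z + (-1) ^+ s * (r%:C)%C).
Proof.
move=> r0.
have := cmod_parallelogram (r%:C)%C z; rewrite cmod_real ger0_norm// => H.
have [h|h] := leP r (cmod (z + (r%:C)%C)); first by exists false; rewrite mul1r.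
exists true; rewrite expr1 mulN1r addrC leNgt; apply/negP => h'.
rewrite [z + _]addrC in h.
have h1 : cmod ((r%:C)%C + z) ^+ 2 < r ^+ 2 by rewrite ltr_sqr ?nnegrE ?cmod_ge0.
have h2 : cmod (- (r%:C)%C + z) ^+ 2 < r ^+ 2 by rewrite ltr_sqr ?nnegrE ?cmod_ge0.
have := sqr_ge0 (cmod z); lra.
Qed.

(* The sign in front of [delta] is chosen at each node [i / I] so that the unknown sum
   of the [v]'s cannot cancel the aligned sum of size [delta * N]. *)
Lemma selection (v : nat -> R[i]) (A delta : R) (N : nat) : 0 <= A -> 0 < delta ->
  (forall K, cmod (v K) <= A) -> (0 < N)%N ->
  exists I (c : nat -> R[i]), (forall K, cmod (c K) <= 1) /\
    forall y, exists2 i, (i < I)%N &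
      delta * N%:R / 2 <= cmod (\sum_(l < N) (v (N * i + l)%N + (delta%:C)%C * c (N * i +
        l)%N) *
         expi (2 * pi * (y * 2 ^+ l))).
Proof.
move=> A0 d0 vA N0; have N0' : 0 < N%:R :> R by rewrite ltr0n.
(* Moving [y] by at most [1 / I] changes each of the [N] terms by at most
   [4 pi 2^N (A + delta) / I]; the total is at most [delta * N / 2] as soon as [I >= B]. *)
pose B : R := 8 * pi * 2 ^+ N * (A + delta) / delta.
have B0 : 0 <= B by rewrite divr_ge0 ?mulr_ge0 ?pi_ge0 ?exprn_ge0 ?addr_ge0 ?(ltW d0).
pose I := (Num.truncn B).+1.
have BI : B <= I%:R by rewrite ltW// truncnS_gt.
have I0 : 0 < I%:R :> R by rewrite ltr0n.
pose tt i : R := i%:R / I%:R.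
pose Z i := \sum_(l < N) v (N * i + l)%N * expi (2 * pi * (tt i * 2 ^+ l)).
have dN : 0 <= delta * N%:R by rewrite mulr_ge0// ltW.
have [sg Hsg] := choice (fun i => sign_choice (Z i) dN).
(* Block [i = K %/ N] cancels the phases at its node [tt i]: there the [N] corrections add up to
   [delta * N], with the sign chosen for that block. *)
pose c K : R[i] := (-1) ^+ sg (K %/ N)%N * expi (- (2 * pi * (tt (K %/ N)%N * 2 ^+ (K %% N)))).
have c1 K : cmod (c K) = 1.
  rewrite /c cmodM cmod_expi mulr1; case: (sg _); rewrite ?expr1 ?cmodN cmod1//.
have cE i (l : 'I_N) : c (N * i + l)%N = (-1) ^+ sg i * expi (- (2 * pi * (tt i * 2 ^+ l))).
  by rewrite /c mulnC divnMDl// divn_small// addn0 modnMDl modn_small.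
exists I, c; split; first by move=> K; rewrite c1.
move=> y; have [i iter_integrable [y0 [k [-> yi]]]] := @circle_net I y isT.
exists i => //.
pose q (l : 'I_N) := v (N * i + l)%N + (delta%:C)%C * c (N * i + l)%N.
have qA l : cmod (q l) <= A + delta.
  rewrite (le_trans (ler_cmodD _ _))// lerD// cmodM c1 mulr1 cmod_real ger0_norm//.
  exact: ltW.
have -> : \sum_(l < N) (v (N * i + l)%N + (delta%:C)%C * c (N * i + l)%N) *
         expi (2 * pi * ((y0 + k%:~R) * 2 ^+ l)) = \sum_(l < N) q l * expi (2 * pi * (y0 * 2
           ^+ l)).
  apply: eq_bigr => l _; congr (_ * _).
  rewrite (mulrDl y0) mulrDr expiD (_ : k%:~R * 2 ^+ l = (k * 2 ^+ l)%:~R).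
    by rewrite expi_int mulr1.
  by rewrite intrM rmorphXn.
have Q0 : \sum_(l < N) q l * expi (2 * pi * (tt i * 2 ^+ l)) = Z i + (-1) ^+ sg i * ((delta *
  N%:R)%:C)%C.
  rewrite /q; under eq_bigr do rewrite mulrDl.
  rewrite big_split /=; congr (_ + _).
  rewrite (eq_bigr (fun=> (-1) ^+ sg i * (delta%:C)%C)).
    by rewrite sumr_const card_ord rmorphM /= rmorph_nat mulrA mulr_natr.
  move=> l _; rewrite cE -!mulrA -expiD addNr expi0 mulr1 mulrC//.
have D : cmod (\sum_(l < N) q l * expi (2 * pi * (y0 * 2 ^+ l)) -
    \sum_(l < N) q l * expi (2 * pi * (tt i * 2 ^+ l))) <= delta * N%:R / 2.
  rewrite -sumrB (le_trans (ler_cmod_sum _))//.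
  rewrite (@le_trans _ _ (\sum_(l < N) (A + delta) * (2 * (2 * pi * (2 ^+ N / I%:R)))))//.
    apply: ler_sum => l _; rewrite -mulrBr cmodM ler_pM ?cmod_ge0//.
    rewrite (le_trans (expi_lipschitz _ _))// ler_wpM2l// -mulrBr -mulrBl.
    rewrite normrM (ger0_norm (_ : 0 <= 2 * pi)) ?mulr_ge0 ?pi_ge0// ler_wpM2l ?mulr_ge0
      ?pi_ge0//.
    rewrite normrM mulrC (ger0_norm (exprn_ge0 l (ler0n R 2))) ler_pM//.
    by rewrite ler_eXn2l ?ltr1n// ltnW.
  rewrite sumr_const card_ord -[_ *+ _]mulr_natr.
  rewrite (_ : _ * _ * N%:R = (B * delta) * N%:R / I%:R / 2); last first.
    by rewrite /B; field; rewrite !gt_eqF.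
  rewrite ler_pM2r ?invr_gt0// ler_pdivrMr//.
  by rewrite -mulrA [leRHS]mulrC; exact: ler_wpM2r.
have := Hsg i; rewrite -Q0.
set S1 := \sum_(l < N) _ in D *; set S2 := \sum_(l < N) _ in D *.
move=> H; have := ler_cmodD (S2 - S1) S1; rewrite subrK -(cmodN (S2 - S1)) opprB.
lra.
Qed.

End Selection.

(** * Bumps on dyadic shells and the perturbed symbol *)

Section SymbolPerturbation.
Variables (R : realType) (n : nat).
Local Notation Rd := 'rV[R]_n.+1.
Local Notation punctured := [set xi : Rd | xi != 0].
Implicit Types (xi : Rd) (t : R) (K M : nat) (s : seq 'I_n.+1).

Lemma open_punctured : open punctured.
Proof.
rewrite (_ : punctured = ~` [set 0]); last by apply/seteqP; split => x /= /eqP.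
apply: closed_openC; apply: compact_closed; first exact: norm_hausdorff.
exact: compact_set1.
Qed.

(** The K-th bump lives where [xi_0] is between [3/4] and [5/4] times [2^K] and the other
    coordinates are at most [2^K] in absolute value. The factor 4 narrows the first coordinate so
    that consecutive shells are disjoint: [5/4 < 2 * 3/4]. *)
Definition shell_slope K (i : 'I_n.+1) : R := (if i == ord0 then 4 else 1) * (2 ^+ K)^-1.
Definition shell_center (i : 'I_n.+1) : R := if i == ord0 then - 4 else 0.

Definition shell_factor K i t : R := bump (shell_slope K i * t + shell_center i).

Definition shell K xi : R := \prod_(i < n.+1) shell_factor K i (xi 0 i).

Lemma smooth_shell_factor K i : smooth (shell_factor K i).
Proof. exact/smooth_affine/smooth_bump. Qed.

Lemma rD_shell K s xi : rD s (shell K) xi =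
  \prod_(i < n.+1) (shell_slope K i ^+ count_mem i s *
     derive1n (count_mem i s) (@bump R) (shell_slope K i * xi 0 i + shell_center i)).
Proof.
have [_ ->] := rsmooth_on_prod setT (@smooth_shell_factor K).
apply: eq_bigr => i _; rewrite /shell_factor derive1nZ_affine//.
exact: smooth_bump.
Qed.

Lemma test_fun_derive1n k : test_fun (derive1n k (@bump R)).
Proof.
elim: k => [|k IH]; first exact: bump_test.
by rewrite /derive1n iterS; exact: test_fun_derive1.
Qed.

Lemma derive1n_bump_supp k t : 1 < `|t| -> derive1n k (@bump R) t = 0.
Proof.
elim: k t => [|k IH] t; first exact: bump_supp.
by rewrite /derive1n iterS; exact: derive1_supp.
Qed.

Lemma rD_shell_neq0 K s xi : rD s (shell K) xi != 0 ->
  forall i, `|shell_slope K i * xi 0 i + shell_center i| <= 1.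
Proof.
rewrite rD_shell => H i; rewrite leNgt; apply: contra H => H.
by rewrite (bigD1 i)//= derive1n_bump_supp// mulr0 mul0r.
Qed.

Lemma rD_shell_coord0 K s xi : rD s (shell K) xi != 0 ->
  3 / 4 * 2 ^+ K <= xi 0 ord0 <= 5 / 4 * 2 ^+ K.
Proof.
move=> /rD_shell_neq0/(_ ord0); rewrite /shell_slope /shell_center eqxx.
have p2 : 0 < (2 : R) ^+ K by rewrite exprn_gt0.
rewrite ler_norml => /andP[h1 h2].
have E : 4 * (2 ^+ K)^-1 * xi 0 ord0 = 4 * (xi 0 ord0 / 2 ^+ K) by ring.
rewrite E in h1 h2.
by apply/andP; split; [rewrite -ler_pdivlMr//|rewrite -ler_pdivrMr//]; lra.
Qed.

Lemma shell_disjoint K K' s xi : K != K' -> rD s (shell K) xi != 0 -> rD s (shell K') xi = 0.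
Proof.
wlog KK : K K' / (K < K')%N.
  move=> H KK'; have [h|h|h] := ltngtP K K'; first exact: H.
    move=> h1; apply/eqP/negPn/negP => h2.
    by have := H K' K h; rewrite eq_sym => /(_ KK' h2) h3; rewrite h3 eqxx in h1.
  by rewrite h eqxx in KK'.
move=> _ /rD_shell_coord0/andP[_ h1]; apply/eqP/negPn/negP => /rD_shell_coord0/andP[h2 _].
have : (2 : R) ^+ K.+1 <= 2 ^+ K' by rewrite ler_eXn2l// ltr1n.
have p2 : 0 < (2 : R) ^+ K by rewrite exprn_gt0.
by move=> h3; rewrite exprS in h3; lra.
Qed.

(** Lets the values of the perturbation at the points [2^K e_0] be prescribed independently of each
    other. *)
Lemma shell_e0 K K' : shell K ((2 ^+ K') *: ebasis R ord0) = (K == K')%:R.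
Proof.
have E xi : shell K xi = rD [::] (shell K) xi by [].
have D K1 : shell K1 ((2 ^+ K1) *: ebasis R ord0) = 1.
  rewrite /shell big1// => i _; rewrite /shell_factor !mxE /shell_slope /shell_center [i ==
    ord0]eq_sym.
  case: (ord0 == i); last by rewrite !mulr0 addr0 bump0.
  by rewrite mulr1 mulfVK ?expf_neq0// subrr bump0.
have [->|KK'] := eqVneq K K'; first by rewrite D.
rewrite E (@shell_disjoint K' K [::])//; first by rewrite eq_sym.
by rewrite /= D oner_neq0.
Qed.

Lemma shell_0 K : shell K 0 = 0.
Proof.
rewrite /shell big_ord_recl /shell_factor /shell_center eqxx mxE mulr0 add0r.
by rewrite bump_supp ?mul0r// normrN ger0_norm// ltr1n.
Qed.

Lemma derive1n_bump_bound j : exists B : R, 1 <= B /\ forall k t,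
  (k <= j)%N -> `|derive1n k (@bump R) t| <= B.
Proof.
have H k : exists C : R, forall t, `|derive1n k (@bump R) t| <= C.
  have [_ [C HC]] := test_fun_decay (test_fun_derive1n k).
  exists C => t; rewrite (le_trans (HC t))// ler_piMr ?oneDsqrV_le1//.
  have := le_trans (normr_ge0 _) (HC 0); rewrite pmulr_lge0//; exact: oneDsqrV_gt0.
elim: j => [|j [B [B1 HB]]].
  have [C HC] := H 0%N; exists (Num.max 1 C); rewrite le_max lexx; split => // k t.
  by rewrite leqn0 => /eqP ->; rewrite le_max HC orbT.
have [C HC] := H j.+1; exists (Num.max B C); rewrite le_max B1; split => // k t.
rewrite leq_eqVlt => /orP[/eqP ->|kj]; first by rewrite le_max HC orbT.
by rewrite le_max HB.
Qed.

(** Scale invariance: on the support [enorm xi] is at most [2^K * 2 * n.+2], each derivative brings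
    a factor at most [4 / 2^K], and the powers of [2^K] cancel. The product of the two is
    [D0 = 8 * n.+2]. *)
Lemma shell_bound j : exists2 D : R, 0 < D & forall K (al : 'I_n.+1 -> nat) xi,
  (mlen al <= j)%N ->
  enorm xi ^+ mlen al * `|rD (mword al) (shell K) xi| <= D.
Proof.
have [B [B1 HB]] := derive1n_bump_bound j.
have B0 : 0 <= B by rewrite (le_trans _ B1).
pose D0 : R := 8 * n.+2%:R.
have D01 : 1 <= D0 by rewrite /D0 mulr_ege1// ler1n.
exists (D0 ^+ j * B ^+ n.+1).
  by rewrite mulr_gt0// exprn_gt0// (lt_le_trans ltr01).
move=> K al xi aj.
have [->|nz] := eqVneq (rD (mword al) (shell K) xi) 0.
  by rewrite normr0 mulr0 mulr_ge0 ?exprn_ge0// (le_trans _ D01).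
have p2 : 0 < (2 : R) ^+ K by rewrite exprn_gt0.
have x2 i : `|xi 0 i| <= 2 ^+ K * 2.
  have := rD_shell_neq0 nz i; rewrite /shell_slope /shell_center.
  case: (i == ord0).
    rewrite ler_norml => /andP[h1 h2].
    have E : 4 * (2 ^+ K)^-1 * xi 0 i = 4 * (xi 0 i / 2 ^+ K) by ring.
    rewrite E in h1 h2.
    rewrite -ler_pdivrMl// -(ger0_norm (ltW p2)) -normfV -normrM mulrC.
    by rewrite ler_norml; apply/andP; split; lra.
  rewrite mul1r addr0 normrM normfV (ger0_norm (ltW p2)) ler_pdivrMl// => h.
  by rewrite (le_trans h)// mulr1 ler_peMr ?ler1n// ltW.
have eK : enorm xi <= 2 ^+ K * 2 * n.+2%:R.
  by apply: enorm_le => //; rewrite mulr_ge0// ltW.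
have slope0 i : 0 <= shell_slope K i.
  by rewrite /shell_slope mulr_ge0 ?invr_ge0 ?(ltW p2)//; case: ifP.
have slope4 i : shell_slope K i <= 4 / 2 ^+ K.
  rewrite /shell_slope; case: (i == ord0) => //.
  by rewrite ler_wpM2r ?invr_ge0 ?(ltW p2)// ler1n.
have rDle : `|rD (mword al) (shell K) xi| <= (4 / 2 ^+ K) ^+ mlen al * B ^+ n.+1.
  rewrite rD_shell normr_prod /mlen expr_sum -[X in B ^+ X](card_ord n.+1) -prodr_const
    -big_split /=.
  apply: ler_prod => i _; rewrite normr_ge0 /= count_mword normrM; apply: ler_pM => //.
    rewrite normrX ger0_norm//; apply: lerXn2r; rewrite ?nnegrE ?slope0 ?slope4//.
  by apply: HB; rewrite (leq_trans _ aj)// /mlen (bigD1 i)//= leq_addr.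
apply: le_trans (ler_wpM2l _ rDle) _; first by rewrite exprn_ge0 ?enorm_ge0.
rewrite mulrA ler_wpM2r ?exprn_ge0// -exprMn.
rewrite (@le_trans _ _ (D0 ^+ mlen al))//; last by rewrite ler_weXn2l.
apply: lerXn2r; rewrite ?nnegrE ?mulr_ge0 ?enorm_ge0 ?divr_ge0 ?(ltW p2)//.
rewrite (le_trans (ler_wpM2r _ eK)) ?divr_ge0 ?(ltW p2)//.
rewrite le_eqVlt; apply/orP; left; apply/eqP; rewrite /D0; field.
by rewrite gt_eqF.
Qed.

Definition shells M (c : nat -> R[i]) xi : R[i] := \sum_(K < M) c K * ((shell K xi)%:C)%C.

Lemma Re_shells M c : (fun xi => complex.Re (shells M c xi)) =
  (fun xi => \sum_(K < M) complex.Re (c K) * shell K xi).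
Proof.
apply/funext => xi; rewrite Re_sum; apply: eq_bigr => K _.
by rewrite Re_mul /= mulr0 subr0.
Qed.

Lemma Im_shells M c : (fun xi => complex.Im (shells M c xi)) =
  (fun xi => \sum_(K < M) complex.Im (c K) * shell K xi).
Proof.
apply/funext => xi; rewrite Im_sum; apply: eq_bigr => K _.
by rewrite Im_mul /= mulr0 add0r.
Qed.

Lemma csmooth_shells M c : csmooth_on punctured (shells M c) /\
  forall s xi, punctured xi -> cD s (shells M c) xi = \sum_(K < M) c K * ((rD s (shell K)
    xi)%:C)%C.
Proof.
have sS (K : 'I_M) : rsmooth_on punctured (shell K) := (rsmooth_on_prod punctured
  (@smooth_shell_factor K)).1.
have [a1 b1] := rsmooth_on_sum (fun K : 'I_M => complex.Re (c K)) open_punctured sS.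
have [a2 b2] := rsmooth_on_sum (fun K : 'I_M => complex.Im (c K)) open_punctured sS.
split; first by split; rewrite ?Re_shells ?Im_shells.
move=> s xi xi0; apply: complexP; rewrite /cD /=.
  rewrite Re_shells b1// Re_sum; apply: eq_bigr => K _.
  by rewrite Re_mul /= mulr0 subr0.
rewrite Im_shells b2// Im_sum; apply: eq_bigr => K _.
by rewrite Im_mul /= mulr0 add0r.
Qed.

(** For a given word of derivatives at most one summand is nonzero at each point, so the bound for a
    single shell passes to the sum, uniformly in [M] and [c]. *)
Lemma shells_bound j : exists2 D : R, 0 < D & forall M c, (forall K, cmod (c K) <= 1) ->
  forall al xi, xi != 0 -> (mlen al <= j)%N ->
  enorm xi ^+ mlen al * cmod (dpow al (shells M c) xi) <= D.
Proof.
have [D D0 HD] := shell_bound j; exists D => // M c c1 al xi xi0 aj.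
rewrite /dpow (csmooth_shells M c).2//.
have [[K nz]|H] := pselect (exists K : 'I_M, rD (mword al) (shell K) xi != 0); last first.
  rewrite big1; first by rewrite cmod0 mulr0 ltW.
  move=> K _; have [->|nz] := eqVneq (rD (mword al) (shell K) xi) 0; first by rewrite mulr0.
  by exfalso; apply: H; exists K.
rewrite (bigD1 K)//= big1 ?addr0; last first.
  by move=> K' KK'; rewrite (@shell_disjoint K K')// ?mulr0// eq_sym.
rewrite cmodM cmod_real mulrCA (le_trans _ (HD K al xi aj))//.
by rewrite ler_piMl// mulr_ge0// exprn_ge0// enorm_ge0.
Qed.

Lemma csmooth_DZ (f g : Rd -> R[i]) (r : R) : csmooth_on punctured f ->
  csmooth_on punctured g ->
  csmooth_on punctured (fun xi => f xi + (r%:C)%C * g xi) /\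
  forall s xi, xi != 0 -> cD s (fun xi => f xi + (r%:C)%C * g xi) xi = cD s f xi + (r%:C)%C *
    cD s g xi.
Proof.
move=> [f1 f2] [g1 g2].
have E1 : (fun xi => complex.Re (f xi + (r%:C)%C * g xi)) =
    (fun xi => complex.Re (f xi) + r * complex.Re (g xi)).
  by apply/funext => xi; rewrite Re_add Re_mul /= mul0r subr0.
have E2 : (fun xi => complex.Im (f xi + (r%:C)%C * g xi)) =
    (fun xi => complex.Im (f xi) + r * complex.Im (g xi)).
  by apply/funext => xi; rewrite Im_add Im_mul /= mul0r addr0.
split; first by split; rewrite ?E1 ?E2; apply: rsmooth_on_DZ => //; exact: open_punctured.
move=> s xi xi0; apply: complexP; rewrite ?Re_add ?Im_add ?Re_mul ?Im_mul /= ?E1 ?E2.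
  by rewrite mul0r subr0 (rD_DZ r open_punctured).
by rewrite mul0r addr0 (rD_DZ r open_punctured).
Qed.

Lemma dpowB (f g : Rd -> R[i]) al xi : csmooth_on punctured f -> csmooth_on punctured g ->
  xi != 0 ->
  dpow al (fun xi => f xi - g xi) xi = dpow al f xi - dpow al g xi.
Proof.
move=> sf sg xi0; have [_ H] := csmooth_DZ (-1) sf sg.
have N (z : R[i]) : ((-1)%:C)%C * z = - z by rewrite rmorphN1 mulN1r.
have := H (mword al) xi xi0; rewrite N -/(dpow al f xi) -/(dpow al g xi) => <-.
by congr (cD _ _ xi); apply/funext => y; rewrite N.
Qed.

Definition perturb (m : Rd -> R[i]) (delta : R) M c : Rd -> R[i] :=
  fun xi => m xi + (delta%:C)%C * shells M c xi.

Lemma dpow_perturb m delta M c al xi : Sym m -> xi != 0 ->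
  dpow al (perturb m delta M c) xi = dpow al m xi + (delta%:C)%C * dpow al (shells M c) xi.
Proof. by move=> [_ [sm _]] xi0; exact: (csmooth_DZ delta sm (csmooth_shells M c).1).2. Qed.

Lemma perturb_e0 m delta M c K : (K < M)%N ->
  perturb m delta M c ((2 ^+ K) *: ebasis R ord0) = m ((2 ^+ K) *: ebasis R ord0) +
    (delta%:C)%C * c K.
Proof.
move=> KM; rewrite /perturb /shells (bigD1 (Ordinal KM))//= shell_e0 eqxx mulr1 big1 ?addr0//.
by move=> K' KK'; rewrite shell_e0 (negbTE (_ : (K' : nat) != K)) ?mulr0.
Qed.

Lemma Sym_perturb m delta M c : 0 <= delta -> (forall K,
  cmod (c K) <= 1) -> Sym m -> Sym (perturb m delta M c).
Proof.
move=> d0 c1 Sm; have [m0 [sm bm]] := Sm; split.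
  by rewrite /perturb m0 add0r /shells big1 ?mulr0// => K _; rewrite shell_0 mulr0.
split; first exact: (csmooth_DZ delta sm (csmooth_shells M c).1).1.
move=> al; have [C HC] := bm al; have [D D0 HD] := shells_bound (mlen al).
exists (C + delta * D) => xi xi0; rewrite dpow_perturb//.
rewrite (le_trans (ler_cmodD _ _))// mulrDl lerD ?HC// cmodM cmod_real ger0_norm// -mulrA
  ler_wpM2l//.
by rewrite ler_pdivlMr ?exprn_gt0 ?enorm_gt0// mulrC HD.
Qed.

Lemma snorm_ub j (h : Rd -> R[i]) al xi : xi != 0 -> (mlen al <= j)%N ->
  ((enorm xi ^+ mlen al * cmod (dpow al h xi))%:E <= snorm j h)%E.
Proof. by move=> xi0 aj; apply: ereal_sup_ubound; exists xi, al. Qed.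

Lemma sball_bound m m' j (e : R) : sball m j e m' -> csmooth_on punctured m -> forall al xi,
  xi != 0 -> (mlen al <= j)%N ->
  enorm xi ^+ mlen al * cmod (dpow al m' xi - dpow al m xi) <= e.
Proof.
move=> [[_ [sm' _]] h] sm al xi xi0 aj; rewrite -lee_fin -dpowB//.
exact: le_trans (snorm_ub _ xi0 aj) (ltW h).
Qed.

Lemma mlen0 : mlen (fun _ : 'I_n.+1 => 0%N) = 0%N.
Proof. by rewrite /mlen big1. Qed.

Lemma dpow0 (h : Rd -> R[i]) xi : dpow (fun=> 0%N) h xi = h xi.
Proof.
rewrite /dpow (_ : mword _ = [::]); first by rewrite /cD /=; case: (h xi).
by rewrite /mword; elim: (enum _) => [//|i r IH] /=.
Qed.

Lemma sball_sup m m' j (e : R) : sball m j e m' -> csmooth_on punctured m -> forall xi,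
  xi != 0 ->
  cmod (m' xi - m xi) <= e.
Proof.
move=> h sm xi xi0; have := sball_bound h sm xi0 (_ : (mlen (fun _ : 'I_n.+1 => 0%N) <= j)%N).
by rewrite mlen0 !dpow0 expr0 mul1r; exact.
Qed.

Lemma Sym_bounded (m : Rd -> R[i]) : Sym m -> exists2 A : R, 0 <= A & forall xi,
  cmod (m xi) <= A.
Proof.
move=> [m0 [_ bm]]; have [C HC] := bm (fun=> 0%N).
exists `|C| => // xi; have [->|xi0] := eqVneq xi 0; first by rewrite m0 cmod0.
have := HC xi xi0; rewrite dpow0 mlen0 expr0 invr1 mulr1 => h.
by rewrite (le_trans h)// ler_norm.
Qed.

Lemma sball_perturb m j (e delta D : R) M c : Sym m -> 0 < e -> 0 <= delta ->
  (forall al xi, xi != 0 -> (mlen al <= j)%N ->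
     enorm xi ^+ mlen al * cmod (dpow al (shells M c) xi) <= D) ->
  delta * D <= e / 4 -> Sym (perturb m delta M c) ->
  forall e', e' <= e / 2 -> sball (perturb m delta M c) j e' `<=` sball m j e.
Proof.
move=> Sm e0 d0 HD dD Sp e' e'2 m'' hb; have [Sm'' _] := hb.
(* The small ball contributes [e / 2] and the perturbation [e / 4]. The sum [3 / 4 * e] leaves room
   for the strict inequality, which a supremum need not preserve. *)
split => //; apply: (@le_lt_trans _ _ (3 / 4 * e)%:E); last by rewrite lte_fin; lra.
apply: ge_ereal_sup => _ [xi [al [xi0 aj ->]]]; rewrite lee_fin.
rewrite dpowB//; [|exact: Sm''.2.1|exact: Sm.2.1].
have h1 := sball_bound hb Sp.2.1 xi0 aj.
rewrite (_ : dpow al m'' xi - _ = (dpow al m'' xi - dpow al (perturb m delta M c) xi) +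
   (delta%:C)%C * dpow al (shells M c) xi); last by rewrite dpow_perturb//; ring.
have E0 : 0 <= enorm xi ^+ mlen al by rewrite exprn_ge0// enorm_ge0.
rewrite (le_trans (ler_wpM2l E0 (ler_cmodD _ _)))// mulrDr cmodM cmod_real ger0_norm//.
rewrite [X in _ + X]mulrCA; have := ler_wpM2l d0 (HD al xi xi0 aj); lra.
Qed.

End SymbolPerturbation.

(** * First category *)

Section FirstCategory.
Variables (R : realType) (n : nat).
Local Notation Rd := 'rV[R]_n.+1.
Implicit Types (m : Rd -> R[i]) (x xi : Rd).

Definition bounded_level (k : nat) : set (Rd -> R[i]) :=
  [set m | exists p : R, [/\ 1 < p, p <= k.+1%:R &
    (ereal_sup [set Lpnorm p (Mmax m f) | f in [set f | S0 f /\
       (Lpnorm p (fun x => (cmod (f x))%:E) <= 1)%E]] <= k.+1%:R%:E)%E]].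

Lemma SymM_bounded_level m : SymM m -> exists k, bounded_level k m.
Proof.
move=> [_ [p [p1 h]]].
set s := ereal_sup _ in h.
have [r hr] : exists r : R, (s <= r%:E)%E.
  by move: h; case: s => [r| |] // _; [exists r|exists 0; rewrite leNye].
exists (maxn (Num.truncn p) (Num.truncn r)), p; split => //.
  by rewrite ltW// (lt_le_trans (truncnS_gt p))// ler_nat ltnS leq_maxl.
rewrite (le_trans hr)// lee_fin ltW// (lt_le_trans (truncnS_gt r))//.
by rewrite ler_nat ltnS leq_maxr.
Qed.

Lemma Sym_continuous m : Sym m -> forall xi, xi != 0 ->
  {for xi, continuous (fun xi => complex.Re (m xi))} /\
  {for xi, continuous (fun xi => complex.Im (m xi))}.
Proof.
move=> [_ [[s1 s2] _]] xi xi0.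
by split; [exact: (rsmooth_on_continuous s1 xi0)|exact: (rsmooth_on_continuous s2 xi0)].
Qed.

Lemma Sym_near m xi0 (eta : R) : Sym m -> xi0 != 0 -> 0 < eta ->
  exists2 rho : R, 0 < rho & forall xi, (forall i, `|xi 0 i - xi0 0 i| <= rho) ->
    cmod (m xi - m xi0) <= eta.
Proof.
move=> Sm x0 eta0; have [c1 c2] := Sym_continuous Sm x0.
have e2 : 0 < eta / 2 by rewrite divr_gt0.
have N1 : nbhs xi0 (fun xi => `|complex.Re (m xi0) - complex.Re (m xi)| < eta / 2).
  by move/cvgrPdist_lt : c1 => /(_ _ e2).
have N2 : nbhs xi0 (fun xi => `|complex.Im (m xi0) - complex.Im (m xi)| < eta / 2).
  by move/cvgrPdist_lt : c2 => /(_ _ e2).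
have [r r0 hr] : exists2 r : R, 0 < r & forall xi, ball xi0 r xi ->
    `|complex.Re (m xi0) - complex.Re (m xi)| < eta / 2 /\
    `|complex.Im (m xi0) - complex.Im (m xi)| < eta / 2.
  have N := @filterI _ (nbhs xi0) (nbhs_filter xi0) _ _ N1 N2.
  by move/nbhs_ballP : N => [r r0 hr]; exists r.
exists (r / 2) => [|xi hxi]; first by rewrite divr_gt0.
have : ball xi0 r xi.
  split => // i j; rewrite (ord1 i) /ball/= distrC (le_lt_trans (hxi j))//.
  by rewrite ltr_pdivrMr// ltr_pMr// ltr1n.
move=> /hr[h1 h2]; rewrite -cmodN opprB (le_trans (cmod_le_ReIm _))// [leRHS]splitr.
move: h1 h2; case: (m xi0) => a b; case: (m xi) => a' b' /= h1 h2.
by rewrite lerD// ltW.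
Qed.

Lemma Sym_near_seq m (pt : nat -> Rd) M (eta : R) : Sym m -> (forall K, pt K != 0) -> 0 < eta ->
  exists2 rho : R, 0 < rho & forall K xi, (K < M)%N -> (forall i,
    `|xi 0 i - pt K 0 i| <= rho) ->
    cmod (m xi - m (pt K)) <= eta.
Proof.
move=> Sm p0 eta0; elim: M => [|M [r r0 hr]]; first by exists 1.
have [r' r'0 hr'] := Sym_near Sm (p0 M) eta0.
exists (Num.min r r'); first by rewrite lt_min r0.
move=> K xi; rewrite ltnS leq_eqVlt => /orP[/eqP -> h|KM h].
  by apply: hr' => i; rewrite (le_trans (h i))// ge_min lexx orbT.
by apply: hr => // i; rewrite (le_trans (h i))// ge_min lexx.
Qed.

Lemma exists_N (b K th : R) : 1 <= b -> 0 < th -> 0 <= K -> forall k : nat,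
  exists2 M : nat, (0 < M)%N & K * b ^+ k / M%:R < th.
Proof.
move=> b1 th0 K0 k; exists (Num.truncn (K * b ^+ k / th)).+1 => //.
rewrite ltr_pdivrMr ?ltr0n// [th * _]mulrC -ltr_pdivrMr//; exact: truncnS_gt.
Qed.

(* As [1 <= p <= k], the smallness of [theta] can be chosen independently of [p]. *)
Lemma powR_contradiction (q theta vol K p b : R) (k : nat) : 0 < q -> 0 < theta -> 1 <= p ->
  p <= k%:R -> 0 <= K -> 1 <= b -> K / q <= b -> theta * b ^+ k < vol ->
  (q / theta `^ p^-1) `^ p * vol <= K `^ p -> False.
Proof.
move=> q0 th0 p1 pk K0 b1 Kb small.
have p0 : 0 < p by rewrite (lt_le_trans ltr01).
set z := theta `^ p^-1; have z0 : 0 < z by exact: powR_gt0.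
have zp : z `^ p = theta by rewrite /z -powRrM mulVf ?gt_eqF// powRr1// ltW.
have qp0 : 0 < q `^ p by exact: powR_gt0.
have E1 : (q / z) `^ p * theta = q `^ p.
  by rewrite -zp -powRM ?divr_ge0 ?(ltW q0) ?(ltW z0)// divfK ?gt_eqF.
have E2 : (K / q) `^ p * q `^ p = K `^ p.
  by rewrite -powRM ?divr_ge0 ?(ltW q0)// divfK ?gt_eqF.
move=> h; have h1 : vol <= theta * (K / q) `^ p.
  have X0 : 0 < (q / z) `^ p by rewrite powR_gt0// divr_gt0.
  by rewrite -E2 -E1 in h; rewrite -(ler_pM2l X0); lra.
have h2 : (K / q) `^ p <= b ^+ k.
  rewrite -powR_mulrn ?(le_trans ler01)// (le_trans (ge0_ler_powR (ltW p0) _ _ Kb))//.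
  - by rewrite nnegrE divr_ge0// ltW.
  - by rewrite nnegrE (le_trans ler01).
  - exact: ler_powR.
have := le_trans h1 (ler_wpM2l (ltW th0) h2); lra.
Qed.

End FirstCategory.

(** * The bounded levels are nowhere dense *)

Section NowhereDense.
Variables (R : realType) (n : nat).
Local Notation Rd := 'rV[R]_n.+1.
Implicit Types (m : Rd -> R[i]) (x xi : Rd).

(** With [lam = M^-1] and [N = M^2] the factor [lam + 3 / (lam * N)] of [Lp_lac_test] equals
    [4 / M]. The amplitude is the inverse of the resulting bound on the norm, [C ^+ n.+1 * N] times
    [theta] to the power [1 / p]. *)
Lemma lac_test_norm_le1 (N M : nat) (L p C theta : R) : 1 <= p -> 1 <= L -> 1 <= C ->
  (forall t, `|window t| <= C * (oneDsqr t)^-1) -> (0 < M)%N -> N = (M ^ 2)%N ->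
  theta = 4 / M%:R * pi ^+ n.+1 ->
  (Lpnorm p (fun x : Rd => (cmod (lac_test (N := N) (C ^+ n.+1 * N%:R * theta `^ p^-1)^-1
    (lac_freq L) x))%:E) <= 1)%E.
Proof.
move=> p1 L1 C1 hC M0 NE thE.
have p0 : 0 < p by rewrite (lt_le_trans ltr01).
have M0' : 0 < M%:R :> R by rewrite ltr0n.
have N0 : (0 < N)%N by rewrite NE expn_gt0 M0.
have N0' : 0 < N%:R :> R by rewrite ltr0n.
have th0 : 0 < theta by rewrite thE mulr_gt0 ?divr_gt0 ?exprn_gt0 ?pi_gt0.
have C0 : 0 < C by rewrite (lt_le_trans ltr01).
set a := _^-1.
have D0 : 0 < C ^+ n.+1 * N%:R * theta `^ p^-1 by rewrite !mulr_gt0 ?exprn_gt0 ?powR_gt0.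
have a0 : 0 <= a by rewrite invr_ge0 ltW.
apply: (Lpnorm_le1 p0).
have M1 : 0 < (M%:R : R)^-1 by rewrite invr_gt0.
apply: (le_trans (Lp_lac_test n L1 a0 C1 hC p1 M1 N0)); rewrite lee_fin.
have -> : a * C ^+ n.+1 * N%:R = (theta `^ p^-1)^-1.
  rewrite /a; have := powR_gt0 p^-1 th0; have := exprn_gt0 n.+1 C0.
  set z := theta `^ _; set w := C ^+ _ => w0 z0; field.
  by rewrite !gt_eqF.
have -> : M%:R^-1 + 3 / (M%:R^-1 * N%:R) = 4 / M%:R :> R.
  by rewrite NE natrX; field; rewrite gt_eqF.
rewrite -thE; set z := theta `^ p^-1; have z0 : 0 < z by exact: powR_gt0.
have zp : z `^ p = theta by rewrite /z -powRrM mulVf ?gt_eqF// powRr1// ltW.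
by rewrite -[X in _ * X]zp -powRM ?invr_ge0 ?(ltW z0)// mulVf ?powR1// gt_eqF.
Qed.

Lemma nowhere_dense_bounded_level k : nowhere_dense_S (@bounded_level R n k).
Proof.
move=> m j e Sm e0.
have [x0 [r [kap [r0 [kap0 Hkap]]]]] := @window_tilde_lower R.
have [C [C1 hC]] := @window_bound R.
have [A A0 hA] := Sym_bounded Sm.
have [D D0 HD] := shells_bound R n j.
(* With this size the perturbation costs at most [e / 4] in the j-th norm. *)
pose delta := e / (4 * D).
have d0 : 0 < delta by rewrite divr_gt0// mulr_gt0.
(* What is left of the gain per summand: [delta * kap ^+ n.+1 / 2] from the aligned sum, minus half
   of that for the error of freezing the symbol. *)
pose kap1 := delta * kap ^+ n.+1 / 4.
have kap10 : 0 < kap1 by rewrite divr_gt0// mulr_gt0// exprn_gt0.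
have C0 : 0 < C ^+ n.+1 by rewrite exprn_gt0// (lt_le_trans ltr01).
pose q := kap1 / C ^+ n.+1.
have q0 : 0 < q by rewrite divr_gt0.
(* Membership in the level will force the volume of the cube to be at most [theta * (k.+1 / q)^p],
   and [p <= k.+1] bounds the power by [b ^+ k.+1]. The integer [M] below makes
   [theta = 4 pi^(n+1) / M] too small for that. *)
pose b := Num.max 1 (k.+1%:R / q).
have b1 : 1 <= b by rewrite le_max lexx.
have vol0 : 0 < (2 * r) ^+ n.+1 by rewrite exprn_gt0// mulr_gt0.
have K0 : 0 <= 4 * pi ^+ n.+1 :> R by rewrite mulr_ge0// exprn_ge0// pi_ge0.
have [M M0 HM] := exists_N b1 vol0 K0 k.+1.
pose N := (M ^ 2)%N.
have N0 : (0 < N)%N by rewrite expn_gt0 M0.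
have N0' : 0 < N%:R :> R by rewrite ltr0n.
pose pt K : Rd := (2 ^+ K) *: ebasis R ord0.
have pt0 K : pt K != 0.
  apply/eqP => /rowP/(_ ord0); rewrite !mxE eqxx mulr1 => /eqP.
  by rewrite expf_eq0 /= pnatr_eq0 andbF.
have [I [c [c1 Hsel]]] := selection A0 d0 (fun K => hA (pt K)) N0.
pose m' := perturb m delta (N * I) c.
have Sm' : Sym m' by apply: Sym_perturb => //; exact: ltW.
pose J : R := hat_mass R ^+ n.+1.
have J0 : 0 <= J by rewrite exprn_ge0// hat_mass_ge0.
(* Keeps the error of [multiplier_approx], which is [2 * eta * J] per summand up to the amplitude,
   below half of the aligned contribution; [J + 1] keeps the denominator positive. *)
pose eta := delta * kap ^+ n.+1 / (8 * (J + 1)).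
have J10 : 0 < 8 * (J + 1) by rewrite mulr_gt0// ltr_wpDl.
have eta0 : 0 < eta by rewrite divr_gt0// mulr_gt0// exprn_gt0.
have etaJ : 2 * eta * J <= delta * kap ^+ n.+1 / 4.
  rewrite /eta; set w := delta * _.
  have w0 : 0 <= w by rewrite mulr_ge0 ?exprn_ge0// ltW.
  rewrite (_ : 2 * _ * J = w / 4 * (J / (J + 1))); last by field; rewrite gt_eqF// ltr_wpDl.
  rewrite ler_piMr ?divr_ge0//.
  by rewrite ler_pdivrMr ?ltr_wpDl// mul1r lerDl.
have eta20 : 0 < eta / 2 by rewrite divr_gt0.
have [rho rho0 Hrho] := Sym_near_seq (N * I) Sm' pt0 eta20.
(* The first bound keeps the new ball inside the given one; the second lets its elements differ from
   [m'] by at most [eta / 2] at every nonzero frequency. *)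
pose e' := Num.min (e / 2) (eta / 2).
have e'0 : 0 < e' by rewrite lt_min divr_gt0.
exists m', j, e'; split => //.
  apply: (@sball_perturb _ _ m j e delta D) => //; first exact: ltW.
  - by move=> al xi xi0 aj; exact: HD.
  - by rewrite /delta le_eqVlt; apply/orP; left; apply/eqP; field; rewrite gt_eqF.
  - by rewrite /e' ge_min lexx.
rewrite -subset0 => m'' [hb [p [p1 pk hp]]].
have [Sm'' _] := hb.
have near'' xi : xi != 0 -> cmod (m'' xi - m' xi) <= eta / 2.
  move=> xi0; rewrite (le_trans (sball_sup hb Sm'.2.1 xi0))//.
  by rewrite /e' ge_min lexx orbT.
(* [L = 2^s] is at least [2^(N I) / rho], so each dilation used below shrinks the unit boxes around
   the frequencies to size [rho]. Being a power of two, it makes the ratios [2^(N i) / L] dyadic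
   dilations. *)
pose s := (Num.truncn (2 ^+ (N * I) / rho)).+1.
pose L : R := 2 ^+ s.
have L2 : 2 <= L by rewrite /L exprS ler_peMr// exprn_ege1// ler1n.
have L0 : 0 < L by rewrite (lt_le_trans _ L2).
have Lrho : 2 ^+ (N * I) / L <= rho.
  rewrite ler_pdivrMr// mulrC -ler_pdivrMr// (le_trans (ltW (truncnS_gt _)))//.
  by rewrite /L -/s -natrX ler_nat ltnW// ltn_expl.
have w2 (l : 'I_N) : 2 <= lac_freq L l by exact: lac_freq_ge.
pose theta : R := 4 / M%:R * pi ^+ n.+1.
pose a : R := (C ^+ n.+1 * N%:R * theta `^ p^-1)^-1.
have th0 : 0 < theta by rewrite mulr_gt0 ?divr_gt0 ?exprn_gt0 ?pi_gt0 ?ltr0n.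
have a0 : 0 < a by rewrite invr_gt0 !mulr_gt0 ?powR_gt0.
have p0 : 0 < p by rewrite (lt_trans ltr01).
pose f := lac_test (n := n) (N := N) a (lac_freq L).
have Sf : S0 f by apply: lac_test_S0.
have f1 : (Lpnorm p (fun x => (cmod (f x))%:E) <= 1)%E.
  apply: (lac_test_norm_le1 (M := M) _ _ C1) => //; first exact: ltW.
  by rewrite (le_trans _ L2)// ler1n.
have Lp : (Lpnorm p (Mmax m'' f) <= k.+1%:R%:E)%E.
  by apply: le_trans hp; apply: ereal_sup_ubound; exists f.
have low x : (forall i, `|x 0 i - x0| <= r) -> ((a * N%:R * kap1)%:E <= Mmax m'' f x)%E.
  move=> hx.
  have [i iter_integrable Hi] := Hsel (x 0 0 * L).
  (* This dilation sends the frequency [L 2^l e_0] to [pt (N * i + l)], the point at which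
     [selection] prescribes the value of [m']. *)
  pose ki : int := (N * i)%:Z - s%:Z.
  pose cc : R := 2 ^ ki.
  have ccE : cc = 2 ^+ (N * i) / L.
    by rewrite /cc /ki expfzDr ?pnatr_eq0// -exprnN.
  have cc0 : 0 < cc by rewrite ccE divr_gt0// exprn_gt0.
  have ccrho : cc <= rho.
    rewrite (le_trans _ Lrho)// ccE ler_wpM2r ?invr_ge0 ?(ltW L0)//.
    by rewrite ler_weXn2l ?ler1n// leq_mul2l ltnW// orbT.
  apply: (@le_trans _ _ (cmod (IFT (fun xi => m'' (cc *: xi) * FT f xi) x))%:E); last first.
    by apply: ereal_sup_ubound; exists ki.
  rewrite lee_fin.
  pose bb (l : 'I_N) : R[i] := m' (pt (N * i + l)%N).
  have bE (l : 'I_N) : bb l = m (pt (N * i + l)%N) + (delta%:C)%C * c (N * i + l)%N.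
    rewrite /bb /m' /pt perturb_e0// (@leq_trans (N * i + N)%N) ?ltn_add2l//.
    by rewrite addnC -mulnS leq_mul2l iter_integrable orbT.
  have KI (l : 'I_N) : (N * i + l < N * I)%N.
    rewrite (@leq_trans (N * i + N)%N) ?ltn_add2l//.
    by rewrite addnC -mulnS leq_mul2l iter_integrable orbT.
  (* Half of [eta] pays for passing from [m''] to [m'], the other half for the variation of [m'] on
     the [rho]-box around [pt (N * i + l)]. *)
  have near_freq (l : 'I_N) xi : (forall i', `|xi 0 i' - freq (lac_freq L) l i'| <= 1) ->
      cmod (m'' (cc *: xi) - bb l) <= eta.
    move=> hxi.
    have xi1 : 0 < xi 0 ord0.
      have := hxi ord0; rewrite /freq eqxx ler_norml => /andP[+ _]; have := w2 l; lra.
    have cxi0 : cc *: xi != 0.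
      apply/eqP => /rowP/(_ ord0); rewrite !mxE => /eqP; rewrite mulf_eq0 !gt_eqF//.
    rewrite (_ : _ - bb l = (m'' (cc *: xi) - m' (cc *: xi)) + (m' (cc *: xi) - bb l));
      last by ring.
    rewrite (le_trans (ler_cmodD _ _))// [leRHS]splitr lerD ?near''//.
    apply: Hrho => // i'.
    rewrite !mxE (_ : 2 ^+ (N * i + l) * (ord0 == i')%:R = cc * freq (lac_freq L) l i');
      last first.
      rewrite /freq eq_sym; case: (i' == ord0); rewrite ?mulr0// mulr1 /lac_freq ccE exprD.
      by rewrite mulrA divfK ?gt_eqF.
    by rewrite -mulrBr normrM (gtr0_norm cc0) (le_trans _ ccrho)// ler_piMr// ltW.
  have Sre xi : xi != 0 -> {for xi, continuous (fun xi => complex.Re (m'' xi))}.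
    by case/(Sym_continuous Sm'').
  have Sim xi : xi != 0 -> {for xi, continuous (fun xi => complex.Im (m'' xi))}.
    by case/(Sym_continuous Sm'').
  have := @multiplier_approx R n N a (lac_freq L) (ltW a0) w2 m'' Sre Sim
    cc eta bb x (lt0r_neq0 cc0) (ltW eta0) near_freq.
  rewrite -/f; set T := IFT _ x; set main := _ * _ * _ => appr.
  have main_ge : a * (delta * N%:R / 2) * kap ^+ n.+1 <= cmod main.
    rewrite /main !cmodM cmod_real (gtr0_norm a0); apply: ler_pM.
    - apply: mulr_ge0; first exact: ltW.
      by apply: divr_ge0 => //; apply: mulr_ge0; exact: ltW.
    - by rewrite exprn_ge0// ltW.
    - rewrite ler_wpM2l ?(ltW a0)// (le_trans Hi)// le_eqVlt; apply/orP; left; apply/eqP.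
      by congr cmod; apply: eq_bigr => l _; rewrite bE /lac_freq !mulrA.
    - rewrite cmod_prod -[X in kap ^+ X](card_ord n.+1) -prodr_const; apply: ler_prod => i' _.
      by rewrite (ltW kap0) cmod_real Hkap.
  have : cmod main <= cmod T + cmod (T - main).
    rewrite -{1}(subKr T main) (le_trans (ler_cmodD _ _))//.
    by rewrite cmodN.
  have : 2 * (a * eta * N%:R * hat_mass R ^+ n.+1) <= a * N%:R * (delta * kap ^+ n.+1 / 4).
    rewrite (_ : 2 * _ = a * N%:R * (2 * eta * J)); last by rewrite /J; ring.
    by rewrite ler_wpM2l ?mulr_ge0 ?(ltW a0).
  have : a * N%:R * kap1 = a * (delta * N%:R / 2) * kap ^+ n.+1 - a * N%:R * (delta * kap ^+
    n.+1 / 4).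
    by rewrite /kap1; field.
  lra.
have mu0 : 0 <= a * N%:R * kap1 by apply: mulr_ge0; [apply: mulr_ge0|]; exact: ltW.
have H := Lpnorm_lower p0 (ler0n R k.+1) mu0 r0 Lp low.
have muE : a * N%:R * kap1 = q / theta `^ p^-1.
  have := powR_gt0 p^-1 th0; rewrite /q /a; set z := theta `^ _; set w := C ^+ _ in C0 * => z0.
  by field; rewrite !gt_eqF.
rewrite muE in H.
apply: (@powR_contradiction _ q theta ((2 * r) ^+ n.+1) k.+1%:R p b k.+1) => //.
- exact: ltW.
- by rewrite le_max lexx orbT.
- by apply: le_lt_trans HM; rewrite le_eqVlt; apply/orP; left; apply/eqP; rewrite /theta; ring.
Qed.

End NowhereDense.

Theorem theorem1p1 (R : realType) (d : nat) :
  (0 < d)%N -> first_category_S (@SymM R d).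
Proof.
case: d => // n _; exists (@bounded_level R n); split; first exact: nowhere_dense_bounded_level.
by move=> m /SymM_bounded_level[k hk]; exists k.
Qed.
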